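(* Let $\boldsymbol u$ be the total displacement field of the elastic scattering problem for the periodic rigid surface $S$ illuminated by the compressional plane wave $\boldsymbol u_{\rm inc}$, as described in the context, and let $e_1^{(n)}$ and $e_2^{(n)}$ be the grating efficiencies of the $n$-th order reflected compressional and shear modes. Then the total energy is conserved, i.e. $$\sum_{n\in U_1}e_1^{(n)}+\sum_{n\in U_2}e_2^{(n)}=1 .$$
   Context: Parameters. $\omega>0$ is the angular frequency; the Lamé constants satisfy $\mu>0$, $\lambda+\mu>0$; $\kappa_1=\omega/\sqrt{\lambda+2\mu}$, $\kappa_2=\omega/\sqrt{\mu}$; $\theta\in(-\pi/2,\pi/2)$; $\alpha=\kappa_1\sin\theta$, $\beta=\kappa_1\cos\theta$. The incident field is $\boldsymbol u_{\rm inc}(x,y)=[\sin\theta,-\cos\theta]^\top e^{{\rm i}(\alpha x-\beta y)}$. $\Lambda>0$ is the period, $\alpha_n=\alpha+2\pi n/\Lambda$ for $n\in\mathbb Z$, and for $j=1,2$ $$\beta_j^{(n)}=(\kappa_j^2-\alpha_n^2)^{1/2}\ \text{ if }|\alpha_n|<\kappa_j,\qquad \beta_j^{(n)}={\rm i}(\alpha_n^2-\kappa_j^2)^{1/2}\ \text{ if }|\alpha_n|>\kappa_j .$$ It is assumed that $\kappa_j\neq|\alpha_n|$ for all $n\in\mathbb Z$, $j=1,2$. Set $U_j=\{n\in\mathbb Z:|\alpha_n|<\kappa_j\}$ and $\chi^{(n)}=\alpha_n^2+\beta_1^{(n)}\beta_2^{(n)}$. Geometry. $S$ is a Lipschitz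 continuous surface (curve), $\Lambda$-periodic in $x$, lying below the line $y=b$. $\Gamma=\{(x,y):0<x<\Lambda,\ y=b\}$, $\Omega$ is the bounded domain (one period) enclosed from below by $S$ and from above by $\Gamma$, and $\Omega^{\rm e}=\{(x,y):0<x<\Lambda,\ y>b\}$. Scattering problem. The total field $\boldsymbol u=[u_1,u_2]^\top$ satisfies the Navier equation $\mu\Delta\boldsymbol u+(\lambda+\mu)\nabla\nabla\cdot\boldsymbol u+\omega^2\boldsymbol u=0$ in the region above $S$, $\boldsymbol u=0$ on $S$, $\boldsymbol u$ is quasi-periodic ($\boldsymbol u(x,y)e^{-{\rm i}\alpha x}$ is $\Lambda$-periodic in $x$), and in $\Omega^{\rm e}$ the diffracted field $\boldsymbol v=\boldsymbol u-\boldsymbol u_{\rm inc}$ consists of bounded outgoing waves. That is, in $\Omega^{\rm e}$, $\boldsymbol v=\nabla\phi_1+{\bf curl}\,\phi_2$ with ${\bf curl}\,\phi=[\partial_y\phi,-\partial_x\phi]^\top$ and $$\phi_j(x,y)=\sum_{n\in\mathbb Z}\phi_j^{(n)}(b)e^{{\rm i}(\alpha_nx+\beta_j^{(n)}(y-b))},\quad y>b .$$ With $\boldsymbol v(x,b)=\sum_n\boldsymbol v^{(n)}(b)e^{{\rm i}\alpha_nx}$, the coefficients are $$\phi_1^{(n)}(b)=-\tfrac{\rm i}{\chi^{(n)}}\bigl(\alpha_nv_1^{(n)}(b)+\beta_2^{(n)}v_2^{(n)}(b)\bigr),\qquad \phi_2^{(n)}(b)=-\tfrac{\rm i}{\chi^{(n)}}\bigl(\beta_1^{(n)}v_1^{(n)}(b)-\alpha_nv_2^{(n)}(b)\bigr).$$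 Grating efficiencies. Put $r_0=-{\rm i}/\kappa_1$, $r_j^{(n)}=\phi_j^{(n)}(b)e^{-{\rm i}\beta_j^{(n)}b}$ for $j=1,2$, and $$e_1^{(n)}=\frac{\beta_1^{(n)}|r_1^{(n)}|^2}{\beta|r_0|^2},\qquad e_2^{(n)}=\frac{\beta_2^{(n)}|r_2^{(n)}|^2}{\beta|r_0|^2}.$$ *)

(* Defs.v *)
From HB Require Import structures.
From mathcomp Require Import all_boot all_order all_algebra.
From mathcomp Require Import all_classical all_reals all_analysis.
From mathcomp.real_closed Require Import complex.
Set Implicit Arguments.
Unset Strict Implicit.
Unset Printing Implicit Defensive.
Import Order.TTheory GRing.Theory Num.Theory numFieldNormedType.Exports.
Local Open Scope classical_set_scope.
Local Open Scope complex_scope.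
Local Open Scope ring_scope.

Notation Cre := (@complex.Re _).
Notation Cim := (@complex.Im _).

Definition ci {R : realType} : R[i] := 0 +i* 1.

Definition cexp {R : realType} (z : R[i]) : R[i] :=
  (expR (Cre z))%:C * (cos (Cim z) +i* sin (Cim z)).

Definition normsq {R : realType} (z : R[i]) : R := Cre z ^+ 2 + Cim z ^+ 2.

(* A field is a total function on the plane; its values below the surface are junk. *)
Notation cfield R := ((R * R)%type -> R[i]).
Notation vfield R := ((cfield R * cfield R)%type).

Definition vsub {R : realType} (u w : vfield R) : vfield R :=
  (fun p => u.1 p - w.1 p, fun p => u.2 p - w.2 p).

Definition dx {R : realType} (f : R * R -> R) (p : R * R) : R :=
  derive1 (fun t : R => f (t, p.2)) p.1.
Definition dy {R : realType} (f : R * R -> R) (p : R * R) : R :=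
  derive1 (fun t : R => f (p.1, t)) p.2.

Definition C1_on {R : realType} (D : set (R * R)) (f : R * R -> R) : Prop :=
  forall p, D p ->
    [/\ derivable (fun t : R => f (t, p.2)) p.1 1,
        derivable (fun t : R => f (p.1, t)) p.2 1,
        {for p, continuous (dx f)} & {for p, continuous (dy f)}].
Definition C2_on {R : realType} (D : set (R * R)) (f : R * R -> R) : Prop :=
  [/\ C1_on D f, C1_on D (dx f) & C1_on D (dy f)].

Definition cC1_on {R : realType} (D : set (R * R)) (f : cfield R) : Prop :=
  C1_on D (Cre \o f) /\ C1_on D (Cim \o f).
Definition cC2_on {R : realType} (D : set (R * R)) (f : cfield R) : Prop :=
  C2_on D (Cre \o f) /\ C2_on D (Cim \o f).

Definition cdx {R : realType} (f : cfield R) : cfield R :=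
  fun p => dx (Cre \o f) p +i* dx (Cim \o f) p.
Definition cdy {R : realType} (f : cfield R) : cfield R :=
  fun p => dy (Cre \o f) p +i* dy (Cim \o f) p.

Definition laplace {R : realType} (f : cfield R) : cfield R :=
  fun p => cdx (cdx f) p + cdy (cdy f) p.
Definition divergence {R : realType} (u : vfield R) : cfield R :=
  fun p => cdx u.1 p + cdy u.2 p.

Definition cint {R : realType} (a c : R) (f : R -> R[i]) : R[i] :=
  Rintegral lebesgue_measure `[a, c] (Cre \o f)
    +i* Rintegral lebesgue_measure `[a, c] (Cim \o f).

(* Convergence of a series indexed by the integers, through its symmetric
   partial sums over -N, ..., N. *)
Definition psumZ {R : realType} (F : int -> R[i]) (N : nat) : R[i] :=
  \sum_(0 <= k < N.*2.+1) F (k%:Z - N%:Z).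
Definition seriesZ_to {R : realType} (F : int -> R[i]) (l : R[i]) : Prop :=
  (fun N => Cre (psumZ F N)) @ \oo --> Cre l /\
  (fun N => Cim (psumZ F N)) @ \oo --> Cim l.

Record params (R : realType) := Params {
  omega : R; lambda : R; mu : R;  (* frequency and Lame constants *)
  theta : R;                      (* incidence angle *)
  Lam : R;                        (* period *)
  hgt : R                         (* height b of the line Gamma *)
}.

Section Quantities.
Context {R : realType} (P : params R).

Definition kappa1 : R := omega P / Num.sqrt (lambda P + 2 * mu P).
Definition kappa2 : R := omega P / Num.sqrt (mu P).
Definition alpha : R := kappa1 * sin (theta P).
Definition beta : R := kappa1 * cos (theta P).

Definition uinc : vfield R :=
  let E (p : R * R) := cexp (ci * (alpha * p.1 - beta * p.2)%:C) in
  (fun p => (sin (theta P))%:C * E p, fun p => (- cos (theta P))%:C * E p).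

Definition alphan (n : int) : R := alpha + 2 * pi * n%:~R / Lam P.

Definition betan (kappa : R) (n : int) : R[i] :=
  if `|alphan n| < kappa then (Num.sqrt (kappa ^+ 2 - alphan n ^+ 2))%:C
  else ci * (Num.sqrt (alphan n ^+ 2 - kappa ^+ 2))%:C.
Definition beta1 := betan kappa1.
Definition beta2 := betan kappa2.

Definition U (kappa : R) : set int := [set n | `|alphan n| < kappa].
Definition U1 := U kappa1.
Definition U2 := U kappa2.

Definition chi (n : int) : R[i] := (alphan n ^+ 2)%:C + beta1 n * beta2 n.

Definition admissible : Prop :=
  [/\ 0 < omega P, 0 < mu P, 0 < lambda P + mu P, 0 < Lam P
    & - (pi / 2) < theta P < pi / 2] /\
  (forall n : int, kappa1 != `|alphan n| /\ kappa2 != `|alphan n|).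

(* Whenever S lies below the line y = b, this component of the complement of S
   contains that whole line and everything above it. *)
Definition region_above (S : set (R * R)) : set (R * R) :=
  connected_component (~` S) (0, hgt P).

(* Near each of its points p, and in suitably rotated coordinates centred at p,
   S is the graph of a Lipschitz function g, and D is what lies above that graph. *)
Definition lipschitz_boundary (S D : set (R * R)) : Prop :=
  forall p, S p ->
    exists (phi r : R) (g : R -> R),
      [/\ 0 < r, (exists k : R, k.-lipschitz g) &
        forall q, ball p r q ->
          let s := cos phi * (q.1 - p.1) + sin phi * (q.2 - p.2) in
          let t := - sin phi * (q.1 - p.1) + cos phi * (q.2 - p.2) in
          (S q <-> t = g s) /\ (D q <-> g s < t)].

Definition Omega (S : set (R * R)) : set (R * R) :=
  [set p | [/\ region_above S p, 0 < p.1 < Lam P & p.2 < hgt P]].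
Definition Omega_e : set (R * R) :=
  [set p | 0 < p.1 < Lam P /\ hgt P < p.2].

Definition periodic_surface (S : set (R * R)) : Prop :=
  [/\ closed S, connected S,
      (forall x y, S (x + Lam P, y) <-> S (x, y)),
      (forall p, S p -> p.2 < hgt P) &
      lipschitz_boundary S (region_above S)] /\
  bounded_set (Omega S).

Definition navier (D : set (R * R)) (u : vfield R) : Prop :=
  forall p, D p ->
    (mu P)%:C * laplace u.1 p + (lambda P + mu P)%:C * cdx (divergence u) p
      + (omega P ^+ 2)%:C * u.1 p = 0 /\
    (mu P)%:C * laplace u.2 p + (lambda P + mu P)%:C * cdy (divergence u) p
      + (omega P ^+ 2)%:C * u.2 p = 0.

Definition quasi_periodic (D : set (R * R)) (f : cfield R) : Prop :=
  forall x y, D (x, y) ->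
    f (x + Lam P, y) * cexp (- (ci * (alpha * (x + Lam P))%:C)) =
    f (x, y) * cexp (- (ci * (alpha * x)%:C)).

Definition H1normsq (A : set (R * R)) (f : cfield R) : \bar R :=
  (\int[(lebesgue_measure \x lebesgue_measure)]_(p in A)
     (normsq (f p) + normsq (cdx f p) + normsq (cdy f p))%:E)%E.

(* The condition f = 0 on S for a quasi-periodic function f of class H^1 near S,
   in the sense of traces: f is an H^1(Omega)-limit of quasi-periodic functions
   that are continuous up to S and vanish there pointwise.  When f is itself
   continuous up to S, and 0 on it, the constant sequence qualifies, so the
   classical boundary condition is covered. *)
Definition zero_trace (S : set (R * R)) (f : cfield R) : Prop :=
  let D := region_above S in
  exists w : nat -> cfield R,
    (forall k, [/\ cC1_on D (w k), quasi_periodic D (w k),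
        {within D `|` S, continuous (Cre \o w k)},
        {within D `|` S, continuous (Cim \o w k)} &
        forall p, S p -> w k p = 0]) /\
    H1normsq (Omega S) (fun p => f p - w k p) @[k --> \oo] --> (0 : \bar R).

Section Diffracted.
Variable u : vfield R.

Definition diffracted : vfield R := vsub u uinc.

(* Coefficients of the expansion of v(x, b) in the functions e^{i alpha_n x}. *)
Definition trace_coef (f : cfield R) (n : int) : R[i] :=
  ((Lam P)^-1)%:C *
  cint 0 (Lam P) (fun x => f (x, hgt P) * cexp (- (ci * (alphan n * x)%:C))).
Definition v1n := trace_coef diffracted.1.
Definition v2n := trace_coef diffracted.2.

Definition phi1n (n : int) : R[i] :=
  - (ci / chi n) * ((alphan n)%:C * v1n n + beta2 n * v2n n).
Definition phi2n (n : int) : R[i] :=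
  - (ci / chi n) * (beta1 n * v1n n - (alphan n)%:C * v2n n).

Definition rayleigh_mode (betaj phin : int -> R[i]) (p : R * R) (n : int) : R[i] :=
  phin n * cexp (ci * ((alphan n * p.1)%:C + betaj n * (p.2 - hgt P)%:C)).

Definition outgoing : Prop :=
  exists phi1 phi2 : cfield R,
    (forall p, hgt P < p.2 ->
       seriesZ_to (rayleigh_mode beta1 phi1n p) (phi1 p) /\
       seriesZ_to (rayleigh_mode beta2 phi2n p) (phi2 p)) /\
    (forall p, Omega_e p ->
       diffracted.1 p = cdx phi1 p + cdy phi2 p /\
       diffracted.2 p = cdy phi1 p - cdx phi2 p).

Definition r0 : R[i] := - ci / kappa1%:C.
Definition r1 (n : int) : R[i] := phi1n n * cexp (- (ci * beta1 n * (hgt P)%:C)).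
Definition r2 (n : int) : R[i] := phi2n n * cexp (- (ci * beta2 n * (hgt P)%:C)).

Definition e1 (n : int) : R[i] := beta1 n * `|r1 n| ^+ 2 / (beta%:C * `|r0| ^+ 2).
Definition e2 (n : int) : R[i] := beta2 n * `|r2 n| ^+ 2 / (beta%:C * `|r0| ^+ 2).

End Diffracted.

(* This is the notion of an H^1 (variational) solution: such solutions are smooth
   inside the region by interior elliptic regularity, so the Navier equation can
   be read pointwise there, and only the condition on S needs traces. *)
Definition scattering_solution (S : set (R * R)) (u : vfield R) : Prop :=
  let D := region_above S in
  [/\ cC2_on D u.1 /\ cC2_on D u.2,
      navier D u,
      (H1normsq (Omega S) u.1 < +oo)%E /\ (H1normsq (Omega S) u.2 < +oo)%E,
      zero_trace S u.1 /\ zero_trace S u.2 &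
      (quasi_periodic D u.1 /\ quasi_periodic D u.2) /\ outgoing u].

End Quantities.

(* Main.v *)
Require Import Defs.
From mathcomp Require Import all_boot all_order all_algebra.
From mathcomp Require Import all_classical all_reals all_analysis.
From mathcomp.real_closed Require Import complex.
From mathcomp Require Import measurable_realfun ring lra zify.
Set Implicit Arguments.
Unset Strict Implicit.
Unset Printing Implicit Defensive.
Import Order.TTheory GRing.Theory Num.Theory numFieldNormedType.Exports.
Import ComplexField.Normc.
Local Open Scope classical_set_scope.
Local Open Scope complex_scope.
Local Open Scope ring_scope.

(** Energy is conserved because the real and the imaginary part of the total
    field solve the same self-adjoint system. Writing T for the tensor
    mu grad a + (lambda + mu) (div a) I, whose divergence is the elastic
    operator, the field a . T b - b . T a built from the real part a and the
    imaginary part b is divergence free, so its flux through a horizontal line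
    is the same at every height. Three facts then give the identity.

    The flux vanishes ([scattering_flux_eq0]). The contributions of the two
    vertical sides of the period cell cancel by quasi-periodicity, and that of
    the surface vanishes by the boundary condition. The latter holds only in the
    sense of traces and the surface is rough, so the divergence theorem cannot
    be applied on the cell. The divergence identity is first tested with fields
    w that are continuous up to the surface and vanish on it: multiplied by a
    smooth cut-off of |w|^2 the flux extends by zero to a C1 field on a
    rectangle, and the cut-off is removed by dominated convergence
    ([cell_divergence]). The points of the cell where w vanishes do not matter
    since the gradient of w is zero at almost all of them
    ([ae_gradient_zero_set]). A limit in energy norm then replaces w by the
    solution ([pairing_integral_limit]). The rows of T are multiplied by a
    function of the height that descends to zero at the line y = b, so that no
    boundary term appears there ([flux_integral_eq0]).

    Above the line the field is the incident wave plus two Rayleigh series. The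
    data of the series are bounded and chi is bounded below for high orders, so
    the coefficients of the potentials have subexponential growth; since the
    modes decay exponentially in their order above the line, the series may be
    differentiated term by term ([mode_sum_dx], [mode_sum_dy]). All evanescent
    orders have decay rates bounded below, so up to an error exponentially small
    in the height the displacement and its traction are trigonometric sums over
    the finitely many propagating orders ([mode_sum_asymptotic]).

    By orthogonality the flux of these sums is a sum over the orders
    ([trig_cross_integral]). In each order the cross terms between compressional
    and shear waves and between reflected and incident waves cancel, and the
    dispersion relations leave omega^2 times the difference between reflected
    and incident energy ([flux_algebra]), a number that does not depend on the
    height. Being exponentially small for large heights, their sum is zero
    ([energy_balance]); dividing by the incident energy gives the theorem. *)

(** * Planar sets *)

Lemma continuous_pair (T : topologicalType) (R : realType) (f g : T -> R) (t : T) :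
  {for t, continuous f} -> {for t, continuous g} ->
  {for t, continuous (fun t => (f t, g t) : R * R)}.
Proof. by move=> cf cg; exact: (cvg_pair cf cg). Qed.

Lemma star_connected (R : realType) (A : set (R * R)) (p : R * R) : A p ->
  (forall q t, A q -> t \in `[0, 1] ->
     A (p.1 + t * (q.1 - p.1), p.2 + t * (q.2 - p.2))) -> connected A.
Proof.
move=> Ap Astar.
pose seg (q : R * R) := (fun t : R => (p.1 + t * (q.1 - p.1), p.2 + t * (q.2 - p.2))) @` `[0, 1].
have -> : A = \bigcup_(q in A) seg q.
  apply/seteqP; split => [q Aq|q [r Ar [t t01 <-]]]; last exact: Astar.
  exists q => //; exists 1; first by rewrite /= in_itv/= ler01 lexx.
  by rewrite !mul1r !(addrC _ (_ - _)) !subrK; case: q {Aq}.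
apply: bigcup_connected.
  exists p => q Aq; exists 0; first by rewrite /= in_itv/= ler01 lexx.
  by rewrite !mul0r !addr0; case: p {Ap Astar seg Aq}.
move=> q Aq; apply: connected_continuous_connected.
  exact: segment_connected.
have cseg (a b t : R) : {for t, continuous (fun t : R => a + t * b)}.
  by apply: cvgD; [exact: cvg_cst|apply: cvgM; [exact: cvg_id|exact: cvg_cst]].
by apply: continuous_subspaceT => t; exact: (continuous_pair (cseg _ _ t) (cseg _ _ t)).
Qed.

Lemma connected_plane_ball (R : realType) (p : R * R) (r : R) :
  connected (ball p r).
Proof.
have [r0|r0] := ltP 0 r; last first.
  suff -> : ball p r = set0 by exact: connected0.
  apply/seteqP; split => // q [/= + _]; rewrite /ball/= => h.
  by have := le_lt_trans (normr_ge0 _) (lt_le_trans h r0); rewrite ltxx.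
apply: (@star_connected _ _ p); first exact: ballxx.
have key a b t : `|a - b| < r -> t \in `[0, 1] -> `|a - (a + t * (b - a))| < r.
  move=> h /[!in_itv]/= /andP[t0 t1].
  rewrite opprD addrA subrr sub0r normrN normrM ger0_norm// distrC.
  by apply: le_lt_trans h; rewrite ler_piMl.
by move=> q t [/= h1 h2] t01; split; rewrite /ball/=; exact: key.
Qed.

(** Components of open planar sets are open because balls are connected. *)
Lemma component_open (R : realType) (A : set (R * R)) (x : R * R) :
  open A -> open (connected_component A x).
Proof.
move=> oA; rewrite openE => p Dp.
have Ap : A p by exact: connected_component_sub Dp.
have : nbhs p A by exact: open_nbhs_nbhs.
move=> /nbhs_ballP[r /= r0 rA]; apply/nbhs_ballP; exists r => // q pq.
apply: connected_component_trans Dp _.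
apply: (connected_component_max _ rA (@connected_plane_ball _ p r)) => //.
exact: ballxx.
Qed.

(** A ball is connected, so it meets only one component of [A]; hence the closure of
    a component of the complement of [S] adds only points of [S]. *)
Lemma component_ball (R : realType) (A : set (R * R)) (x p q : R * R) (r : R) :
  ball p r `<=` A -> ball p r q -> connected_component A x q ->
  ball p r `<=` connected_component A x.
Proof.
move=> rA pq Dq z pz; apply: connected_component_trans Dq _.
exact: (connected_component_max _ rA (@connected_plane_ball _ p r)).
Qed.

Lemma open_plane_measurable (R : realType) (A : set (R * R)) :
  open A -> measurable (A : set (measurableTypeR R * measurableTypeR R)).
Proof.
move=> oA.
pose box (q : rat * rat * (rat * rat)) : set (R * R) :=
  `](ratr q.1.1 : R), (ratr q.1.2 : R)[%classic `*` `](ratr q.2.1 : R), (ratr q.2.2 : R)[%classic.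
have -> : A = \bigcup_(q in [set q | box q `<=` A]) box q.
  apply/seteqP; split => [p Ap|p [q qA]]; last exact: qA.
  have : nbhs p A by exact: open_nbhs_nbhs.
  move=> /nbhs_ballP[r /= r0 rA].
  have ex1 (a : R) : exists q : rat * rat, [/\ a - r < ratr q.1, ratr q.1 < a,
      a < ratr q.2 & ratr q.2 < a + r].
    have [q1] := @rat_in_itvoo _ (a - r) a ltac:(by rewrite ltrBlDr ltrDl).
    rewrite in_itv/= => /andP[h1 h2].
    have [q2] := @rat_in_itvoo _ a (a + r) ltac:(by rewrite ltrDl).
    rewrite in_itv/= => /andP[h3 h4].
    by exists (q1, q2).
  have [q1 [a1 a2 a3 a4]] := ex1 p.1.
  have [q2 [b1 b2 b3 b4]] := ex1 p.2.
  exists (q1, q2) => /=; last by split; rewrite /= in_itv/=; apply/andP.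
  move=> z [/=]; rewrite !in_itv/= => /andP[z1 z2] /andP[z3 z4]; apply: rA.
  split; rewrite /ball/=; rewrite ltr_distlC.
    by rewrite (lt_trans a1 z1) (lt_trans z2 a4).
  by rewrite (lt_trans b1 z3) (lt_trans z4 b4).
rewrite bigcup_mkcond; apply: countable_bigcupT_measurable => [|q]; first exact: countableP.
by case: ifPn => // _; apply: measurableX; exact: measurable_itv.
Qed.

Lemma continuous_plane_measurable (R : realType) (D : set (R * R)) (f : R * R -> R) :
  open D -> (forall p, D p -> {for p, continuous f}) ->
  measurable_fun (D : set (measurableTypeR R * measurableTypeR R)) (f : _ -> measurableTypeR R).
Proof.
move=> oD cf; apply: (measurability _ (@measurable_realfun.RGenOpens.measurableE R)).
move=> _ [_ [a [b ->] <-]]; apply: open_plane_measurable.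
rewrite openE => p [Dp fp]; rewrite /interior.
apply: filterI; first exact: open_nbhs_nbhs.
apply: (cf p Dp); apply: open_nbhs_nbhs; split => //; exact: interval_open.
Qed.

(** * Continuously differentiable functions on planar sets *)

Section PlaneCalculus.
Context {R : realType}.
Implicit Types (D : set (R * R)) (f g : R * R -> R) (p : R * R).

(** A C1 function together with its partial derivatives. Keeping the derivatives as
    parameters lets sums and products of such functions be formed without
    computing [dx] and [dy], and continuity of [f] itself is part of the notion. *)
Definition C1w D f fx fy := forall p, D p ->
  [/\ {for p, continuous f},
      is_derive p.1 1 (fun t : R => f (t, p.2)) (fx p),
      is_derive p.2 1 (fun t : R => f (p.1, t)) (fy p),
      {for p, continuous fx} & {for p, continuous fy}].

Lemma C1w_cst D k : C1w D (cst k) (cst 0) (cst 0).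
Proof.
by move=> p Dp; split; try exact: cvg_cst; exact: is_derive_cst.
Qed.

Lemma C1wD D f fx fy g gx gy : C1w D f fx fy -> C1w D g gx gy ->
  C1w D (fun p => f p + g p) (fun p => fx p + gx p) (fun p => fy p + gy p).
Proof.
move=> hf hg p Dp; have [f1 f2 f3 f4 f5] := hf p Dp.
have [g1 g2 g3 g4 g5] := hg p Dp; split; try exact: cvgD.
- exact: is_deriveD.
- exact: is_deriveD.
Qed.

Lemma C1wM D f fx fy g gx gy : C1w D f fx fy -> C1w D g gx gy ->
  C1w D (fun p => f p * g p) (fun p => f p * gx p + fx p * g p)
                             (fun p => f p * gy p + fy p * g p).
Proof.
move=> hf hg [x y] Dp; have [/= f1 f2 f3 f4 f5] := hf _ Dp.
have [/= g1 g2 g3 g4 g5] := hg _ Dp; split => /=; try by [exact: cvgM|apply: cvgD; exact: cvgM].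
- by apply: is_derive_eq (is_deriveM f2 g2) _; rewrite /GRing.scale/=; ring.
- by apply: is_derive_eq (is_deriveM f3 g3) _; rewrite /GRing.scale/=; ring.
Qed.

Lemma C1w_ext D f fx fy g gx gy : open D ->
  (forall p, D p -> [/\ f p = g p, fx p = gx p & fy p = gy p]) ->
  C1w D f fx fy -> C1w D g gx gy.
Proof.
move=> oD fg hf p Dp; have [f1 f2 f3 f4 f5] := hf p Dp.
have [e1 e2 e3] := fg p Dp.
have nD : \near p, D p by exact: open_nbhs_nbhs.
have cont h k : (forall q, D q -> h q = k q) -> {for p, continuous h} ->
    {for p, continuous k}.
  move=> hk ch; rewrite /prop_for /continuous_at -(hk p Dp).
  apply: cvg_trans ch; apply: near_eq_cvg.
  by apply: filterS nD => q Dq; rewrite hk.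
split.
- by apply: cont f1 => q /fg[].
- rewrite -e2; apply: near_eq_is_derive f2.
  have : \forall t \near p.1, D (t, p.2).
    have c : {for p.1, continuous (fun t : R => (t, p.2) : R * R)}.
      by apply: continuous_pair; [exact: cvg_id|exact: cvg_cst].
    by apply: c; rewrite -surjective_pairing.
  by apply: filterS => t /fg[].
- rewrite -e3; apply: near_eq_is_derive f3.
  have : \forall t \near p.2, D (p.1, t).
    have c : {for p.2, continuous (fun t : R => (p.1, t) : R * R)}.
      by apply: continuous_pair; [exact: cvg_cst|exact: cvg_id].
    by apply: c; rewrite -surjective_pairing.
  by apply: filterS => t /fg[].
- by apply: cont f4 => q /fg[].
- by apply: cont f5 => q /fg[].
Qed.

Lemma C1w_comp D f fx fy (G G' : R -> R) : (forall t : R, is_derive t 1 G (G' t)) ->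
  continuous G' -> C1w D f fx fy ->
  C1w D (fun p => G (f p)) (fun p => G' (f p) * fx p) (fun p => G' (f p) * fy p).
Proof.
move=> dG cG hf p Dp; have [f1 f2 f3 f4 f5] := hf p Dp; split.
- apply: continuous_comp f1 _; apply/differentiable_continuous/derivable1_diffP.
  by have [] := dG (f p).
- by apply: (@is_derive1_comp _ G); rewrite -?surjective_pairing.
- by apply: (@is_derive1_comp _ G); rewrite -?surjective_pairing.
- by apply: cvgM f4; exact: continuous_comp f1 (cG _).
- by apply: cvgM f5; exact: continuous_comp f1 (cG _).
Qed.

Lemma C1w_snd D : C1w D snd (cst 0) (cst 1).
Proof.
move=> p Dp; split; try exact: cvg_cst; first exact: cvg_snd.
- exact: is_derive_cst.
- exact: is_derive_id.
Qed.

Lemma C1w_union D E f fx fy : C1w D f fx fy -> C1w E f fx fy -> C1w (D `|` E) f fx fy.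
Proof. by move=> h k p [/h|/k]. Qed.

(** Continuity comes from the mean value theorem along horizontal segments,
    where the horizontal derivative is bounded, and from derivability along
    the vertical line. *)
Lemma C1_on_C1w D f : open D -> C1_on D f -> C1w D f (dx f) (dy f).
Proof.
move=> oD hf p Dp; have [f1 f2 f3 f4] := hf p Dp; 
have d1 : is_derive p.1 1 (fun t : R => f (t, p.2)) (dx f p).
  by have := derivableP f1; rewrite -derive1E.
have d2 : is_derive p.2 1 (fun t : R => f (p.1, t)) (dy f p).
  by have := derivableP f2; rewrite -derive1E.
split; [|exact: d1|exact: d2|exact: f3|exact: f4].
have nD : nbhs p D by exact: open_nbhs_nbhs.
have nM : \forall q \near p, `|dx f q| < `|dx f p| + 1.
  have c : `|dx f q| @[q --> p] --> `|dx f p| by exact: cvg_norm f3.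
  by apply: (cvgr_lt _ c); rewrite ltrDl.
have [r /= r0 rD] : exists2 r, 0 < r & ball p r `<=` [set q | D q /\ `|dx f q| < `|dx f p| + 1].
  have : nbhs p [set q | D q /\ `|dx f q| < `|dx f p| + 1] by exact: filterI nD nM.
  by move=> /nbhs_ballP[r r0 rD]; exists r.
set M := _ + 1 in rD nM.
have M0 : 0 < M by rewrite /M ltr_wpDl.
have lip q : ball p r q -> `|f (p.1, q.2) - f q| <= M * `|p.1 - q.1|.
  move=> pq; have fq : f q = f (q.1, q.2) by rewrite -surjective_pairing.
  have ballq t : t \in `[Num.min p.1 q.1, Num.max p.1 q.1] -> ball p r (t, q.2).
    move=> tin; case: pq => pq1 pq2; split => //=; rewrite /ball/=.
    move: tin pq1; rewrite in_itv/= /ball/=.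
    have [_|_] := leP p.1 q.1 => /andP[t1 t2]; rewrite !ltr_distlC => /andP[h1 h2]; apply/andP; split; lra.
  have dq t : t \in `[Num.min p.1 q.1, Num.max p.1 q.1] ->
      is_derive t 1 (fun s => f (s, q.2)) (dx f (t, q.2)).
    by move=> /ballq/rD[/hf[/derivableP + _ _ _] _]; rewrite -derive1E.
  have cwq : {within `[Num.min p.1 q.1, Num.max p.1 q.1], continuous (fun s => f (s, q.2))}.
    apply: derivable_within_continuous => z zin; by have [] := dq z zin.
  have lem : Num.min p.1 q.1 <= Num.max p.1 q.1 by rewrite ge_min !le_max !lexx.
  have dq' t : t \in `]Num.min p.1 q.1, Num.max p.1 q.1[ ->
      is_derive t 1 (fun s => f (s, q.2)) (dx f (t, q.2)).
    by move=> /subset_itv_oo_cc; exact: dq.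
  have [c cin] := MVT_segment lem dq' cwq.
  have [_ /ltW cM] := rD _ (ballq _ cin).
  have [pq1|pq1] := leP p.1 q.1 => e.
    rewrite distrC fq e normrM [`|p.1 - _|]distrC.
    by apply: ler_wpM2r.
  rewrite fq e normrM.
  by apply: ler_wpM2r.
have cy : f (p.1, q.2) @[q --> p] --> f p.
  have c : {for p.2, continuous (fun t => f (p.1, t))}.
    exact: (differentiable_continuous ((derivable1_diffP _ _).1 f2)).
  rewrite [X in _ --> f X]surjective_pairing.
  apply: (@cvg_comp _ _ _ snd (fun t => f (p.1, t)) _ _ _ _ c); exact: cvg_snd.
apply/cvgrPdist_lt => e e0.
have nx : \forall q \near p, M * `|p.1 - q.1| < e / 2.
  have cx : M * `|p.1 - q.1| @[q --> p] --> M * `|p.1 - p.1|.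
    apply: cvgM; first exact: cvg_cst.
    apply: cvg_norm; apply: cvgB; [exact: cvg_cst|exact: cvg_fst].
  apply: (cvgr_lt _ cx); rewrite subrr normr0 mulr0; lra.
have e20 : 0 < e / 2 by rewrite divr_gt0.
have /cvgrPdist_lt/(_ _ e20) ny := cy.
have nb : nbhs p (ball p r) by exact: nbhsx_ballx.
apply: filterS3 nx ny nb => q h1 h2 /lip h3.
have := ler_normD (f p - f (p.1, q.2)) (f (p.1, q.2) - f q).
rewrite addrA subrK; lra.
Qed.

End PlaneCalculus.

(** * Fubini and divergence theorems on rectangles *)

Section Rectangle.
Context {R : realType}.
Local Notation leb := (@lebesgue_measure R).
Local Notation leb2 := (leb \x leb)%E.
Local Notation plane := (measurableTypeR R * measurableTypeR R)%type.

Lemma continuous_rectangle_bounded (D : set (R * R)) (f : R * R -> R) (a b c d : R) :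
  `[a, b] `*` `[c, d] `<=` D -> (forall p, D p -> {for p, continuous f}) ->
  exists2 M, 0 < M & forall p, (`[a, b] `*` `[c, d]) p -> `|f p| <= M.
Proof.
move=> sD cf.
have cK : compact (`[a, b] `*` `[c, d] : set (R * R)).
  by apply: compact_setX; exact: segment_compact.
have cfK : compact (f @` (`[a, b] `*` `[c, d])).
  apply: continuous_compact cK.
  by apply: continuous_in_subspaceT => p /set_mem/sD; exact: cf.
have [M [_ hM]] := compact_bounded cfK.
exists (`|M| + 1); first by rewrite ltr_wpDl.
move=> p Kp; apply: (hM (`|M| + 1)); last by exists p.
by rewrite (le_lt_trans (ler_norm _)) // ltrDl.
Qed.

Lemma open_rectangle_measurable (a b c d : R) :
  measurable (`]a, b[ `*` `]c, d[ : set plane).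
Proof. by apply: measurableX; exact: measurable_itv. Qed.

Lemma rectangle_finite (a b c d : R) :
  (leb2 (`]a, b[ `*` `]c, d[ : set plane) < +oo)%E.
Proof.
have fin (x y : R) : exists r : R, leb `]x, y[ = r%:E.
  by rewrite lebesgue_measure_itv; case: ifPn => _; [exists (y - x)|exists 0].
have [r1 e1] := fin a b; have [r2 e2] := fin c d.
rewrite product_measure1E; [|exact: measurable_itv|exact: measurable_itv].
by rewrite [X in (X * _)%E]e1 [X in (_ * X)%E]e2 -EFinM ltry.
Qed.

Lemma continuous_rectangle_integrable (D : set (R * R)) (f : R * R -> R) (a b c d : R) :
  open D -> `[a, b] `*` `[c, d] `<=` D -> (forall p, D p -> {for p, continuous f}) ->
  leb2.-integrable (`]a, b[ `*` `]c, d[ : set plane) (EFin \o f).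
Proof.
move=> oD sD cf; have [M M0 fM] := continuous_rectangle_bounded sD cf.
apply: measurable_bounded_integrable.
- exact: open_rectangle_measurable.
- exact: rectangle_finite.
- apply: (measurable_funS (open_plane_measurable oD)).
    by move=> [x y] [/= /subset_itv_oo_cc h1 /subset_itv_oo_cc h2]; apply: sD.
  exact: continuous_plane_measurable.
- exists M; split; first by rewrite num_real.
  move=> N MN p [h1 h2]; apply: le_trans (ltW MN); apply: fM; split; exact: subset_itv_oo_cc.
Qed.

Let restrictE (f : R * R -> R) (a b c d x y : R) :
  ((EFin \o f) \_ (`]a, b[ `*` `]c, d[)) (x, y) =
  if (x \in `]a, b[) && (y \in `]c, d[) then (f (x, y))%:E else 0%E.
Proof.
rewrite patchE; case: ifPn => [/set_mem [/= hx hy]|/negP h]; first by rewrite hx hy.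
by case: ifPn => // /andP[hx hy]; case: h; rewrite inE.
Qed.

Section FubiniRect.
Variables (D : set (R * R)) (f : R * R -> R) (a b c d : R).
Hypothesis oD : open D.
Hypothesis sD : `[a, b] `*` `[c, d] `<=` D.
Hypothesis cf : forall p, D p -> {for p, continuous f}.

Let intf : leb2.-integrable setT ((EFin \o f) \_ (`]a, b[ `*` `]c, d[ : set plane)).
Proof.
apply/(integrable_mkcond _ (open_rectangle_measurable _ _ _ _)).
exact: (continuous_rectangle_integrable oD sD cf).
Qed.

Lemma rectangle_integral_xy :
  (\int[leb2]_(p in (`]a, b[ `*` `]c, d[ : set plane)) (f p)%:E =
   \int[leb]_(x in `]a, b[) \int[leb]_(y in `]c, d[) (f (x, y))%:E)%E.
Proof.
rewrite [LHS]integral_mkcond -(integral12_prod_meas1 intf) [RHS]integral_mkcond.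
apply: eq_integral => x _; rewrite patchE /fubini_F.
under eq_integral do rewrite restrictE.
case: ifPn => [/set_mem /= hx|/negP hx].
  rewrite [RHS]integral_mkcond; apply: eq_integral => y _.
  by rewrite patchE hx /=; rewrite mem_setE.
rewrite integral0_eq// => y _; case: ifPn => // /andP[h _].
by case: hx; rewrite inE.
Qed.

Lemma rectangle_integral_yx :
  (\int[leb2]_(p in (`]a, b[ `*` `]c, d[ : set plane)) (f p)%:E =
   \int[leb]_(y in `]c, d[) \int[leb]_(x in `]a, b[) (f (x, y))%:E)%E.
Proof.
rewrite [LHS]integral_mkcond -(integral21_prod_meas1 intf) [RHS]integral_mkcond.
apply: eq_integral => y _; rewrite patchE /fubini_G.
under eq_integral do rewrite restrictE.
case: ifPn => [/set_mem /= hy|/negP hy].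
  rewrite [RHS]integral_mkcond; apply: eq_integral => x _.
  by rewrite patchE hy andbT mem_setE.
rewrite integral0_eq// => x _; case: ifPn => // /andP[_ h].
by case: hy; rewrite inE.
Qed.

End FubiniRect.

(** The integral is over the open interval because Fubini's theorem is used on open
    cells. *)
Lemma integral_derive_oo (F f : R -> R) (a b : R) : a < b ->
  (forall x, x \in `[a, b] -> is_derive x 1 F (f x)) ->
  {within `[a, b], continuous f} ->
  (\int[leb]_(x in `]a, b[) (f x)%:E = (F b - F a)%:E)%E.
Proof.
move=> ab dF cf.
have cF : {within `[a, b], continuous F}.
  by apply: derivable_within_continuous => z /dF[].
rewrite EFinB -(@continuous_FTC2 _ f F a b ab cf); last 2 first.
- have [cF1 cF2 cF3] := (continuous_within_itvP F ab).1 cF.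
  split; [|exact: cF2|exact: cF3].
  by move=> x /subset_itv_oo_cc/dF[].
- by move=> x /subset_itv_oo_cc/dF h; rewrite derive1E; exact: derive_val.
have /measurable_EFinP mf : measurable_fun (`[a, b] : set (measurableTypeR R))
    (f : _ -> measurableTypeR R).
  by apply: subspace_continuous_measurable_fun.
rewrite integral_itv_obnd_cbnd ?integral_itv_bndo_bndc//.
- by apply: measurable_funS mf => //; apply: subset_itvl; rewrite bnd_simp.
- by apply: measurable_funS mf => //; exact: subset_itv_oo_cc.
Qed.

(** Periodicity of the horizontal component makes the two vertical sides cancel. *)
Lemma rectangle_divergence (D : set (R * R)) (a b c d : R)
    (X1 X1x X1y X2 X2x X2y : R * R -> R) :
  open D -> `[a, b] `*` `[c, d] `<=` D -> a < b -> c < d ->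
  C1w D X1 X1x X1y -> C1w D X2 X2x X2y ->
  (forall y, c <= y <= d -> X1 (a, y) = X1 (b, y)) ->
  (\int[leb2]_(p in (`]a, b[ `*` `]c, d[ : set plane)) (X1x p + X2y p)%:E =
   \int[leb]_(x in `]a, b[) (X2 (x, d) - X2 (x, c))%:E)%E.
Proof.
move=> oD sD ab cd h1 h2 per.
have sD' x y : x \in `[a, b] -> y \in `[c, d] -> D (x, y) by move=> hx hy; exact: sD.
have c1 p : D p -> {for p, continuous X1x} by move=> /h1[].
have c2 p : D p -> {for p, continuous X2y} by move=> /h2[].
under eq_integral do rewrite EFinD.
rewrite integralD //=; last 3 first.
- exact: open_rectangle_measurable.
- exact: (continuous_rectangle_integrable oD sD c1).
- exact: (continuous_rectangle_integrable oD sD c2).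
rewrite (rectangle_integral_yx oD sD c1) (rectangle_integral_xy oD sD c2).
rewrite integral0_eq ?add0e => [|y yin].
  apply: eq_integral => x /set_mem /= /subset_itv_oo_cc xin.
  apply: (integral_derive_oo (F := fun y => X2 (x, y)) (f := fun y => X2y (x, y)) cd).
    by move=> y yin; have [] := h2 (x, y) (sD' _ _ xin yin).
  apply: continuous_in_subspaceT => y /set_mem yin.
  apply: continuous_comp (c2 _ (sD' _ _ xin yin)).
  by apply: continuous_pair; [exact: cvg_cst|exact: cvg_id].
move: yin => /subset_itv_oo_cc yin.
transitivity (X1 (b, y) - X1 (a, y))%:E.
  apply: (integral_derive_oo (F := fun x => X1 (x, y)) (f := fun x => X1x (x, y)) ab).
    by move=> x xin; have [] := h1 (x, y) (sD' _ _ xin yin).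
  apply: continuous_in_subspaceT => x /set_mem xin.
  apply: continuous_comp (c1 _ (sD' _ _ xin yin)).
  by apply: continuous_pair; [exact: cvg_id|exact: cvg_cst].
by rewrite per ?subrr//; move: yin; rewrite /= in_itv.
Qed.

End Rectangle.

(** * Zero sets of differentiable functions and cut-offs *)

Section NullSets.
Context {R : realType}.
Local Notation leb := (@lebesgue_measure R).
Local Notation leb2 := (leb \x leb)%E.
Local Notation plane := (measurableTypeR R * measurableTypeR R)%type.

(** A zero where the derivative does not vanish is isolated; rational endpoints of
    isolating intervals enumerate such zeros. *)
Lemma simple_zeros_countable (h dh : R -> R) (Z : set R) :
  (forall x, Z x -> [/\ is_derive x 1 h (dh x), h x = 0 & dh x != 0]) -> countable Z.
Proof.
move=> hZ.
have iso x : Z x -> exists2 q : rat * rat, ratr q.1 < x < ratr q.2 &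
    forall t, Z t -> ratr q.1 < t < ratr q.2 -> t = x.
  move=> /[dup] Zx /hZ[[dx dxE] hx dx0].
  have : \forall s \near 0^', s^-1 *: (h (s *: 1 + x) - h x) != 0.
    by apply: (cvgr_neq0 ('D_1 h x)); [exact: dx|rewrite dxE].
  move=> /nbhs_ballP[r /= r0 hr].
  have [q1] := @rat_in_itvoo _ (x - r) x ltac:(by rewrite ltrBlDr ltrDl).
  rewrite in_itv/= => /andP[h1 h2].
  have [q2] := @rat_in_itvoo _ x (x + r) ltac:(by rewrite ltrDl).
  rewrite in_itv/= => /andP[h3 h4].
  exists (q1, q2) => /=; first by rewrite h2 h3.
  move=> t /hZ[_ ht _] /andP[t1 t2]; apply/eqP/negPn/negP => tx.
  have /= := hr (t - x); rewrite /ball/= sub0r normrN subr_eq0 => /(_ _ tx).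
  rewrite ltr_norml => /(_ ltac:(apply/andP; split; lra)).
  by rewrite [_ *: 1]mulr1 subrK ht hx subrr scaler0 eqxx.
pose Zq (q : rat * rat) := [set x | Z x /\ ratr q.1 < x < ratr q.2 /\
    forall t, Z t -> ratr q.1 < t < ratr q.2 -> t = x].
have -> : Z = \bigcup_(q in setT) Zq q.
  apply/seteqP; split => [x Zx|x [q _ []]//].
  by have [q q1 q2] := iso x Zx; exists q.
apply: bigcup_countable => [|q _]; first exact: countableP.
have [->|/set0P[x Zx]] := eqVneq (Zq q) set0; first exact: countable0.
apply: (@sub_countable _ _ _ [set x]); last exact: countable1.
by apply: subset_card_le => t [Zt [qt _]]; case: Zx => _ [_]; exact.
Qed.

Lemma null_of_ysections (N : set (R * R)) : measurable (N : set plane) ->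
  (forall y, countable [set x | N (x, y)]) -> leb2 (N : set plane) = 0%E.
Proof.
move=> mN cN; rewrite -(setIT N) -integral_indic//=.
have := @fubini_tonelli2 _ _ (measurableTypeR R) (measurableTypeR R) R leb leb
  (EFin \o \1_N); move=> ->; last 2 first.
- exact/measurable_EFinP.
- by move=> x /=; rewrite lee_fin.
rewrite integral0_eq// => y _; rewrite /fubini_G.
have c0 : leb [set x | N (x, y)] = 0%E by exact: countable_lebesgue_measure0.
have my : measurable ([set x | N (x, y)] : set (measurableTypeR R)).
  have := measurable_ysection y mN; congr (measurable _).
  by apply/seteqP; split => x; rewrite /ysection/= inE.
transitivity (\int[leb]_x (\1_[set x | N (x, y)] x)%:E)%E; last first.
  by rewrite integral_indic// setIT.
by apply: eq_integral => x _; rewrite /= !indicE; congr (_%:R%:E); apply/idP/idP; rewrite !inE.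
Qed.

Lemma null_of_xsections (N : set (R * R)) : measurable (N : set plane) ->
  (forall x, countable [set y | N (x, y)]) -> leb2 (N : set plane) = 0%E.
Proof.
move=> mN cN; rewrite -(setIT N) -integral_indic//=.
have := @fubini_tonelli1 _ _ (measurableTypeR R) (measurableTypeR R) R leb leb
  (EFin \o \1_N); move=> ->; last 2 first.
- exact/measurable_EFinP.
- by move=> x /=; rewrite lee_fin.
rewrite integral0_eq// => x _; rewrite /fubini_F.
have c0 : leb [set y | N (x, y)] = 0%E by exact: countable_lebesgue_measure0.
have my : measurable ([set y | N (x, y)] : set (measurableTypeR R)).
  have := measurable_xsection x mN; congr (measurable _).
  by apply/seteqP; split => y; rewrite /xsection/= inE.
transitivity (\int[leb]_y (\1_[set y | N (x, y)] y)%:E)%E; last first.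
  by rewrite integral_indic// setIT.
by apply: eq_integral => y _; rewrite /= !indicE; congr (_%:R%:E); apply/idP/idP; rewrite !inE.
Qed.

(** On every horizontal line the zeros of [w] where [wx] does not vanish are
    countable, so by Fubini's theorem they form a null set; likewise for [wy] on
    vertical lines. *)
Lemma ae_gradient_zero_set (D : set (R * R)) (w wx wy : R * R -> R) :
  open D -> C1w D w wx wy ->
  {ae leb2, forall p : plane, D p -> w p = 0 -> wx p = 0 /\ wy p = 0}.
Proof.
move=> oD hw.
have mD := open_plane_measurable oD.
have mw : measurable_fun (D : set plane) (w : plane -> measurableTypeR R).
  by apply: continuous_plane_measurable => // p /hw[].
have mwx : measurable_fun (D : set plane) (wx : plane -> measurableTypeR R).
  by apply: continuous_plane_measurable => // p /hw[].
have mwy : measurable_fun (D : set plane) (wy : plane -> measurableTypeR R).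
  by apply: continuous_plane_measurable => // p /hw[].
have mN (v : plane -> R) : measurable_fun (D : set plane) (v : plane -> measurableTypeR R) ->
    measurable ([set p | [/\ D p, w p = 0 & v p != 0]] : set plane).
  move=> mv.
  have := measurableI _ _ (mw mD [set 0] (measurable_set1 _))
    (mv mD (~` [set 0]) (measurableC (measurable_set1 _))).
  congr (measurable _); apply/seteqP; split => p /=.
    by move=> [[Dp w0] [_ /eqP v0]].
  by move=> [Dp w0 /eqP v0].
have ae0 (v : plane -> R) : measurable_fun (D : set plane) (v : plane -> measurableTypeR R) ->
    leb2 ([set p | [/\ D p, w p = 0 & v p != 0]] : set plane) = 0%E ->
    {ae leb2, forall p : plane, D p -> w p = 0 -> v p = 0}.
  move=> mv v0; exists [set p | [/\ D p, w p = 0 & v p != 0]]; split => //; first exact: mN.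
  by move=> p /= /not_implyP[Dp /not_implyP[w0 /eqP]].
have zx : {ae leb2, forall p : plane, D p -> w p = 0 -> wx p = 0}.
  apply: ae0 => //; apply: null_of_ysections; first exact: mN.
  move=> y; apply: (@simple_zeros_countable (fun x => w (x, y)) (fun x => wx (x, y))).
  by move=> x [Dp w0 w1]; have [_ ? _ _ _] := hw _ Dp.
have zy : {ae leb2, forall p : plane, D p -> w p = 0 -> wy p = 0}.
  apply: ae0 => //; apply: null_of_xsections; first exact: mN.
  move=> x; apply: (@simple_zeros_countable (fun y => w (x, y)) (fun y => wy (x, y))).
  by move=> y [Dp w0 w1]; have [_ _ ? _ _] := hw _ Dp.
by apply: filterS2 zx zy => p h1 h2 Dp w0; split; [exact: h1|exact: h2].
Qed.

End NullSets.

Section Cutoffs.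
Context {R : realType}.

(** A C1 function that is zero exactly on the negative half-line, from which the
    cut-offs are built. *)
Definition pos_sq (t : R) : R := Num.max 0 t ^+ 2.

Lemma continuous_pos_part : continuous (fun t : R => Num.max 0 t).
Proof. by move=> t; apply: continuous_max; [exact: cvg_cst|exact: cvg_id]. Qed.

Lemma is_derive_pos_sq (t : R) : is_derive t 1 pos_sq (2 * Num.max 0 t).
Proof.
have [t0|t0|->] : [\/ t < 0, 0 < t | t = 0].
  by case: (ltgtP t 0) => h; [constructor 1|constructor 2|constructor 3].
- rewrite max_l ?ltW// mulr0; apply: (@near_eq_is_derive _ _ _ (cst 0)).
  have : \forall s \near t, s < 0 by exact: lt_nbhsl.
  by apply: filterS => s s0; rewrite /pos_sq max_l ?ltW// expr0n.
- rewrite max_r ?ltW//; have n : \forall s \near t, s ^+ 2 = pos_sq s.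
    have : \forall s \near t, 0 < s by exact: lt_nbhsr.
    by apply: filterS => s s0; rewrite /pos_sq max_r ?ltW.
  have h := is_deriveX 2 (is_derive_id t 1).
  apply: (near_eq_is_derive n); apply: is_derive_eq h _.
  by rewrite /GRing.scale/= mulr1 expr1.
- rewrite max_l // mulr0.
  have lim0 : h^-1 *: (pos_sq (h *: 1 + 0) - pos_sq 0) @[h --> 0^'] --> (0 : R).
    apply/cvgrPdist_lt => e e0; apply/nbhs_ballP; exists e => //= h.
    rewrite /ball/= sub0r normrN => he h0.
    rewrite sub0r normrN [h *: 1]mulr1 addr0 /pos_sq (max_l (lexx _)) expr0n subr0 /GRing.scale/= normrM normfV.
    apply: le_lt_trans he.
    have [hn|hp] := leP h 0; first by rewrite expr0n normr0 mulr0.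
    by rewrite normrX expr2 mulrA mulVf ?mul1r// normr_eq0.
  apply: DeriveDef; first by apply/cvg_ex; exists 0.
  by apply: cvg_lim lim0.
Qed.

(** Zero up to [e] and tending to 1 on the positive half-line as [e] tends to 0,
    with [s * dcutoff e s] bounded uniformly in [e]. *)
Definition cutoff (e s : R) : R := pos_sq (s - e) / (pos_sq (s - e) + e ^+ 2).
Definition dcutoff (e s : R) : R :=
  2 * Num.max 0 (s - e) * e ^+ 2 / (pos_sq (s - e) + e ^+ 2) ^+ 2.

Lemma pos_sq_ge0 t : 0 <= pos_sq t.
Proof. exact: sqr_ge0. Qed.

Let den_gt0 (e s : R) : 0 < e -> 0 < pos_sq (s - e) + e ^+ 2.
Proof. by move=> e0; rewrite ltr_wpDl ?pos_sq_ge0 ?exprn_gt0. Qed.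

Lemma is_derive_cutoff (e s : R) : 0 < e -> is_derive s 1 (cutoff e) (dcutoff e s).
Proof.
move=> e0; have n0 : pos_sq (s - e) + e ^+ 2 != 0 by rewrite gt_eqF ?den_gt0.
have dq : is_derive s 1 (fun s => pos_sq (s - e)) (2 * Num.max 0 (s - e)).
  have h := @is_derive1_comp _ pos_sq (fun s => s - e) s _ _ (is_derive_pos_sq (s - e))
    (is_deriveB (is_derive_id s 1) (is_derive_cst e s 1)).
  by apply: is_derive_eq h _; rewrite subr0 mulr1.
have dd := is_deriveD dq (is_derive_cst (e ^+ 2) s 1).
have n0' : ((fun s => pos_sq (s - e)) + cst (e ^+ 2)) s != 0 by exact: n0.
have h := is_deriveM dq (is_deriveV n0' dd).
apply: is_derive_eq h _; rewrite /dcutoff /GRing.scale/= addr0.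
rewrite !fctE; field.
by rewrite n0.
Qed.

Lemma continuous_dcutoff (e : R) : 0 < e -> continuous (dcutoff e).
Proof.
move=> e0 s.
have cm : {for s, continuous (fun s => Num.max 0 (s - e))}.
  by apply: continuous_max; [exact: cvg_cst|apply: cvgB; [exact: cvg_id|exact: cvg_cst]].
apply: cvgM.
  by apply: cvgM; [apply: cvgM; [exact: cvg_cst|exact: cm]|exact: cvg_cst].
apply: cvgV; first by rewrite expf_neq0 ?gt_eqF ?den_gt0.
by apply: cvgM; (apply: cvgD; [apply: cvgM; exact: cm|exact: cvg_cst]).
Qed.

Lemma cutoff_eq0 (e s : R) : s <= e -> cutoff e s = 0.
Proof. by move=> se; rewrite /cutoff /pos_sq max_l ?subr_le0// expr0n mul0r. Qed.

Lemma dcutoff_eq0 (e s : R) : s <= e -> dcutoff e s = 0.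
Proof. by move=> se; rewrite /dcutoff max_l ?subr_le0// mulr0 !mul0r. Qed.

Lemma cutoff_itv (e s : R) : 0 < e -> 0 <= cutoff e s <= 1.
Proof.
move=> e0; apply/andP; split.
  by rewrite divr_ge0 ?pos_sq_ge0 ?ltW ?den_gt0.
by rewrite ler_pdivrMr ?den_gt0// mul1r lerDl sqr_ge0.
Qed.

Lemma dcutoff_bound (e s : R) : 0 < e -> 0 <= s * dcutoff e s <= 4.
Proof.
move=> e0; have [se|se] := leP s e; first by rewrite dcutoff_eq0 ?mulr0 ?lexx /=.
rewrite /dcutoff /pos_sq max_r ?subr_ge0 ?(ltW se)//.
set m := s - e; have m0 : 0 < m by rewrite subr_gt0.
have -> : s = m + e by rewrite subrK.
have d0 : 0 < m ^+ 2 + e ^+ 2 by rewrite addr_gt0 ?exprn_gt0.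
rewrite mulrA; apply/andP; split.
  apply: divr_ge0; last exact: sqr_ge0.
  by apply: mulr_ge0; [lra|apply: mulr_ge0; [lra|exact: sqr_ge0]].
rewrite ler_pdivrMr ?exprn_gt0//.
have h1 : 0 <= (m - e) ^+ 2 by exact: sqr_ge0.
have h2 : (m + e) * m <= 2 * (m ^+ 2 + e ^+ 2) by nra.
have h3 : e ^+ 2 <= m ^+ 2 + e ^+ 2 by nra.
have : (m + e) * m * e ^+ 2 <= 2 * (m ^+ 2 + e ^+ 2) * (m ^+ 2 + e ^+ 2).
  by apply: ler_pM => //; [apply: mulr_ge0; lra|exact: sqr_ge0].
lra.
Qed.

Lemma cutoff_cvg (s : R) : 0 < s -> cutoff n.+1%:R^-1 s @[n --> \oo] --> (1 : R).
Proof.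
move=> s0.
have h0 : (n.+1%:R^-1 : R) @[n --> \oo] --> (0 : R) by exact: cvg_harmonic.
have cm : Num.max 0 (s - n.+1%:R^-1) @[n --> \oo] --> s.
  have c : s - n.+1%:R^-1 @[n --> \oo] --> s.
    by rewrite -[X in _ --> X]subr0; apply: cvgB => //; exact: cvg_cst.
  have h := cvg_comp _ _ c (@continuous_pos_part s).
  by move: h; rewrite /= max_r ?ltW.
have cq : pos_sq (s - n.+1%:R^-1) @[n --> \oo] --> s ^+ 2 by apply: cvgM.
have cd : pos_sq (s - n.+1%:R^-1) + n.+1%:R^-1 ^+ 2 @[n --> \oo] --> s ^+ 2.
  rewrite -[X in _ --> X]addr0; apply: cvgD => //.
  by rewrite -[X in _ --> X](mulr0 0); apply: cvgM.
have n0 : s ^+ 2 != 0 by rewrite expf_neq0 ?gt_eqF.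
have : cutoff n.+1%:R^-1 s @[n --> \oo] --> s ^+ 2 / s ^+ 2.
  by apply: cvgM => //; exact: cvgV.
by rewrite divff.
Qed.

Lemma dcutoff_cvg (s : R) : 0 < s -> dcutoff n.+1%:R^-1 s @[n --> \oo] --> (0 : R).
Proof.
move=> s0.
have h0 : (n.+1%:R^-1 : R) @[n --> \oo] --> (0 : R) by exact: cvg_harmonic.
have cm : Num.max 0 (s - n.+1%:R^-1) @[n --> \oo] --> s.
  have c : s - n.+1%:R^-1 @[n --> \oo] --> s.
    by rewrite -[X in _ --> X]subr0; apply: cvgB => //; exact: cvg_cst.
  have h := cvg_comp _ _ c (@continuous_pos_part s).
  by move: h; rewrite /= max_r ?ltW.
have c2 : (n.+1%:R^-1 : R) ^+ 2 @[n --> \oo] --> (0 : R).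
  by rewrite -[X in _ --> X](mulr0 0); apply: cvgM.
have cq : pos_sq (s - n.+1%:R^-1) @[n --> \oo] --> s ^+ 2 by apply: cvgM.
have cd : pos_sq (s - n.+1%:R^-1) + n.+1%:R^-1 ^+ 2 @[n --> \oo] --> s ^+ 2.
  by rewrite -[X in _ --> X]addr0; apply: cvgD.
rewrite -[X in _ --> X](mul0r ((s ^+ 2) ^+ 2)^-1); apply: cvgM.
  by rewrite -[X in _ --> X](mulr0 (2 * s)); apply: cvgM => //; apply: cvgM => //; exact: cvg_cst.
by apply: cvgV; [rewrite !expf_neq0 ?gt_eqF|apply: cvgM].
Qed.

End Cutoffs.

(** * The divergence theorem on a cell with a rough lower boundary *)

Section ZeroTrace.
Context {R : realType}.
Local Notation leb := (@lebesgue_measure R).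
Local Notation leb2 := (leb \x leb)%E.
Local Notation plane := (measurableTypeR R * measurableTypeR R)%type.
Variables (D S : set (R * R)) (L top bot : R).
Hypothesis oD : open D.
Hypothesis cDS : closed (D `|` S).
Hypothesis L0 : 0 < L.
Hypothesis bot_top : bot < top.
Hypothesis Dbot : forall p, D p -> 0 <= p.1 <= L -> bot < p.2.
Hypothesis Dper : forall y, D (0, y) <-> D (L, y).

Definition cell : set (R * R) := [set p | [/\ D p, 0 < p.1 < L & p.2 < top]].

Lemma cell_open : open cell.
Proof.
have -> : cell = D `&` (fst @^-1` `]0, L[) `&` (snd @^-1` `]-oo, top[).
  by apply/seteqP; split => p /=; rewrite !in_itv/=; [move=> []|move=> [[]]].
apply: openI; first apply: openI => //.
  apply: open_comp => [p _|]; [exact: cvg_fst|exact: interval_open].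
apply: open_comp => [p _|]; [exact: cvg_snd|exact: interval_open].
Qed.

Lemma cell_measurable : measurable (cell : set plane).
Proof. exact: open_plane_measurable cell_open. Qed.

Lemma cellD p : cell p -> D p. Proof. by case. Qed.

Section CutField.
(* [s] stands for the squared modulus of a field vanishing on [S], and [(X1, X2)] for its flux. *)
Variables (s sx sy X1 X1x X1y X2 X2x X2y : R * R -> R).
Hypothesis hs : C1w D s sx sy.
Hypothesis hX1 : C1w D X1 X1x X1y.
Hypothesis hX2 : C1w D X2 X2x X2y.
Hypothesis s0 : forall p, D p -> 0 <= s p.
Hypothesis cs : {within D `|` S, continuous s}.
Hypothesis sS : forall p, S p -> s p = 0.
Hypothesis s_per : forall y, D (0, y) -> s (0, y) = s (L, y).
Hypothesis X_per : forall y, D (0, y) -> X1 (0, y) = X1 (L, y).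
Hypothesis X_top : forall x, X2 (x, top) = 0.

(** The cut-off of [s] is active only away from [S], so the extension by zero of
    the cut field is C1 on the whole plane. *)
Lemma C1w_cut (e : R) (Z Zx Zy : R * R -> R) : 0 < e -> C1w D Z Zx Zy ->
  C1w setT (fun p => if `[< D p >] then cutoff e (s p) * Z p else 0)
    (fun p => if `[< D p >] then cutoff e (s p) * Zx p + dcutoff e (s p) * sx p * Z p else 0)
    (fun p => if `[< D p >] then cutoff e (s p) * Zy p + dcutoff e (s p) * sy p * Z p else 0).
Proof.
move=> e0 hZ.
pose E : set (R * R) := interior [set q | D q -> s q <= e].
have oE : open E by exact: open_interior.
have -> : setT = D `|` E.
  apply/seteqP; split => // p _; have [Dp|nDp] := pselect (D p); first by left.
  right; rewrite /E/=.
  have [Sp|nSp] := pselect (S p); last first.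
    have : nbhs p (~` (D `|` S)).
      by apply: open_nbhs_nbhs; split; [exact: closed_openC|case].
    by apply: filterS => q nq Dq; case: nq; left.
  have /subspace_continuousP/(_ p (or_intror Sp)) := cs.
  move=> /cvgrPdist_lt/(_ e e0); rewrite near_withinE; apply: filterS => q h Dq.
  have : `|s p - s q| < e by exact: h (or_introl Dq).
  rewrite (sS Sp) sub0r normrN => /ltW.
  by apply: le_trans; exact: ler_norm.
apply: C1w_union.
  apply: (C1w_ext oD _ (C1wM (C1w_comp (fun t => @is_derive_cutoff _ e t e0) (continuous_dcutoff e0) hs) hZ)).
  by move=> p Dp; rewrite asboolT.
apply: (C1w_ext oE _ (@C1w_cst _ E 0)) => p Ep.
case: asboolP => // Dp; have se : s p <= e by exact: (interior_subset Ep).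
by rewrite cutoff_eq0// dcutoff_eq0// !mul0r addr0.
Qed.

(** The cell is enclosed in a rectangle on which the cut field is defined. *)
Lemma cell_divergence_cut (e : R) : 0 < e ->
  (\int[leb2]_(p in (cell : set plane))
    (cutoff e (s p) * (X1x p + X2y p) +
     dcutoff e (s p) * (sx p * X1 p + sy p * X2 p))%:E = 0)%E.
Proof.
move=> e0.
have h1 := C1w_cut e0 hX1; have h2 := C1w_cut e0 hX2.
have per y : bot <= y <= top ->
   (if `[< D (0, y) >] then cutoff e (s (0, y)) * X1 (0, y) else 0) =
   (if `[< D (L, y) >] then cutoff e (s (L, y)) * X1 (L, y) else 0).
  move=> _; case: asboolP => [Dy|nDy]; case: asboolP => [DLy|nDLy] //.
  - by rewrite s_per// X_per.
  - by case: nDLy; apply/Dper.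
  - by case: nDy; apply/Dper.
have := rectangle_divergence openT (@subsetT _ (`[0, L] `*` `[bot, top])) L0 bot_top h1 h2 per.
rewrite [X in _ = X -> _]integral0_eq; last first.
  move=> x /=; rewrite in_itv/= => /andP[x0 xL].
  rewrite X_top mulr0 if_same asboolF ?subrr// => /Dbot/=.
  by rewrite (ltW x0) (ltW xL) ltxx => /(_ isT).
move=> <-; rewrite integral_mkcond [RHS]integral_mkcond; apply: eq_integral => p _.
rewrite !patchE; case: ifPn => [/set_mem [Dp px py]|nOp].
  rewrite mem_set; last first.
    split; rewrite /= in_itv/= ?px// py andbT; apply: Dbot => //.
    by case/andP: px => /ltW -> /ltW ->.
  by rewrite asboolT//; congr (_%:E); ring.
case: ifPn => // /set_mem [/=]; rewrite !in_itv/= => px /andP[_ py].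
by case: asboolP => [Dp|_]; [case/negP: nOp; rewrite inE|rewrite addr0].
Qed.

Hypothesis ae_zero : {ae leb2, forall p : plane, cell p -> s p = 0 -> X1x p + X2y p = 0}.
Variable (h : R * R -> R).
Hypothesis ih : leb2.-integrable (cell : set plane) (EFin \o h).
Hypothesis div_le : forall p, cell p -> `|X1x p + X2y p| <= h p.
Hypothesis grad_le : forall p, cell p -> `|sx p * X1 p + sy p * X2 p| <= s p * h p.

Let mcont (f : R * R -> R) : (forall p, D p -> {for p, continuous f}) ->
  measurable_fun (cell : set plane) (f : plane -> measurableTypeR R).
Proof. by move=> cf; apply: continuous_plane_measurable cell_open _ => p /cellD; exact: cf. Qed.

(** Letting the cut-off threshold tend to zero; the terms carrying the derivative of
    the cut-off are dominated because they come with a factor [s]. *)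
Lemma cell_divergence : (\int[leb2]_(p in (cell : set plane)) (X1x p + X2y p)%:E = 0)%E.
Proof.
pose F n p := cutoff n.+1%:R^-1 (s p) * (X1x p + X2y p) +
     dcutoff n.+1%:R^-1 (s p) * (sx p * X1 p + sy p * X2 p).
have e0 n : 0 < n.+1%:R^-1 :> R by rewrite invr_gt0.
have cdiv p : D p -> {for p, continuous (fun p => X1x p + X2y p)}.
  by move=> Dp; have [_ _ _ ? _] := hX1 Dp; have [_ _ _ _ ?] := hX2 Dp; exact: cvgD.
have [] := @dominated_convergence _ plane R leb2 (cell : set plane) cell_measurable
  (fun n p => (F n p)%:E) (fun p => (X1x p + X2y p)%:E) (fun p => (5 * h p)%:E).
- move=> n; apply/measurable_EFinP; apply: mcont => p Dp.
  have [s1 _ _ s2 s3] := hs Dp.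
  have [x1 _ _ x2 _] := hX1 Dp; have [y1 _ _ _ y2] := hX2 Dp.
  apply: cvgD; apply: cvgM; [|exact: cdiv| |by apply: cvgD; exact: cvgM].
    apply: (continuous_comp s1); apply/differentiable_continuous/derivable1_diffP.
    by have [] := @is_derive_cutoff _ _ (s p) (e0 n).
  by apply: (continuous_comp s1); exact: (continuous_dcutoff (e0 n)).
- by apply/measurable_EFinP; apply: mcont.
- apply: filterS ae_zero => p hp cp.
  have sp0 : 0 <= s p by apply: s0; exact: cellD.
  have [sp|sp] := eqVneq (s p) 0.
    have -> : (fun n => (F n p)%:E) = cst 0%:E.
      apply/funext => n; rewrite /F sp cutoff_eq0 ?dcutoff_eq0 ?mul0r ?addr0 //;
      exact: ltW.
    by rewrite (hp cp sp); exact: cvg_cst.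
  have {}sp : 0 < s p by rewrite lt_neqAle eq_sym sp.
  apply: cvg_EFin; first by apply: nearW.
  have : (F n p) @[n --> \oo] --> 1 * (X1x p + X2y p) + 0 * (sx p * X1 p + sy p * X2 p).
    apply: cvgD; apply: cvgM; try exact: cvg_cst; [exact: cutoff_cvg|exact: dcutoff_cvg].
  by rewrite mul1r mul0r addr0.
- have -> : (fun p => (5 * h p)%:E) = (fun p => 5%:E * (h p)%:E)%E.
    by apply/funext => p; rewrite EFinM.
  by apply: integrableZl ih; exact: cell_measurable.
- apply: aeW => p n cp; rewrite lee_fin.
  have h0 : 0 <= h p by apply: le_trans (div_le cp).
  have sp0 : 0 <= s p by apply: s0; exact: cellD.
  have /andP[c0 c1] := cutoff_itv (s p) (e0 n).
  have /andP[d0 d1] := dcutoff_bound (s p) (e0 n).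
  rewrite /F; apply: (le_trans (ler_normD _ _)).
  rewrite [X in X + _]normrM [X in _ + X]normrM (ger0_norm c0).
  have k1 : cutoff n.+1%:R^-1 (s p) * `|X1x p + X2y p| <= 1 * h p.
    by apply: ler_pM => //; exact: div_le.
  have dc0 : 0 <= dcutoff n.+1%:R^-1 (s p).
    have [/dcutoff_eq0 ->//|se] := leP (s p) n.+1%:R^-1.
    by move: d0; rewrite pmulr_rge0// (lt_trans _ se).
  have k2 : `|dcutoff n.+1%:R^-1 (s p)| * `|sx p * X1 p + sy p * X2 p| <= 4 * h p.
    rewrite (ger0_norm dc0); apply: (le_trans (ler_wpM2l dc0 (grad_le cp))).
    by rewrite mulrA [dcutoff _ _ * _]mulrC; apply: ler_wpM2r.
  lra.
move=> _ _ lim; apply/esym; apply: (cvg_unique _ _ lim) => //.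
rewrite (_ : (fun n => _) = cst 0%E); first exact: cvg_cst.
by apply/funext => n; exact: cell_divergence_cut.
Qed.

End CutField.
End ZeroTrace.

(** * Testing with fields that vanish on the surface *)

Section WeakForm.
Context {R : realType}.
Local Notation leb := (@lebesgue_measure R).
Local Notation leb2 := (leb \x leb)%E.
Local Notation plane := (measurableTypeR R * measurableTypeR R)%type.

Lemma C1w_sum (D : set (R * R)) (I : Type) (r : seq I) (f fx fy : I -> R * R -> R) :
  (forall i, C1w D (f i) (fx i) (fy i)) ->
  C1w D (fun p => \sum_(i <- r) f i p) (fun p => \sum_(i <- r) fx i p)
        (fun p => \sum_(i <- r) fy i p).
Proof.
move=> hf; elim: r => [|i r IH].
  have e0 (F : I -> R * R -> R) : (fun p => \sum_(i <- [::]) F i p) = cst 0.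
    by apply/funext => p; rewrite big_nil.
  by rewrite !e0; exact: C1w_cst.
have e1 (F : I -> R * R -> R) :
    (fun p => \sum_(j <- i :: r) F j p) = (fun p => F i p + \sum_(j <- r) F j p).
  by apply/funext => p; rewrite big_cons.
by rewrite !e1; exact: C1wD.
Qed.

Lemma cvg_finite_sum (T I : Type) (F : set_system T) (FF : Filter F) (r : seq I)
    (f : I -> T -> R) (a : I -> R) : (forall i, f i x @[x --> F] --> a i) ->
  \sum_(i <- r) f i x @[x --> F] --> \sum_(i <- r) a i.
Proof. by move=> hf; apply: cvg_big => //; exact: add_continuous. Qed.

Lemma norm_sum_mul_le (n : nat) (a b : 'I_n -> R) (A B : R) :
  (forall l, `|a l| <= A) -> (forall l, `|b l| <= B) ->
  `|\sum_l a l * b l| <= n%:R * (A * B).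
Proof.
move=> aA bB; apply: (le_trans (ler_norm_sum _ _ _)).
apply: (@le_trans _ _ (\sum_(l < n) A * B)); last by rewrite sumr_const card_ord mulr_natl.
by apply: ler_sum => l _; rewrite normrM; apply: ler_pM.
Qed.

Lemma norm_le_sqrt_sum (n : nat) (a g : 'I_n -> R) (l : 'I_n) :
  (forall m, 0 <= g m) -> a l ^+ 2 <= g l -> `|a l| <= Num.sqrt (\sum_m g m).
Proof.
move=> g0 ag; rewrite -sqrtr_sqr ler_sqrt; last exact: sumr_ge0.
by rewrite (bigD1 l)//= ler_wpDr// sumr_ge0.
Qed.

Lemma young (t x y : R) : 0 < t -> `|x * y| <= (t * y ^+ 2 + x ^+ 2 / t) / 2.
Proof.
move=> t0; have i0 : 0 < t^-1 by rewrite invr_gt0.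
have e : t * t^-1 = 1 by rewrite divff ?gt_eqF.
have k1 : 0 <= t^-1 * (x - t * y) ^+ 2 by rewrite mulr_ge0 ?sqr_ge0 ?ltW.
have k2 : 0 <= t^-1 * (x + t * y) ^+ 2 by rewrite mulr_ge0 ?sqr_ge0 ?ltW.
have e1 : t^-1 * (x - t * y) ^+ 2 = x ^+ 2 / t - 2 * (x * y) * (t * t^-1) + t * y ^+ 2 * (t * t^-1).
  by ring.
have e2 : t^-1 * (x + t * y) ^+ 2 = x ^+ 2 / t + 2 * (x * y) * (t * t^-1) + t * y ^+ 2 * (t * t^-1).
  by ring.
rewrite e !mulr1 in e1 e2; rewrite ler_norml; apply/andP; split; lra.
Qed.

Variables (D S : set (R * R)) (L top bot : R) (n : nat).
Hypothesis oD : open D.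
Hypothesis cDS : closed (D `|` S).
Hypothesis L0 : 0 < L.
Hypothesis bot_top : bot < top.
Hypothesis Dbot : forall p, D p -> 0 <= p.1 <= L -> bot < p.2.
Hypothesis Dper : forall y, D (0, y) <-> D (L, y).
Local Notation cell := (cell D L top).

(** The flux field is [X = \sum_l w l * (Y1 l, Y2 l)]. *)
Variables (Y1 Y1x Y1y Y2 Y2x Y2y : 'I_n -> R * R -> R).
Hypothesis hY1 : forall l, C1w D (Y1 l) (Y1x l) (Y1y l).
Hypothesis hY2 : forall l, C1w D (Y2 l) (Y2x l) (Y2y l).
Hypothesis Y_top : forall l x, Y2 l (x, top) = 0.

(** The density of the squared H1 norm of [w] when [wx], [wy] are its derivatives; used for
    the triples ([divY], [Y1], [Y2]) as well. *)
Definition energy (w wx wy : 'I_n -> R * R -> R) (p : R * R) : R :=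
  \sum_l (w l p ^+ 2 + wx l p ^+ 2 + wy l p ^+ 2).
Definition divY (l : 'I_n) (p : R * R) : R := Y1x l p + Y2y l p.
(** The divergence of the flux field [X]. *)
Definition pairing (w wx wy : 'I_n -> R * R -> R) (p : R * R) : R :=
  \sum_l (wx l p * Y1 l p + wy l p * Y2 l p + w l p * divY l p).
Local Notation energyY := (energy divY Y1 Y2).

Lemma energy_ge0 w wx wy p : 0 <= energy w wx wy p.
Proof. by apply: sumr_ge0 => l _; rewrite !addr_ge0 ?sqr_ge0. Qed.

Hypothesis iY : leb2.-integrable (cell : set plane) (EFin \o energyY).

Let mcont (f : R * R -> R) : (forall p, D p -> {for p, continuous f}) ->
  measurable_fun (cell : set plane) (f : plane -> measurableTypeR R).
Proof.
move=> cf; have h p : cell p -> {for p, continuous f} by move=> /cellD; exact: cf.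
exact: continuous_plane_measurable (@cell_open _ D L top oD) h.
Qed.

Let cont_sum (F : 'I_n -> R * R -> R) p : (forall l, {for p, continuous (F l)}) ->
  {for p, continuous (fun q => \sum_l F l q)}.
Proof. by move=> h; apply: cvg_finite_sum => l; exact: h. Qed.

Let cont_sqr (f : R * R -> R) p : {for p, continuous f} -> {for p, continuous (fun q => f q ^+ 2)}.
Proof. by move=> h; apply: cvgM. Qed.

Lemma energy_continuous_measurable w wx wy :
  (forall l p, D p -> [/\ {for p, continuous (w l)}, {for p, continuous (wx l)} &
     {for p, continuous (wy l)}]) ->
  measurable_fun (cell : set plane) (energy w wx wy : plane -> measurableTypeR R).
Proof.
move=> hw; apply: mcont => p Dp; apply: cont_sum => l.
have [c1 c2 c3] := hw l p Dp.
by apply: cvgD; [apply: cvgD|]; exact: cont_sqr.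
Qed.

Lemma energy_measurable w wx wy : (forall l, C1w D (w l) (wx l) (wy l)) ->
  measurable_fun (cell : set plane) (energy w wx wy : plane -> measurableTypeR R).
Proof.
by move=> hw; apply: energy_continuous_measurable => i p Dp; have [c1 _ _ c2 c3] := hw i p Dp.
Qed.

Lemma pairing_measurable w wx wy : (forall l, C1w D (w l) (wx l) (wy l)) ->
  measurable_fun (cell : set plane) (pairing w wx wy : plane -> measurableTypeR R).
Proof.
move=> hw; apply: mcont => p Dp; apply: cont_sum => l.
have [c1 _ _ c2 c3] := hw l p Dp.
have [y1 _ _ y2 _] := hY1 l Dp; have [z1 _ _ _ z2] := hY2 l Dp.
by apply: cvgD; [apply: cvgD; exact: cvgM|apply: cvgM => //; exact: cvgD].
Qed.

(** In a limit the energy of [w] may tend to zero first, and the free parameter [t]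
    afterwards. *)
Lemma norm_pairing_le (t : R) w wx wy p : 0 < t ->
  `|pairing w wx wy p| <= (t * energyY p + energy w wx wy p / t) / 2.
Proof.
move=> t0; apply: (le_trans (ler_norm_sum _ _ _)).
rewrite /energy mulr_sumr mulr_suml -big_split/= mulr_suml; apply: ler_sum => l _.
apply: (le_trans (ler_normD _ _)).
apply: (le_trans (lerD (ler_normD _ _) (lexx _))).
have h1 := young (wx l p) (Y1 l p) t0.
have h2 := young (wy l p) (Y2 l p) t0.
have h3 := young (w l p) (divY l p) t0.
rewrite !mulrDr !mulrDl in h1 h2 h3 *; lra.
Qed.

Lemma pairing_integrable w wx wy : (forall l, C1w D (w l) (wx l) (wy l)) ->
  leb2.-integrable (cell : set plane) (EFin \o energy w wx wy) ->
  leb2.-integrable (cell : set plane) (EFin \o pairing w wx wy).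
Proof.
move=> hw iw.
have is2 : leb2.-integrable (cell : set plane) (EFin \o energyY \+ (EFin \o energy w wx wy))%E.
  by apply: integrableD iY iw; exact: (@cell_measurable _ D L top oD).
apply: le_integrable is2; first exact: (@cell_measurable _ D L top oD).
  by apply/measurable_EFinP; exact: pairing_measurable.
move=> p cp /=; rewrite lee_fin.
have := norm_pairing_le w wx wy p (@ltr01 R); rewrite mul1r divr1.
rewrite [X in _ -> _ <= X]ger0_norm ?addr_ge0 ?energy_ge0//.
have := energy_ge0 divY Y1 Y2 p; have := energy_ge0 w wx wy p; lra.
Qed.

(** The divergence theorem on the cell for [s = \sum_l w l ^ 2]. Both the flux and
    the gradient of [s] carry a factor of size [sqrt s], which gives the bound
    [s * h] needed there. *)
Lemma pairing_integral_eq0 (w wx wy : 'I_n -> R * R -> R) :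
  (forall l, C1w D (w l) (wx l) (wy l)) ->
  (forall l, {within D `|` S, continuous (w l)}) ->
  (forall l p, S p -> w l p = 0) ->
  (forall y, D (0, y) -> \sum_l w l (0, y) ^+ 2 = \sum_l w l (L, y) ^+ 2) ->
  (forall y, D (0, y) -> \sum_l w l (0, y) * Y1 l (0, y) = \sum_l w l (L, y) * Y1 l (L, y)) ->
  leb2.-integrable (cell : set plane) (EFin \o energy w wx wy) ->
  (\int[leb2]_(p in (cell : set plane)) (pairing w wx wy p)%:E = 0)%E.
Proof.
move=> hw cw wS pers perX iw.
have hs := C1w_sum (index_enum 'I_n) (fun l => C1wM (hw l) (hw l)).
have hX1 := C1w_sum (index_enum 'I_n) (fun l => C1wM (hw l) (hY1 l)).
have hX2 := C1w_sum (index_enum 'I_n) (fun l => C1wM (hw l) (hY2 l)).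
have pE p : pairing w wx wy p = \sum_l (w l p * Y1x l p + wx l p * Y1 l p) +
    \sum_l (w l p * Y2y l p + wy l p * Y2 l p).
  by rewrite -big_split/=; apply: eq_bigr => l _; rewrite /divY; ring.
under eq_integral do rewrite pE.
have hm := @cell_measurable _ D L top oD.
pose H p := energyY p + energy w wx wy p.
have iH : leb2.-integrable (cell : set plane) (EFin \o H).
  have -> : EFin \o H = (EFin \o energyY \+ (EFin \o energy w wx wy))%E by [].
  by apply: integrableD iY iw.
have H0 p : 0 <= H p by rewrite addr_ge0 ?energy_ge0.
pose c : R := 4 * n%:R * n%:R + 1.
apply: (@cell_divergence _ D S L top bot oD cDS L0 bot_top Dbot Dper _ _ _ _ _ _ _ _ _ hs hX1 hX2
   _ _ _ _ _ _ _ (fun p => c * H p)).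
- by move=> p Dp; apply: sumr_ge0 => l _; rewrite -expr2 sqr_ge0.
- by move=> p; apply: cvg_finite_sum => l; apply: cvgM; exact: cw.
- by move=> p Sp; apply: big1 => l _; rewrite wS// mul0r.
- by move=> y Dy; under eq_bigr do rewrite -expr2; rewrite pers//; under eq_bigr do rewrite expr2.
- exact: perX.
- by move=> x; apply: big1 => l _; rewrite Y_top mulr0.
- have : {ae leb2, forall p : plane, forall l, D p -> w l p = 0 -> wx l p = 0 /\ wy l p = 0}.
    by apply: filter_forall => l; exact: ae_gradient_zero_set.
  apply: filterS => p hp cp s0; have Dp := cellD cp.
  have wl l : w l p = 0.
    move/eqP: s0; rewrite psumr_eq0; last by move=> m _; rewrite -expr2 sqr_ge0.
    by move=> /allP/(_ l (mem_index_enum _)); rewrite mulf_eq0 orbb => /eqP.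
  rewrite -pE; apply: big1 => l _; have [-> ->] := hp l Dp (wl l).
  by rewrite wl !mul0r !addr0.
- have -> : (EFin \o (fun p => c * H p)) = (fun p => c%:E * (EFin \o H) p)%E.
    by apply/funext => p; rewrite /= EFinM.
  exact: integrableZl.
- move=> p cp; rewrite -pE; have := norm_pairing_le w wx wy p (@ltr01 R); rewrite mul1r divr1.
  have cH : H p <= c * H p.
    by rewrite ler_peMl// /c lerDr !mulr_ge0.
  have := H0 p; rewrite /H in cH *; lra.
- move=> p cp.
  set s := \sum_l w l p * w l p.
  have s0 : 0 <= s by apply: sumr_ge0 => l _; rewrite -expr2 sqr_ge0.
  have ws l : `|w l p| <= Num.sqrt s.
    by apply: (@norm_le_sqrt_sum _ (fun l => w l p) (fun l => w l p * w l p)) => [m|]; rewrite /= -expr2 ?sqr_ge0.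
  have ew l : `|wx l p| <= Num.sqrt (energy w wx wy p) /\ `|wy l p| <= Num.sqrt (energy w wx wy p).
    have g0 m : 0 <= w m p ^+ 2 + wx m p ^+ 2 + wy m p ^+ 2 by rewrite !addr_ge0 ?sqr_ge0.
    have := sqr_ge0 (w l p); have := sqr_ge0 (wx l p); have := sqr_ge0 (wy l p) => h1 h2 h3.
    split; [apply: (@norm_le_sqrt_sum _ (fun l => wx l p)) => //|
            apply: (@norm_le_sqrt_sum _ (fun l => wy l p)) => //]; lra.
  have eY l : `|Y1 l p| <= Num.sqrt (energyY p) /\ `|Y2 l p| <= Num.sqrt (energyY p).
    have g0 m : 0 <= divY m p ^+ 2 + Y1 m p ^+ 2 + Y2 m p ^+ 2 by rewrite !addr_ge0 ?sqr_ge0.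
    have := sqr_ge0 (divY l p); have := sqr_ge0 (Y1 l p); have := sqr_ge0 (Y2 l p) => h1 h2 h3.
    split; [apply: (@norm_le_sqrt_sum _ (fun l => Y1 l p)) => //|
            apply: (@norm_le_sqrt_sum _ (fun l => Y2 l p)) => //]; lra.
  set a := Num.sqrt (energy w wx wy p) in ew; set b := Num.sqrt (energyY p) in eY.
  set t := Num.sqrt s in ws.
  have tE : t * t = s by rewrite -expr2 sqr_sqrtr.
  have aE : a ^+ 2 = energy w wx wy p by rewrite sqr_sqrtr ?energy_ge0.
  have bE : b ^+ 2 = energyY p by rewrite sqr_sqrtr ?energy_ge0.
  have key (v z : 'I_n -> R) : (forall l, `|v l| <= a) -> (forall l, `|z l| <= b) ->
     `|(\sum_l (w l p * v l + v l * w l p)) * \sum_l w l p * z l| <= 2 * n%:R * n%:R * (s * (a * b)).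
    move=> va zb.
    have -> : \sum_l (w l p * v l + v l * w l p) = 2 * \sum_l w l p * v l.
      by rewrite mulr_sumr; apply: eq_bigr => l _; ring.
    have k1 := norm_sum_mul_le ws va; have k2 := norm_sum_mul_le ws zb.
    rewrite !normrM (@ger0_norm _ 2)//.
    have -> : 2 * n%:R * n%:R * (s * (a * b)) = 2 * (n%:R * (t * a)) * (n%:R * (t * b)).
      by rewrite -tE; ring.
    by rewrite -[leLHS]mulrA -[leRHS]mulrA; apply: ler_wpM2l => //; exact: ler_pM.
  have k1 := key (wx^~ p) (Y1^~ p) (fun l => (ew l).1) (fun l => (eY l).1).
  have k2 := key (wy^~ p) (Y2^~ p) (fun l => (ew l).2) (fun l => (eY l).2).
  apply: (le_trans (ler_normD _ _)); apply: (le_trans (lerD k1 k2)).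
  have ab : a * b <= H p / 2.
    by have := sqr_ge0 (a - b); rewrite sqrrB aE bE /H; lra.
  have : s * (a * b) <= s * (H p / 2) by rewrite ler_wpM2l.
  have nn : 0 <= 4 * n%:R * n%:R :> R by rewrite !mulr_ge0.
  move=> h; have h2 := ler_wpM2l nn h; have h3 : 0 <= s * H p by rewrite mulr_ge0.
  have -> : s * (c * H p) = 4 * n%:R * n%:R * (s * (H p / 2)) * 2 + s * H p by rewrite /c; field.
  have -> : 2 * n%:R * n%:R * (s * (a * b)) = 4 * n%:R * n%:R * (s * (a * b)) / 2 by field.
  have h4 : 0 <= 4 * n%:R * n%:R * (s * (H p / 2)) by rewrite mulr_ge0// mulr_ge0// divr_ge0.
  lra.
Qed.

(** The boundary condition enters here: [v] is only a limit of fields vanishing on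
    [S], and the pairing is continuous for the energy norm. *)
Lemma pairing_integral_limit (v vx vy : 'I_n -> R * R -> R) (w wx wy : nat -> 'I_n -> R * R -> R) :
  (forall l, C1w D (v l) (vx l) (vy l)) ->
  leb2.-integrable (cell : set plane) (EFin \o energy v vx vy) ->
  (forall k l, C1w D (w k l) (wx k l) (wy k l)) ->
  (forall k l, {within D `|` S, continuous (w k l)}) ->
  (forall k l p, S p -> w k l p = 0) ->
  (forall k y, D (0, y) -> \sum_l w k l (0, y) ^+ 2 = \sum_l w k l (L, y) ^+ 2) ->
  (forall k y, D (0, y) ->
     \sum_l w k l (0, y) * Y1 l (0, y) = \sum_l w k l (L, y) * Y1 l (L, y)) ->
  (\int[leb2]_(p in (cell : set plane)) (energy (fun l p => v l p - w k l p)
     (fun l p => vx l p - wx k l p) (fun l p => vy l p - wy k l p) p)%:E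
     @[k --> \oo] --> 0)%E ->
  (\int[leb2]_(p in (cell : set plane)) (pairing v vx vy p)%:E = 0)%E.
Proof.
move=> hv iv hw cw wS pers perX lim.
have mc := @cell_measurable _ D L top oD.
pose dif k := energy (fun l p => v l p - w k l p)
     (fun l p => vx l p - wx k l p) (fun l p => vy l p - wy k l p).
have hd k l : C1w D (fun p => v l p - w k l p) (fun p => vx l p - wx k l p) (fun p => vy l p - wy k l p).
  have := C1wD (hv l) (C1wM (@C1w_cst _ D (-1)) (hw k l)).
  by apply: (C1w_ext oD) => p Dp; split; rewrite /= ?mul0r ?addr0 mulN1r.
have md k : measurable_fun (cell : set plane) (dif k : plane -> measurableTypeR R).
  exact: energy_measurable (hd k).
have dif0 k p : 0 <= dif k p by exact: energy_ge0.
have ipv : leb2.-integrable (cell : set plane) (EFin \o pairing v vx vy) by exact: pairing_integrable.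
set J := (\int[leb2]_(p in (cell : set plane)) (pairing v vx vy p)%:E)%E.
pose c k := (\int[leb2]_(p in (cell : set plane)) (dif k p)%:E)%E.
set A := (\int[leb2]_(p in (cell : set plane)) (energyY p)%:E)%E.
have Afin : A \is a fin_num by exact: (integrable_fin_num mc iY).
have Jfin : J \is a fin_num by exact: (integrable_fin_num mc ipv).
(* A field of finite energy distance to [v] has finite energy, hence zero pairing. *)
have bound k t : 0 < t -> (c k < +oo)%E -> `|fine J| <= (t * fine A + fine (c k) / t) / 2.
  move=> t0 ck.
  have idif : leb2.-integrable (cell : set plane) (EFin \o dif k).
    apply/integrableP; split; first by apply/measurable_EFinP; exact: (md k).
    by under eq_integral do rewrite /= ger0_norm//.
  have iwk : leb2.-integrable (cell : set plane) (EFin \o energy (w k) (wx k) (wy k)).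
    have is2 : leb2.-integrable (cell : set plane)
        (fun p => 2%:E * (EFin \o energy v vx vy \+ (EFin \o dif k)) p)%E.
      by apply: integrableZl => //; exact: integrableD.
    apply: le_integrable is2 => //.
      by apply/measurable_EFinP; exact: energy_measurable.
    move=> p cp /=; rewrite lee_fin ger0_norm ?energy_ge0// ger0_norm; last first.
      by rewrite mulr_ge0// addr_ge0// energy_ge0.
    rewrite /dif /energy -big_split/= mulr_sumr; apply: ler_sum => l _.
    have sq (a b : R) : b ^+ 2 <= 2 * (a ^+ 2 + (a - b) ^+ 2).
      by have := sqr_ge0 (2 * a - b); rewrite !sqrrB exprMn; lra.
    have := sq (v l p) (w k l p); have := sq (vx l p) (wx k l p); have := sq (vy l p) (wy k l p).
    lra.
  have w0 := pairing_integral_eq0 (hw k) (cw k) (wS k) (pers k) (perX k) iwk.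
  have ipw := pairing_integrable (hw k) iwk.
  have -> : J = (\int[leb2]_(p in (cell : set plane))
      (pairing (fun l p => v l p - w k l p)
       (fun l p => vx l p - wx k l p) (fun l p => vy l p - wy k l p) p)%:E)%E.
    rewrite -[LHS]sube0 -[X in (_ - X)%E]w0 -integralB//.
    apply: eq_integral => p _ /=; rewrite -EFinB; congr (_%:E).
    by rewrite /pairing -sumrB; apply: eq_bigr => l _; ring.
  set pd := pairing _ _ _.
  have ipd : leb2.-integrable (cell : set plane) (EFin \o pd).
    exact: pairing_integrable (hd k) idif.
  have iB : leb2.-integrable (cell : set plane) (EFin \o (fun p => (t * energyY p + t^-1 * dif k p) / 2)).
    have -> : EFin \o (fun p => (t * energyY p + t^-1 * dif k p) / 2) =
       ((fun p => (t / 2)%:E * (EFin \o energyY) p) \+ (fun p => (t^-1 / 2)%:E * (EFin \o dif k) p))%E.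
      by apply/funext => p /=; rewrite -!EFinM -EFinD; congr (_%:E); field; rewrite gt_eqF.
    by apply: integrableD => //; exact: integrableZl.
  have : `|\int[leb2]_(p in (cell : set plane)) pd p| <=
      \int[leb2]_(p in (cell : set plane)) ((t * energyY p + t^-1 * dif k p) / 2).
    apply: (le_trans (le_normr_Rintegral mc ipd)); apply: le_Rintegral => //.
      exact: integrable_norm.
    by move=> p cp; rewrite [t^-1 * _]mulrC; exact: norm_pairing_le.
  rewrite RintegralZr//; last first.
    have -> : EFin \o (fun p => (t * energyY p + t^-1 * dif k p)) =
       ((fun p => t%:E * (EFin \o energyY) p) \+ (fun p => (t^-1)%:E * (EFin \o dif k) p))%E.
      by apply/funext => p /=; rewrite -!EFinM -EFinD.
    by apply: integrableD => //; exact: integrableZl.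
  rewrite RintegralD// ?RintegralZl//; last 2 first.
  - have -> : EFin \o (fun p => t * energyY p) = (fun p => t%:E * (EFin \o energyY) p)%E.
      by apply/funext => p /=; rewrite EFinM.
    exact: integrableZl.
  - have -> : EFin \o (fun p => t^-1 * dif k p) = (fun p => (t^-1)%:E * (EFin \o dif k) p)%E.
      by apply/funext => p /=; rewrite EFinM.
    exact: integrableZl.
  by rewrite [t^-1 * _]mulrC.
have finite_k : \forall k \near \oo, (c k < +oo)%E.
  have n1 : nbhs (0%E : \bar R) [set x | (x < 1%:E)%E].
    by apply: open_nbhs_nbhs; split; [exact: open_ereal_lt_ereal|rewrite /= lte_fin].
  have h1 : \forall k \near \oo, (c k < 1%:E)%E by exact: (lim _ n1).
  by apply: filterS h1 => k h; exact: lt_le_trans h (leey _).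
have flim : fine (c k) @[k --> \oo] --> (0 : R).
  by apply: fine_cvg.
have Jt t : 0 < t -> `|fine J| <= t * fine A / 2.
  move=> t0.
  have l2 : (t * fine A + fine (c k) / t) / 2 @[k --> \oo] --> (t * fine A + 0 / t) / 2.
    apply: cvgM; last exact: cvg_cst.
    by apply: cvgD; [exact: cvg_cst|apply: cvgM => //; exact: cvg_cst].
  rewrite mul0r addr0 in l2.
  rewrite -(cvg_lim _ l2)//; apply: limr_ge; first by apply/cvg_ex; eexists; exact: l2.
  by apply: filterS finite_k => k; exact: bound.
have A0 : 0 <= fine A by apply: fine_ge0; apply: integral_ge0 => p _; rewrite lee_fin energy_ge0.
rewrite -(fineK Jfin); congr (_%:E); apply/eqP; rewrite -normr_eq0 eq_le normr_ge0 andbT.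
apply/ler_addgt0Pr => e e0; rewrite add0r.
have a1 : 0 < fine A + 1 by rewrite ltr_wpDl.
apply: (le_trans (Jt (e / (fine A + 1)) _)); first by rewrite divr_gt0.
rewrite -[e / _ * _]mulrA [_^-1 * _]mulrC !mulrA ler_pdivrMr// ler_pdivrMr//.
by rewrite -mulrA; apply: ler_wpM2l; lra.
Qed.

End WeakForm.

(** * The region above the surface *)

Section Region.
Context {R : realType}.
Variables (P : params R) (S : set (R * R)).
Hypothesis L0 : 0 < Lam P.
Hypothesis hS : periodic_surface P S.
Local Notation D := (region_above P S).
Local Notation L := (Lam P).
Local Notation top := (hgt P).

Let closedS : closed S. Proof. by have [[]] := hS. Qed.
Let perS x y : S (x + L, y) <-> S (x, y). Proof. by have [[? ? + ? ?] _] := hS; apply. Qed.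
Let belowS p : S p -> p.2 < top. Proof. by have [[? ? ? + ?] _] := hS; apply. Qed.

Lemma region_open : open D.
Proof. by apply: component_open; exact: closed_openC. Qed.

Lemma region_closedU : closed (D `|` S).
Proof.
rewrite -[D `|` S]setCK; apply: open_closedC; rewrite openE => p nDS.
have nSp : nbhs p (~` S).
  by apply: open_nbhs_nbhs; split; [exact: closed_openC|move=> Sp; apply: nDS; right].
move: nSp => /nbhs_ballP[r /= r0 rS]; apply/nbhs_ballP; exists r => // q pq [Dq|Sq].
  by apply: nDS; left; exact: (component_ball rS pq Dq (ballxx _ r0)).
exact: (rS q).
Qed.

Lemma regionNS p : D p -> ~ S p.
Proof. by move=> Dp Sp; exact: (connected_component_sub Dp). Qed.

Lemma region_upper p : top <= p.2 -> D p.
Proof.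
move=> hp; pose A : set (R * R) := [set p | top <= p.2].
have A0 : A (0, top) by rewrite /A/=.
apply: (connected_component_max A0 _ _ hp) => [q /= Aq /belowS|].
  by rewrite ltNge; rewrite /A/= in Aq; rewrite Aq.
apply: (star_connected A0) => q t; rewrite /A/= in_itv/= => Aq /andP[t0 _].
by rewrite lerDl mulr_ge0// subr_ge0.
Qed.

(** By compactness the surface stays at a positive distance below the line, over one period. *)
Lemma region_collar : exists2 b0, b0 < top & forall x y, 0 <= x <= L -> b0 <= y -> D (x, y).
Proof.
pose K : set (R * R) := S `&` (`[0, L] `*` `[top - 1, top]).
have cK : compact K.
  rewrite /K setIC; apply: compact_closedI => //.
  by apply: compact_setX; exact: segment_compact.
have [b0 b0t hb] : exists2 b0, b0 < top & forall x y, 0 <= x <= L -> b0 <= y -> ~ S (x, y).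
  have [K0|/set0P K0] := eqVneq K set0.
    exists (top - 1); first by rewrite gtrBl.
    move=> x y hx hy Sxy; have : K (x, y) by split => //; split; rewrite /= in_itv/= ?hx// hy ltW// (belowS Sxy).
    by rewrite K0.
  have [c /set_mem[Sc [c1 c2]] cmax] := @compact_EVT_max _ _ (fun p : R * R => p.2) K K0 cK
    (continuous_subspaceT (fun p => @cvg_snd _ _ _ _ _)).
  exists ((c.2 + top) / 2); first by have := belowS Sc; lra.
  move=> x y hx hy Sxy; have sc := belowS Sc; have sxy := belowS Sxy; rewrite /= in sxy.
  have : K (x, y).
    split => //; split; rewrite /= in_itv/= ?hx//; move: c2; rewrite /= in_itv/= => /andP[c2 _].
    by apply/andP; split; lra.
  by move=> /mem_set/cmax/=; lra.
exists b0 => // x y hx hy; pose A : set (R * R) := [set p | 0 <= p.1 <= L /\ b0 <= p.2].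
have A0 : A (0, top) by split; rewrite /= ?lexx ltW.
have Axy : A (x, y) by [].
apply: (connected_component_max A0 _ _ Axy) => [[x' y'] [/= h1 h2]|].
  exact: hb.
apply: (star_connected A0) => q t [/= /andP[h1 h2] h3] /[!in_itv]/= /andP[t0 t1].
split; rewrite /=; last by nra.
by rewrite add0r subr0; apply/andP; split; nra.
Qed.

Lemma region_shift (d : R) p : (forall x y, S (x + d, y) <-> S (x, y)) ->
  D p -> D (p.1 + d, p.2).
Proof.
move=> perd Dp.
pose tau (q : R * R) := (q.1 + d, q.2).
have ctau : continuous tau.
  move=> q.
  have c1 : {for q, continuous (fun q : R * R => q.1 + d)}.
    by apply: cvgD; [exact: cvg_fst|exact: cvg_cst].
  have c2 : {for q, continuous (fun q : R * R => q.2)} by exact: cvg_snd.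
  exact: (continuous_pair c1 c2).
have Dd : D (d, top) by exact: region_upper.
apply: (connected_component_trans Dd).
apply: (@connected_component_max _ _ (tau @` D)) => /=; last by exists p.
- by exists (0, top); [exact: region_upper|rewrite /tau/= add0r].
- by move=> _ [q Dq <-] /perd; rewrite -surjective_pairing; exact: regionNS.
- apply: connected_continuous_connected; first exact: component_connected.
  exact: continuous_subspaceT.
Qed.

Lemma region_periodic x y : D (x, y) <-> D (x + L, y).
Proof.
split => [/(region_shift (d := L))|/(region_shift (d := - L))] /=; first by apply.
rewrite addrK; apply => x' y'; rewrite -[in X in _ <-> X](subrK L x').
by apply: iff_sym; exact: perS.
Qed.

Lemma region_bounded_below : exists2 bot, bot < top & forall p, D p -> 0 <= p.1 <= L -> bot < p.2.
Proof.
have [_ [M [_ hM]]] := hS.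
pose M' := `|M| + 1.
have {}hM p : Omega P S p -> `|p| <= M'.
  by apply: hM; rewrite (le_lt_trans (ler_norm _))// ltrDl.
(* Only the open strip is covered by the bound on the cell: points of its two sides
   are first moved horizontally inside. *)
exists (Num.min (top - 1) (- M' - 1)); first by rewrite gt_min gtrBl ltr01.
move=> p Dp /andP[p0 pL]; rewrite gt_min; apply/orP.
have [ht|ht] := leP top p.2; [left; lra|right].
suff [q [Oq qp]] : exists q, Omega P S q /\ q.2 = p.2.
  have := hM q Oq; rewrite prod_normE ge_max => /andP[_]; rewrite qp ler_norml => /andP[h _].
  by apply: lt_le_trans h; lra.
have : nbhs p D by apply: open_nbhs_nbhs; split => //; exact: region_open.
move=> /nbhs_ballP[r /= r0 rD].
pose e := Num.min (r / 2) (L / 4).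
have e0 : 0 < e by rewrite lt_min !divr_gt0.
have er : e <= r / 2 by rewrite ge_min lexx.
have eL : e <= L / 4 by rewrite ge_min lexx orbT.
have [hx|hx] := leP p.1 (L / 2).
  exists (p.1 + e, p.2); split => //; split => //=; last by apply/andP; split; lra.
  apply: rD; split; last exact: ballxx.
  by rewrite /ball/= opprD addrA subrr sub0r normrN gtr0_norm; lra.
exists (p.1 - e, p.2); split => //; split => //=; last by apply/andP; split; lra.
apply: rD; split; last exact: ballxx.
by rewrite /ball/= opprB addrC subrK gtr0_norm; lra.
Qed.

End Region.

(** * Betti's reciprocity for the elastic system *)

Section Collar.
Context {R : realType}.
Variables (lo hi : R).
Hypothesis lohi : lo < hi.

(** A C1 function of the height, constant below [lo] and zero above [hi]; it is
    the second difference of [pos_sq] that makes it so. *)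
Definition collar (y : R) : R :=
  (hi - lo) ^+ 2 / 2 -
  (pos_sq (y - lo) - 2 * pos_sq (y - (lo + hi) / 2) + pos_sq (y - hi)).
Definition dcollar (y : R) : R :=
  - (2 * Num.max 0 (y - lo) - 2 * (2 * Num.max 0 (y - (lo + hi) / 2)) + 2 * Num.max 0 (y - hi)).

Lemma is_derive_collar (y : R) : is_derive y 1 collar (dcollar y).
Proof.
have dq c : is_derive y 1 (fun y => pos_sq (y - c)) (2 * Num.max 0 (y - c)).
  have h := @is_derive1_comp _ pos_sq (fun s => s - c) y _ _ (is_derive_pos_sq (y - c))
    (is_deriveB (is_derive_id y 1) (is_derive_cst c y 1)).
  by apply: is_derive_eq h _; rewrite subr0 mulr1.
have h := is_deriveB (is_derive_cst ((hi - lo) ^+ 2 / 2) y 1)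
  (is_deriveD (is_deriveB (dq lo) (is_deriveZ 2 (dq ((lo + hi) / 2)))) (dq hi)).
by apply: is_derive_eq h _; rewrite /GRing.scale/= /dcollar sub0r.
Qed.

Lemma continuous_dcollar : continuous dcollar.
Proof.
have cm c y : {for y, continuous (fun y : R => Num.max 0 (y - c))}.
  by apply: continuous_max; [exact: cvg_cst|apply: cvgB; [exact: cvg_id|exact: cvg_cst]].
move=> y; apply: cvgN; apply: cvgD; last by apply: cvgM; [exact: cvg_cst|exact: cm].
apply: cvgB; first by apply: cvgM; [exact: cvg_cst|exact: cm].
by apply: cvgM; [exact: cvg_cst|apply: cvgM; [exact: cvg_cst|exact: cm]].
Qed.

Lemma collar_lo y : y <= lo -> collar y = (hi - lo) ^+ 2 / 2 /\ dcollar y = 0.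
Proof.
move=> h; have lh := lohi; have h1 : y - lo <= 0 by rewrite subr_le0.
have h2 : y - (lo + hi) / 2 <= 0 by lra.
have h3 : y - hi <= 0 by lra.
rewrite /collar /dcollar /pos_sq (max_l h1) (max_l h2) (max_l h3).
by split; ring.
Qed.

Lemma collar_hi y : hi <= y -> collar y = 0 /\ dcollar y = 0.
Proof.
move=> h; have lh := lohi; have h1 : 0 <= y - lo by lra.
have h2 : 0 <= y - (lo + hi) / 2 by lra.
have h3 : 0 <= y - hi by lra.
rewrite /collar /dcollar /pos_sq (max_r h1) (max_r h2) (max_r h3).
by split; field.
Qed.

Lemma collar_bounded bot : exists2 M, 0 < M &
  forall y, bot <= y <= hi -> `|collar y| <= M /\ `|dcollar y| <= M.
Proof.
have c1 : continuous collar.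
  by move=> y; apply/differentiable_continuous/derivable1_diffP; have [] := is_derive_collar y.
have bnd (f : R -> R) : continuous f -> exists2 M, 0 < M & forall y, bot <= y <= hi -> `|f y| <= M.
  move=> cf; have ck : compact (f @` `[bot, hi]).
    by apply: continuous_compact (@segment_compact _ _ _); exact: continuous_subspaceT.
  have [M [_ hM]] := compact_bounded ck.
  exists (`|M| + 1); first by rewrite ltr_wpDl.
  move=> y hy; apply: (hM (`|M| + 1)); last by exists y => //=; rewrite in_itv.
  by rewrite (le_lt_trans (ler_norm _))// ltrDl.
have [M1 M10 h1] := bnd _ c1; have [M2 M20 h2] := bnd _ continuous_dcollar.
exists (M1 + M2); first by rewrite addr_gt0.
by move=> y hy; have := h1 y hy; have := h2 y hy; split; lra.
Qed.

End Collar.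

Section Lame.
Context {R : realType}.
Variables (D : set (R * R)) (m l om2 : R).
Hypothesis oD : open D.

Lemma C1w_dx (f fx fy : R * R -> R) p : C1w D f fx fy -> D p -> dx f p = fx p /\ dy f p = fy p.
Proof.
by move=> h Dp; have [_ d1 d2 _ _] := h p Dp; rewrite /dx /dy !derive1E !derive_val.
Qed.

(** The rows of the tensor [m grad a + l (div a) I]; its divergence is the
    elastic operator, although it is not the physical stress. *)
Definition tensor11 (a1 a2 : R * R -> R) p := m * dx a1 p + l * (dx a1 p + dy a2 p).
Definition tensor12 (a1 a2 : R * R -> R) p := m * dy a1 p.
Definition tensor21 (a1 a2 : R * R -> R) p := m * dx a2 p.
Definition tensor22 (a1 a2 : R * R -> R) p := m * dy a2 p + l * (dx a1 p + dy a2 p).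

Definition lame_solution (a1 a2 : R * R -> R) :=
  [/\ C2_on D a1, C2_on D a2,
   (forall p, D p -> m * (dx (dx a1) p + dy (dy a1) p) + l * (dx (dx a1) p + dx (dy a2) p)
      + om2 * a1 p = 0) &
   (forall p, D p -> m * (dx (dx a2) p + dy (dy a2) p) + l * (dy (dx a1) p + dy (dy a2) p)
      + om2 * a2 p = 0)].

Section OneSolution.
Variables (a1 a2 : R * R -> R).
Hypothesis sol : lame_solution a1 a2.

Let C2w (a : R * R -> R) : C2_on D a ->
  [/\ C1w D a (dx a) (dy a), C1w D (dx a) (dx (dx a)) (dy (dx a)) &
      C1w D (dy a) (dx (dy a)) (dy (dy a))].
Proof. by move=> [h1 h2 h3]; split; exact: C1_on_C1w. Qed.

Let scale (k : R) f fx fy : C1w D f fx fy -> 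
  C1w D (fun p => k * f p) (fun p => k * fx p) (fun p => k * fy p).
Proof.
move=> h; apply: (C1w_ext oD _ (C1wM (@C1w_cst _ D k) h)) => p Dp.
by rewrite /= !mul0r !addr0.
Qed.

Lemma C1w_tensor : exists T11x T11y T12x T12y T21x T21y T22x T22y : R * R -> R,
  [/\ [/\ C1w D (tensor11 a1 a2) T11x T11y, C1w D (tensor12 a1 a2) T12x T12y,
      C1w D (tensor21 a1 a2) T21x T21y & C1w D (tensor22 a1 a2) T22x T22y],
  (forall p, D p -> T11x p + T12y p = - (om2 * a1 p)) &
  (forall p, D p -> T21x p + T22y p = - (om2 * a2 p))].
Proof.
have [/C2w[h1 h1x h1y] /C2w[h2 h2x h2y] e1 e2] := sol.
have d := C1wD h1x h2y.
have alg1 x y z v : m * (x + y) + l * (x + z) + om2 * v = 0 ->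
    m * x + l * (x + z) + m * y = - (om2 * v) by lra.
have alg2 x y z v : m * (x + y) + l * (z + y) + om2 * v = 0 ->
    m * x + (m * y + l * (z + y)) = - (om2 * v) by lra.
do 8 eexists; split; first split.
- exact: C1wD (scale m h1x) (scale l d).
- exact (scale m h1y).
- exact (scale m h2x).
- exact: C1wD (scale m h2y) (scale l d).
- by move=> p /e1; exact: alg1.
- by move=> p /e2; exact: alg2.
Qed.

End OneSolution.

Section TwoSolutions.
Variables (a1 a2 b1 b2 : R * R -> R).
Hypothesis sola : lame_solution a1 a2.
Hypothesis solb : lame_solution b1 b2.

Definition flux1 (p : R * R) : R :=
  a1 p * tensor11 b1 b2 p - b1 p * tensor11 a1 a2 p
  + a2 p * tensor21 b1 b2 p - b2 p * tensor21 a1 a2 p.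
Definition flux2 (p : R * R) : R :=
  a1 p * tensor12 b1 b2 p - b1 p * tensor12 a1 a2 p
  + a2 p * tensor22 b1 b2 p - b2 p * tensor22 a1 a2 p.

Let C1wB f fx fy g gx gy : C1w D f fx fy -> C1w D g gx gy ->
  C1w D (fun p => f p - g p) (fun p => fx p - gx p) (fun p => fy p - gy p).
Proof.
move=> hf hg; apply: (C1w_ext oD _ (C1wD hf (C1wM (@C1w_cst _ D (-1)) hg))) => p Dp.
by split; rewrite /= ?mul0r ?addr0 mulN1r.
Qed.

(** Betti's reciprocity: the products of gradients in the divergence are symmetric in
    the two solutions and cancel, and so do the terms of order zero. *)
Lemma C1w_flux : exists F1x F1y F2x F2y : R * R -> R,
  [/\ C1w D flux1 F1x F1y, C1w D flux2 F2x F2y & forall p, D p -> F1x p + F2y p = 0].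
Proof.
have [[ha1 _ _] [ha2 _ _] _ _] := sola; have [[hb1 _ _] [hb2 _ _] _ _] := solb.
have {}ha1 := C1_on_C1w oD ha1; have {}ha2 := C1_on_C1w oD ha2.
have {}hb1 := C1_on_C1w oD hb1; have {}hb2 := C1_on_C1w oD hb2.
have [A11x [A11y [A12x [A12y [A21x [A21y [A22x [A22y [[hA11 hA12 hA21 hA22] eA1 eA2]]]]]]]]] := C1w_tensor sola.
have [B11x [B11y [B12x [B12y [B21x [B21y [B22x [B22y [[hB11 hB12 hB21 hB22] eB1 eB2]]]]]]]]] := C1w_tensor solb.
do 4 eexists; split.
- exact: C1wB (C1wD (C1wB (C1wM ha1 hB11) (C1wM hb1 hA11)) (C1wM ha2 hB21)) (C1wM hb2 hA21).
- exact: C1wB (C1wD (C1wB (C1wM ha1 hB12) (C1wM hb1 hA12)) (C1wM ha2 hB22)) (C1wM hb2 hA22).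
- move=> p Dp /=.
  have e1 : A11x p = - (om2 * a1 p) - A12y p by rewrite -eA1// addrK.
  have e2 : A21x p = - (om2 * a2 p) - A22y p by rewrite -eA2// addrK.
  have e3 : B11x p = - (om2 * b1 p) - B12y p by rewrite -eB1// addrK.
  have e4 : B21x p = - (om2 * b2 p) - B22y p by rewrite -eB2// addrK.
  rewrite e1 e2 e3 e4 /tensor11 /tensor12 /tensor21 /tensor22; ring.
Qed.

End TwoSolutions.
End Lame.

(** * The flux through a horizontal line *)

Section FluxBalance.
Context {R : realType}.
Local Notation leb := (@lebesgue_measure R).
Local Notation leb2 := (leb \x leb)%E.
Local Notation plane := (measurableTypeR R * measurableTypeR R)%type.

Definition vec4 (T : Type) (x0 x1 x2 x3 : T) (i : 'I_4) : T := nth x0 [:: x0; x1; x2; x3] i.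

Lemma sum_ord4 (F : 'I_4 -> R) :
  \sum_i F i = F ord0 + F (lift ord0 ord0) + F (lift ord0 (lift ord0 ord0)) +
    F (lift ord0 (lift ord0 (lift ord0 ord0))).
Proof. by rewrite !big_ord_recl big_ord0 addr0 !addrA. Qed.

Lemma C1w_vec4 (D : set (R * R)) (f0 f1 f2 f3 f0x f1x f2x f3x f0y f1y f2y f3y : R * R -> R) :
  C1w D f0 f0x f0y -> C1w D f1 f1x f1y -> C1w D f2 f2x f2y -> C1w D f3 f3x f3y ->
  forall i, C1w D (vec4 f0 f1 f2 f3 i) (vec4 f0x f1x f2x f3x i) (vec4 f0y f1y f2y f3y i).
Proof. by move=> h0 h1 h2 h3 [[|[|[|[|]]]]]. Qed.

Lemma C1wN (D : set (R * R)) (f fx fy : R * R -> R) : open D -> C1w D f fx fy ->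
  C1w D (fun p => - f p) (fun p => - fx p) (fun p => - fy p).
Proof.
move=> oD h; apply: (C1w_ext oD _ (C1wM (@C1w_cst _ D (-1)) h)) => p Dp.
by rewrite /= !mul0r !addr0 !mulN1r.
Qed.

Lemma energy_term (n : nat) (w wx wy : 'I_n -> R * R -> R) p i :
  [/\ w i p ^+ 2 <= energy w wx wy p, wx i p ^+ 2 <= energy w wx wy p &
      wy i p ^+ 2 <= energy w wx wy p].
Proof.
have h : w i p ^+ 2 + wx i p ^+ 2 + wy i p ^+ 2 <= energy w wx wy p.
  by rewrite /energy (bigD1 i)//= ler_wpDr// sumr_ge0// => j _; rewrite !addr_ge0 ?sqr_ge0.
have := sqr_ge0 (w i p); have := sqr_ge0 (wx i p); have := sqr_ge0 (wy i p).
by move=> h1 h2 h3; split; apply: le_trans h; lra.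
Qed.

Lemma tensor_sq_le (m l x y z E : R) : x ^+ 2 <= E -> y ^+ 2 <= E -> z ^+ 2 <= E ->
  (m * x + l * (y + z)) ^+ 2 <= 9 * (m ^+ 2 + l ^+ 2) * E.
Proof.
move=> xE yE zE.
have h1 : m ^+ 2 * x ^+ 2 <= m ^+ 2 * E by rewrite ler_wpM2l ?sqr_ge0.
have h2 : l ^+ 2 * y ^+ 2 <= l ^+ 2 * E by rewrite ler_wpM2l ?sqr_ge0.
have h3 : l ^+ 2 * z ^+ 2 <= l ^+ 2 * E by rewrite ler_wpM2l ?sqr_ge0.
have E0 : 0 <= E by apply: le_trans xE; exact: sqr_ge0.
have h4 : 0 <= m ^+ 2 * E by rewrite mulr_ge0 ?sqr_ge0.
have h5 : 0 <= l ^+ 2 * E by rewrite mulr_ge0 ?sqr_ge0.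
have -> : (m * x + l * (y + z)) ^+ 2 = 3 * (m ^+ 2 * x ^+ 2 + l ^+ 2 * y ^+ 2 + l ^+ 2 * z ^+ 2)
   - ((m * x - l * y) ^+ 2 + (m * x - l * z) ^+ 2 + (l * y - l * z) ^+ 2) by ring.
have := sqr_ge0 (m * x - l * y); have := sqr_ge0 (m * x - l * z); have := sqr_ge0 (l * y - l * z).
have -> : 9 * (m ^+ 2 + l ^+ 2) * E = 9 * (m ^+ 2 * E) + 9 * (l ^+ 2 * E) by ring.
lra.
Qed.

Lemma row_sq_le (M N om f g T1 T2 b E : R) : 0 <= M -> `|f| <= M -> `|g| <= M ->
  T1 ^+ 2 <= N * E -> T2 ^+ 2 <= N * E -> b ^+ 2 <= E ->
  (f * - (om * b) + g * T2) ^+ 2 + (f * T1) ^+ 2 + (f * T2) ^+ 2 <=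
  (4 * M ^+ 2 * N + 2 * M ^+ 2 * om ^+ 2) * E.
Proof.
move=> M0 Mf Mg hT1 hT2 hb.
have f2 : f ^+ 2 <= M ^+ 2 by rewrite -[leLHS]real_normK ?num_real// lerXn2r ?nnegrE.
have g2 : g ^+ 2 <= M ^+ 2 by rewrite -[leLHS]real_normK ?num_real// lerXn2r ?nnegrE.
have m1 : f ^+ 2 * T1 ^+ 2 <= M ^+ 2 * (N * E) by apply: ler_pM; rewrite ?sqr_ge0.
have m2 : f ^+ 2 * T2 ^+ 2 <= M ^+ 2 * (N * E) by apply: ler_pM; rewrite ?sqr_ge0.
have m3 : g ^+ 2 * T2 ^+ 2 <= M ^+ 2 * (N * E) by apply: ler_pM; rewrite ?sqr_ge0.
have ob : om ^+ 2 * b ^+ 2 <= om ^+ 2 * E by apply: ler_wpM2l; rewrite ?sqr_ge0.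
have m4 : f ^+ 2 * (om ^+ 2 * b ^+ 2) <= M ^+ 2 * (om ^+ 2 * E).
  by apply: ler_pM; rewrite ?sqr_ge0// mulr_ge0 ?sqr_ge0.
have m5 := sqr_ge0 (f * - (om * b) - g * T2).
have -> : (4 * M ^+ 2 * N + 2 * M ^+ 2 * om ^+ 2) * E =
  4 * (M ^+ 2 * (N * E)) + 2 * (M ^+ 2 * (om ^+ 2 * E)) by ring.
have -> : (f * - (om * b) + g * T2) ^+ 2 = 2 * (f ^+ 2 * (om ^+ 2 * b ^+ 2)) +
  2 * (g ^+ 2 * T2 ^+ 2) - (f * - (om * b) - g * T2) ^+ 2 by ring.
rewrite !exprMn; lra.
Qed.

Variables (D S : set (R * R)) (L top bot lo m l om2 : R).
Hypothesis oD : open D.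
Hypothesis cDS : closed (D `|` S).
Hypothesis L0 : 0 < L.
Hypothesis bot_top : bot < top.
Hypothesis lo_top : lo < top.
Hypothesis Dbot : forall p, D p -> 0 <= p.1 <= L -> bot < p.2.
Hypothesis Dper : forall y, D (0, y) <-> D (L, y).
Hypothesis Dlo : forall x y : R, 0 <= x <= L -> lo <= y -> D (x, y).
Local Notation cell := (cell D L top).

(** A phase factor [c + i s] relates the values on the two sides of the period cell. *)
Variables (c s : R).
Hypothesis cs1 : c ^+ 2 + s ^+ 2 = 1.
Definition phase_shift (f g : R * R -> R) := forall y, D (0, y) ->
  f (L, y) = c * f (0, y) - s * g (0, y) /\ g (L, y) = s * f (0, y) + c * g (0, y).

Lemma phase_shift_dot f g h k y : phase_shift f g -> phase_shift h k -> D (0, y) ->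
  f (0, y) * h (0, y) + g (0, y) * k (0, y) = f (L, y) * h (L, y) + g (L, y) * k (L, y).
Proof.
move=> h1 h2 Dy; have [-> ->] := h1 y Dy; have [-> ->] := h2 y Dy.
transitivity ((c ^+ 2 + s ^+ 2) * (f (0, y) * h (0, y) + g (0, y) * k (0, y))); last by ring.
by rewrite cs1 mul1r.
Qed.

Lemma phase_shift_cross f g h k y : phase_shift f g -> phase_shift h k -> D (0, y) ->
  f (0, y) * k (0, y) - g (0, y) * h (0, y) = f (L, y) * k (L, y) - g (L, y) * h (L, y).
Proof.
move=> h1 h2 Dy; have [-> ->] := h1 y Dy; have [-> ->] := h2 y Dy.
transitivity ((c ^+ 2 + s ^+ 2) * (f (0, y) * k (0, y) - g (0, y) * h (0, y))); last by ring.
by rewrite cs1 mul1r.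
Qed.

(* Real and imaginary parts of the two displacement components. *)
Variables (a1 a2 b1 b2 : R * R -> R).
Hypothesis sola : lame_solution D m l om2 a1 a2.
Hypothesis solb : lame_solution D m l om2 b1 b2.
Hypothesis ps1 : phase_shift a1 b1.
Hypothesis ps2 : phase_shift a2 b2.
Hypothesis ps1x : phase_shift (dx a1) (dx b1).
Hypothesis ps2x : phase_shift (dx a2) (dx b2).
Hypothesis ps2y : phase_shift (dy a2) (dy b2).

Local Notation v := (vec4 a1 b1 a2 b2).
Local Notation vx := (vec4 (dx a1) (dx b1) (dx a2) (dx b2)).
Local Notation vy := (vec4 (dy a1) (dy b1) (dy a2) (dy b2)).
Hypothesis iv : leb2.-integrable (cell : set plane) (EFin \o energy v vx vy).

Variables (wa1 wb1 wa2 wb2 : nat -> R * R -> R).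
Local Notation w k := (vec4 (wa1 k) (wb1 k) (wa2 k) (wb2 k)).
Local Notation wx k := (vec4 (dx (wa1 k)) (dx (wb1 k)) (dx (wa2 k)) (dx (wb2 k))).
Local Notation wy k := (vec4 (dy (wa1 k)) (dy (wb1 k)) (dy (wa2 k)) (dy (wb2 k))).
Hypothesis C1_w : forall k,
  [/\ C1_on D (wa1 k), C1_on D (wb1 k), C1_on D (wa2 k) & C1_on D (wb2 k)].
Hypothesis cont_w : forall k i, {within D `|` S, continuous (w k i)}.
Hypothesis zero_w : forall k i p, S p -> w k i p = 0.
Hypothesis psw1 : forall k, phase_shift (wa1 k) (wb1 k).
Hypothesis psw2 : forall k, phase_shift (wa2 k) (wb2 k).
Hypothesis lim_w :
  (\int[leb2]_(p in (cell : set plane)) (energy (fun i p => v i p - w k i p)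
     (fun i p => vx i p - wx k i p) (fun i p => vy i p - wy k i p) p)%:E
     @[k --> \oo] --> 0)%E.

Local Notation psi := (fun p : R * R => collar lo top p.2).
Local Notation dpsi := (fun p : R * R => dcollar lo top p.2).

Lemma C1w_collar (E : set (R * R)) : open E -> C1w E psi (cst 0) dpsi.
Proof.
move=> oE; apply: (C1w_ext oE _ (C1w_comp (is_derive_collar lo top) (continuous_dcollar (lo := lo) (hi := top)) (@C1w_snd _ E))).
by move=> p _; rewrite /= mulr0 mulr1.
Qed.

Let C1wv i : C1w D (v i) (vx i) (vy i).
Proof.
have [[ha1 _ _] [ha2 _ _] _ _] := sola; have [[hb1 _ _] [hb2 _ _] _ _] := solb.
by apply: C1w_vec4; exact: C1_on_C1w.
Qed.

Lemma phase_shift_tensor11 : phase_shift (tensor11 m l a1 a2) (tensor11 m l b1 b2).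
Proof.
move=> y Dy; have [e1 e2] := ps1x Dy; have [e3 e4] := ps2y Dy.
by rewrite /tensor11 e1 e2 e3 e4; split; ring.
Qed.

Lemma phase_shift_tensor21 : phase_shift (tensor21 m a1 a2) (tensor21 m b1 b2).
Proof. by move=> y Dy; have [e1 e2] := ps2x Dy; rewrite /tensor21 e1 e2; split; ring. Qed.

Lemma cell_flux_eq0 :
  (\int[leb2]_(p in (cell : set plane)) (dpsi p * flux2 m l a1 a2 b1 b2 p)%:E = 0)%E.
Proof.
have [A11x [A11y [A12x [A12y [A21x [A21y [A22x [A22y [[hA11 hA12 hA21 hA22] eA1 eA2]]]]]]]]] := C1w_tensor oD sola.
have [B11x [B11y [B12x [B12y [B21x [B21y [B22x [B22y [[hB11 hB12 hB21 hB22] eB1 eB2]]]]]]]]] := C1w_tensor oD solb.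
have hpsi := C1w_collar oD.
have hY1 := C1w_vec4 (C1wM hpsi hB11) (C1wM hpsi (C1wN oD hA11)) (C1wM hpsi hB21) (C1wM hpsi (C1wN oD hA21)).
have hY2 := C1w_vec4 (C1wM hpsi hB12) (C1wM hpsi (C1wN oD hA12)) (C1wM hpsi hB22) (C1wM hpsi (C1wN oD hA22)).
have mc := @cell_measurable _ D L top oD.
have Ytop (i : 'I_4) x : vec4
    (fun p => psi p * tensor12 m b1 b2 p) (fun p => psi p * - tensor12 m a1 a2 p)
    (fun p => psi p * tensor22 m l b1 b2 p) (fun p => psi p * - tensor22 m l a1 a2 p) i (x, top) = 0.
  by case: i => [[|[|[|[|//]]]] ?]; rewrite /vec4/= (collar_hi lo_top (lexx _)).1 mul0r.
have C1ww k i : C1w D (w k i) (wx k i) (wy k i).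
  by have [w1 w2 w3 w4] := C1_w k; apply: C1w_vec4; exact: C1_on_C1w.
have [M M0 hM] := collar_bounded lo top bot.
have main iY := pairing_integral_limit oD cDS L0 bot_top Dbot Dper hY1 hY2 Ytop iY C1wv iv
  C1ww cont_w zero_w.
rewrite -[RHS]main => [||k y Dy|k y Dy|//]; last 2 first.
- rewrite !sum_ord4 /vec4 /= !expr2.
  by have := phase_shift_dot (psw1 k) (psw1 k) Dy; have := phase_shift_dot (psw2 k) (psw2 k) Dy; lra.
- rewrite !sum_ord4 /vec4 /=.
  have := phase_shift_cross (psw1 k) phase_shift_tensor11 Dy; have := phase_shift_cross (psw2 k) phase_shift_tensor21 Dy.
  move=> h1 h2.
  transitivity (collar lo top y *
     (wa1 k (0, y) * tensor11 m l b1 b2 (0, y) - wb1 k (0, y) * tensor11 m l a1 a2 (0, y)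
      + (wa2 k (0, y) * tensor21 m b1 b2 (0, y) - wb2 k (0, y) * tensor21 m a1 a2 (0, y)))).
    by ring.
  by rewrite h1 h2; ring.
- apply: eq_integral => p /set_mem cp; have Dp := cellD cp; congr (_%:E).
  rewrite /pairing sum_ord4 /divY /vec4 /=.
  have e1 : A11x p = - (om2 * a1 p) - A12y p by rewrite -eA1// addrK.
  have e2 : A21x p = - (om2 * a2 p) - A22y p by rewrite -eA2// addrK.
  have e3 : B11x p = - (om2 * b1 p) - B12y p by rewrite -eB1// addrK.
  have e4 : B21x p = - (om2 * b2 p) - B22y p by rewrite -eB2// addrK.
  rewrite e1 e2 e3 e4 /flux2 /tensor11 /tensor12 /tensor21 /tensor22; ring.
pose N := 9 * (m ^+ 2 + l ^+ 2).
pose C1 := 4 * M ^+ 2 * N + 2 * M ^+ 2 * om2 ^+ 2.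
pose C := 4 * C1.
apply: (@le_integrable _ _ _ _ _ mc _ (fun p => C%:E * (EFin \o energy v vx vy) p)%E).
- apply/measurable_EFinP; apply: energy_continuous_measurable => // i p Dp.
  have [y1 _ _ y1x _] := hY1 i p Dp; have [y2 _ _ _ y2y] := hY2 i p Dp.
  by split => //; exact: cvgD.
- move=> p cp /=; have Dp := cellD cp.
  have [Mc Md] : `|collar lo top p.2| <= M /\ `|dcollar lo top p.2| <= M.
    have [_ /andP[/ltW p0 /ltW pL] /ltW pt] := cp.
    by apply: hM; rewrite pt ltW// Dbot// p0 pL.
  set E := energy v vx vy p.
  have E0 : 0 <= E by exact: energy_ge0.
  have C0 : 0 <= C.
    have N0 : 0 <= N by apply: mulr_ge0 => //; apply: addr_ge0; exact: sqr_ge0.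
    apply: mulr_ge0 => //; apply: addr_ge0; apply: mulr_ge0 => //; last exact: sqr_ge0;
    by apply: mulr_ge0 => //; exact: sqr_ge0.
  rewrite lee_fin ger0_norm ?energy_ge0// ger0_norm; last by rewrite mulr_ge0.
  have [ga1 ga1x ga1y] : [/\ a1 p ^+ 2 <= E, dx a1 p ^+ 2 <= E & dy a1 p ^+ 2 <= E].
    exact: (energy_term v vx vy p ord0).
  have [gb1 gb1x gb1y] : [/\ b1 p ^+ 2 <= E, dx b1 p ^+ 2 <= E & dy b1 p ^+ 2 <= E].
    exact: (energy_term v vx vy p (lift ord0 ord0)).
  have [ga2 ga2x ga2y] : [/\ a2 p ^+ 2 <= E, dx a2 p ^+ 2 <= E & dy a2 p ^+ 2 <= E].
    exact: (energy_term v vx vy p (lift ord0 (lift ord0 ord0))).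
  have [gb2 gb2x gb2y] : [/\ b2 p ^+ 2 <= E, dx b2 p ^+ 2 <= E & dy b2 p ^+ 2 <= E].
    exact: (energy_term v vx vy p (lift ord0 (lift ord0 (lift ord0 ord0)))).
  have key0 (x : R) : x ^+ 2 <= E -> (m * x) ^+ 2 <= N * E.
    move=> h; have z : (0 : R) ^+ 2 <= E by rewrite expr0n.
    by have := tensor_sq_le m l h z z; rewrite addr0 mulr0 addr0.
  have e1 : A11x p = - (om2 * a1 p) - A12y p by rewrite -eA1// addrK.
  have e2 : A21x p = - (om2 * a2 p) - A22y p by rewrite -eA2// addrK.
  have e3 : B11x p = - (om2 * b1 p) - B12y p by rewrite -eB1// addrK.
  have e4 : B21x p = - (om2 * b2 p) - B22y p by rewrite -eB2// addrK.
  have p1 := @row_sq_le M N om2 _ _ (tensor11 m l b1 b2 p) (tensor12 m b1 b2 p) (b1 p) E (ltW M0) Mc Md.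
  have p2 := @row_sq_le M N om2 _ _ (- tensor11 m l a1 a2 p) (- tensor12 m a1 a2 p) (- a1 p) E (ltW M0) Mc Md.
  have p3 := @row_sq_le M N om2 _ _ (tensor21 m b1 b2 p) (tensor22 m l b1 b2 p) (b2 p) E (ltW M0) Mc Md.
  have p4 := @row_sq_le M N om2 _ _ (- tensor21 m a1 a2 p) (- tensor22 m l a1 a2 p) (- a2 p) E (ltW M0) Mc Md.
  rewrite {1}/energy sum_ord4 /divY /vec4 /= e1 e2 e3 e4.
  rewrite !sqrrN in p2 p4.
  have -> : C * E = C1 * E + C1 * E + C1 * E + C1 * E by rewrite /C; ring.
  apply: lerD; first apply: lerD; first apply: lerD.
  - apply: le_trans (p1 (tensor_sq_le m l gb1x gb1x gb2y) (key0 _ gb1y) gb1).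
    by rewrite le_eqVlt; apply/orP; left; apply/eqP; ring.
  - apply: le_trans (p2 (tensor_sq_le m l ga1x ga1x ga2y) (key0 _ ga1y) ga1).
    by rewrite le_eqVlt; apply/orP; left; apply/eqP; ring.
  - apply: le_trans (p3 (key0 _ gb2x) (tensor_sq_le m l gb2y gb1x gb2y) gb2).
    by rewrite le_eqVlt; apply/orP; left; apply/eqP; ring.
  - apply: le_trans (p4 (key0 _ ga2x) (tensor_sq_le m l ga2y ga1x ga2y) ga2).
    by rewrite le_eqVlt; apply/orP; left; apply/eqP; ring.
- by apply: (integrableZl mc) iv.
Qed.

(** The flux is divergence free, so its integral over a horizontal section above
    the surface does not depend on the height; its mean over the collar vanishes. *)
Lemma flux_integral_eq0 (Y : R) : top <= Y ->
  (\int[leb]_(x in `]0%R, L[) (flux2 m l a1 a2 b1 b2 (x, Y))%:E = 0)%E.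
Proof.
move=> topY.
have [F1x [F1y [F2x [F2y [hF1 hF2 divF]]]]] := C1w_flux oD sola solb.
(* [K] is the value of the collar function below [lo]; [psi - K] vanishes there. *)
pose K := (top - lo) ^+ 2 / 2.
have K0 : K != 0 by rewrite gt_eqF// divr_gt0// exprn_gt0// subr_gt0.
have heta := C1wD (C1w_collar oD) (@C1w_cst _ D (- K)).
have loY : lo < Y by exact: lt_le_trans lo_top topY.
have sub : `[0, L] `*` `[lo, Y] `<=` D.
  by move=> [x y] [] /=; rewrite !in_itv/= => hx /andP[hy _]; exact: Dlo.
have per (y : R) : lo <= y <= Y ->
  (fun p => (psi p + cst (- K) p) * flux1 m l a1 a2 b1 b2 p) (0 : R, y) =
  (fun p => (psi p + cst (- K) p) * flux1 m l a1 a2 b1 b2 p) (L, y).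
  move=> /andP[hy _]; have Dy : D (0, y) by apply: Dlo => //; rewrite lexx ltW.
  rewrite /=; congr (_ * _); rewrite /flux1.
  have h1 := phase_shift_cross ps1 phase_shift_tensor11 Dy.
  have h2 := phase_shift_cross ps2 phase_shift_tensor21 Dy.
  by rewrite h1 -!addrA h2.
have := rectangle_divergence oD sub L0 loY (C1wM heta hF1) (C1wM heta hF2) per.
have -> : (\int[leb2]_(p in (`]0%R, L[ `*` `]lo, Y[ : set plane))
    ((psi p + cst (- K) p) * F1x p + (cst 0 p + cst 0 p) * flux1 m l a1 a2 b1 b2 p +
     ((psi p + cst (- K) p) * F2y p + (dpsi p + cst 0 p) * flux2 m l a1 a2 b1 b2 p))%:E = 0)%E.
  rewrite -[RHS]cell_flux_eq0 integral_mkcond [RHS]integral_mkcond.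
  apply: eq_integral => p _; rewrite !patchE.
  case: ifPn => [/set_mem[/=]|nrect].
    rewrite !in_itv/= => px /andP[py1 py2].
    have Dp : D p.
      by rewrite [p]surjective_pairing; apply: Dlo; [case/andP: px => /ltW -> /ltW ->|exact: ltW].
    have e : F1x p = - F2y p by apply/eqP; rewrite -addr_eq0 divF.
    have -> : (psi p + cst (- K) p) * F1x p + (cst 0 p + cst 0 p) * flux1 m l a1 a2 b1 b2 p +
     ((psi p + cst (- K) p) * F2y p + (dpsi p + cst 0 p) * flux2 m l a1 a2 b1 b2 p) =
      dpsi p * flux2 m l a1 a2 b1 b2 p by rewrite e /=; ring.
    case: ifPn => // nc; have [pt|pt] := ltP p.2 top; last by rewrite (collar_hi lo_top pt).2 mul0r.
    by case/negP: nc; rewrite inE.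
  case: ifPn => // /set_mem[Dp px pt].
  have [pl|pl] := leP p.2 lo; first by rewrite (collar_lo lo_top pl).2 mul0r.
  case/negP: nrect; rewrite inE; split; rewrite /= in_itv/= ?px// pl /=.
  exact: lt_le_trans topY.
move=> e; have {e} : (\int[leb]_(x in `]0%R, L[) ((- K)%:E * (flux2 m l a1 a2 b1 b2 (x, Y))%:E) = 0)%E.
  rewrite [RHS]e; apply: eq_integral => x _; rewrite -EFinM; congr (_%:E).
  rewrite /= (collar_hi lo_top topY).1 (collar_lo lo_top (lexx lo)).1 /K; ring.
have iF : leb.-integrable `]0, L[ (EFin \o (fun x => flux2 m l a1 a2 b1 b2 (x, Y))).
  have : leb.-integrable `[0, L] (EFin \o (fun x => flux2 m l a1 a2 b1 b2 (x, Y))).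
    apply: continuous_compact_integrable; first exact: segment_compact.
    apply: continuous_in_subspaceT => x /set_mem /=; rewrite in_itv/= => hx.
    have [cF _ _ _ _] := hF2 (x, Y) (Dlo hx (ltW loY)).
    by apply: continuous_comp cF; apply: continuous_pair; [exact: cvg_id|exact: cvg_cst].
  by apply: integrableS => //; exact: subset_itv_oo_cc.
rewrite integralZl// => /eqP; rewrite mule_eq0 eqe oppr_eq0 (negbTE K0) /= => /eqP.
by [].
Qed.

End FluxBalance.

(** * The flux of the scattering solution *)

Section ScatteringFlux.
Context {R : realType}.
Local Notation leb := (@lebesgue_measure R).
Local Notation leb2 := (leb \x leb)%E.
Local Notation plane := (measurableTypeR R * measurableTypeR R)%type.

Lemma mulcE (x y : R[i]) :
  x * y = (Cre x * Cre y - Cim x * Cim y) +i* (Cre x * Cim y + Cim x * Cre y).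
Proof. by case: x => a b; case: y => c d. Qed.

Lemma ReM (x y : R[i]) : Cre (x * y) = Cre x * Cre y - Cim x * Cim y.
Proof. by rewrite mulcE. Qed.
Lemma ImM (x y : R[i]) : Cim (x * y) = Cre x * Cim y + Cim x * Cre y.
Proof. by rewrite mulcE. Qed.
Lemma ReD (x y : R[i]) : Cre (x + y) = Cre x + Cre y.
Proof. by case: x => a b; case: y. Qed.
Lemma ImD (x y : R[i]) : Cim (x + y) = Cim x + Cim y.
Proof. by case: x => a b; case: y. Qed.
Lemma ReN (x : R[i]) : Cre (- x) = - Cre x.
Proof. by case: x. Qed.
Lemma ImN (x : R[i]) : Cim (- x) = - Cim x.
Proof. by case: x. Qed.

Lemma cexp_ci (t : R) : cexp (ci * t%:C) = cos t +i* sin t.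
Proof.
rewrite /cexp /ci ReM ImM /= !(mul0r, mul1r, mulr0, subr0, add0r) expR0.
by rewrite mulcE /= !(mul1r, mul0r, subr0, addr0).
Qed.

Lemma complex_eq (x y : R[i]) : Cre x = Cre y -> Cim x = Cim y -> x = y.
Proof. by case: x => a b; case: y => c d /= -> ->. Qed.

Variables (P : params R) (S : set (R * R)).
Hypothesis L0 : 0 < Lam P.
Hypothesis hS : periodic_surface P S.
Local Notation D := (region_above P S).
Local Notation L := (Lam P).
Local Notation top := (hgt P).
Local Notation c := (cos (alpha P * Lam P)).
Local Notation s := (sin (alpha P * Lam P)).
Let oD : open D := region_open hS.

Lemma quasi_periodic_shift (f : cfield R) x y : quasi_periodic P D f -> D (x, y) ->
  Cre (f (x + L, y)) = c * Cre (f (x, y)) - s * Cim (f (x, y)) /\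
  Cim (f (x + L, y)) = s * Cre (f (x, y)) + c * Cim (f (x, y)).
Proof.
move=> hf Dp; have := hf x y Dp.
have e t : - (ci * t%:C) = ci * (- t)%:C :> R[i] by rewrite -mulrN -rmorphN.
rewrite !e !cexp_ci !cosN !sinN.
set u := f (x + L, y); set v := f (x, y); set T := alpha P * (x + L); set t := alpha P * x.
rewrite !mulcE /= => -[h1 h2].
have Te : T - t = alpha P * L by rewrite /T /t; ring.
have c2 : cos T ^+ 2 + sin T ^+ 2 = 1 by exact: cos2Dsin2.
rewrite -Te cosB sinB; split.
  transitivity ((Cre u * cos T - Cim u * - sin T) * cos T - (Cre u * - sin T + Cim u * cos T) * sin T).
    by rewrite -[LHS]mulr1 -c2; ring.
  by rewrite h1 h2; ring.
transitivity ((Cre u * cos T - Cim u * - sin T) * sin T + (Cre u * - sin T + Cim u * cos T) * cos T).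
  by rewrite -[LHS]mulr1 -c2; ring.
by rewrite h1 h2; ring.
Qed.

Let Dper x y : D (x, y) <-> D (x + L, y) := region_periodic hS x y.

Lemma shift_derive (f g : R * R -> R) (k1 k2 : R) : C1_on D f -> C1_on D g ->
  (forall x y, D (x, y) -> f (x + L, y) = k1 * f (x, y) + k2 * g (x, y)) ->
  forall x y, D (x, y) ->
   dx f (x + L, y) = k1 * dx f (x, y) + k2 * dx g (x, y) /\
   dy f (x + L, y) = k1 * dy f (x, y) + k2 * dy g (x, y).
Proof.
move=> /(C1_on_C1w oD) hf /(C1_on_C1w oD) hg fg x y Dp.
have Dq : D (x + L, y) by exact: (Dper x y).1.
have [_ f1 f2 _ _] := hf _ Dp; have [_ g1 g2 _ _] := hg _ Dp; have [_ q1 q2 _ _] := hf _ Dq.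
have nD : nbhs (x, y) D by exact: open_nbhs_nbhs.
have cx : {for x, continuous (fun t : R => (t, y) : R * R)}.
  by apply: continuous_pair; [exact: cvg_id|exact: cvg_cst].
have cy : {for y, continuous (fun t : R => (x, t) : R * R)}.
  by apply: continuous_pair; [exact: cvg_cst|exact: cvg_id].
have nx : \forall t \near x, D (t, y) by exact: cx.
have ny : \forall t \near y, D (x, t) by exact: cy.
split.
  have h1 := @is_derive1_comp _ (fun t => f (t, y)) (fun t => t + L) x _ _ q1
    (is_deriveD (is_derive_id x 1) (is_derive_cst L x 1)).
  have h2 := is_deriveD (is_deriveZ k1 f1) (is_deriveZ k2 g1).
  have e : \forall t \near x, ((fun t => f (t, y)) \o (fun t => t + L)) t =
     (k1 \*: (fun t => f (t, y)) + k2 \*: (fun t => g (t, y))) t.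
    by apply: filterS nx => t Dt; rewrite /= fg.
  have := near_eq_is_derive e h1 => h3.
  by rewrite -[LHS]mulr1 -[X in _ * X = _]addr0 -(@derive_val _ _ _ _ _ _ _ h3) (@derive_val _ _ _ _ _ _ _ h2).
have h2 := is_deriveD (is_deriveZ k1 f2) (is_deriveZ k2 g2).
have e : \forall t \near y, f (x + L, t) =
   (k1 \*: (fun t => f (x, t)) + k2 \*: (fun t => g (x, t))) t.
  by apply: filterS ny => t Dt; rewrite /= fg.
have h3 := near_eq_is_derive e q2.
by rewrite -(@derive_val _ _ _ _ _ _ _ h3) (@derive_val _ _ _ _ _ _ _ h2).
Qed.

(** In real and imaginary parts the quasi-periodicity factor acts as a rotation. *)
Lemma quasi_periodic_phase_shift (f : cfield R) : quasi_periodic P D f ->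
  phase_shift D L c s (Cre \o f) (Cim \o f).
Proof.
move=> hf y Dy; have [e1 e2] := quasi_periodic_shift hf Dy.
by rewrite add0r in e1 e2.
Qed.

Lemma quasi_periodic_phase_shift_derive (f : cfield R) : quasi_periodic P D f -> cC1_on D f ->
  phase_shift D L c s (dx (Cre \o f)) (dx (Cim \o f)) /\
  phase_shift D L c s (dy (Cre \o f)) (dy (Cim \o f)).
Proof.
move=> hf [fr fi].
have e1 x y : D (x, y) -> (Cre \o f) (x + L, y) = c * (Cre \o f) (x, y) + (- s) * (Cim \o f) (x, y).
  by move=> /(quasi_periodic_shift hf)[h _]; rewrite /= h mulNr.
have e2 x y : D (x, y) -> (Cim \o f) (x + L, y) = c * (Cim \o f) (x, y) + s * (Cre \o f) (x, y).
  by move=> /(quasi_periodic_shift hf)[_ h]; rewrite /= h addrC.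
have h1 := shift_derive fr fi e1; have h2 := shift_derive fi fr e2.
split=> y Dy; have [x1 y1] := h1 _ _ Dy; have [x2 y2] := h2 _ _ Dy.
  rewrite add0r in x1 x2; rewrite x1 x2 mulNr; split; first by [].
  by rewrite addrC.
rewrite add0r in y1 y2; rewrite y1 y2 mulNr; split; first by [].
by rewrite addrC.
Qed.

Definition h1_density (f : cfield R) (p : R * R) : R :=
  normsq (f p) + normsq (cdx f p) + normsq (cdy f p).

Lemma h1_density_ge0 f p : 0 <= h1_density f p.
Proof. by rewrite /h1_density /normsq !addr_ge0 ?sqr_ge0. Qed.

Lemma h1_density_measurable f fx1 fy1 fx2 fy2 :
  C1w D (Cre \o f) fx1 fy1 -> C1w D (Cim \o f) fx2 fy2 ->
  measurable_fun (Omega P S : set plane) (h1_density f : plane -> measurableTypeR R).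
Proof.
move=> h1 h2.
have oO : open (Omega P S) by exact: (@cell_open _ D L top oD).
have mono p : Omega P S p -> {for p, continuous (fun p => (Cre \o f) p ^+ 2 + (Cim \o f) p ^+ 2
   + (fx1 p ^+ 2 + fx2 p ^+ 2) + (fy1 p ^+ 2 + fy2 p ^+ 2))}.
  case=> Dp _ _; have [c1 _ _ c2 c3] := h1 p Dp; have [d1 _ _ d2 d3] := h2 p Dp.
  by apply: cvgD; [apply: cvgD|]; apply: cvgD; apply: cvgM.
have := continuous_plane_measurable oO mono.
apply: eq_measurable_fun => p /set_mem[Dp _ _].
have [e1 e2] := C1w_dx h1 Dp; have [e3 e4] := C1w_dx h2 Dp.
by rewrite /h1_density /normsq /cdx /cdy /= e1 e2 e3 e4.
Qed.

Variable u : vfield R.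
Hypothesis hu : scattering_solution P S u.
Local Notation a1 := (Cre \o u.1).
Local Notation b1 := (Cim \o u.1).
Local Notation a2 := (Cre \o u.2).
Local Notation b2 := (Cim \o u.2).

Lemma lame_solution_parts :
  lame_solution D (mu P) (lambda P + mu P) (omega P ^+ 2) a1 a2 /\
  lame_solution D (mu P) (lambda P + mu P) (omega P ^+ 2) b1 b2.
Proof.
have [[[ca1 cb1] [ca2 cb2]] nav _ _ _] := hu.
have [_ /(C1_on_C1w oD) a1x /(C1_on_C1w oD) a1y] := ca1.
have [_ /(C1_on_C1w oD) b1x /(C1_on_C1w oD) b1y] := cb1.
have [_ /(C1_on_C1w oD) a2x /(C1_on_C1w oD) a2y] := ca2.
have [_ /(C1_on_C1w oD) b2x /(C1_on_C1w oD) b2y] := cb2.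
have da p : D p -> dx (Cre \o divergence u) p = dx (dx a1) p + dx (dy a2) p /\
    dy (Cre \o divergence u) p = dy (dx a1) p + dy (dy a2) p.
  exact: (@C1w_dx _ D _ _ _ p (C1wD a1x a2y)).
have db p : D p -> dx (Cim \o divergence u) p = dx (dx b1) p + dx (dy b2) p /\
    dy (Cim \o divergence u) p = dy (dx b1) p + dy (dy b2) p.
  exact: (@C1w_dx _ D _ _ _ p (C1wD b1x b2y)).
have real_mulC (k : R) (z : R[i]) : k%:C * z = (k * Cre z) +i* (k * Cim z).
  by rewrite mulcE /= !mul0r subr0 addr0.
have lapE (f : cfield R) p : laplace f p =
    (dx (dx (Cre \o f)) p + dy (dy (Cre \o f)) p) +i* (dx (dx (Cim \o f)) p + dy (dy (Cim \o f)) p).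
  by [].
have cdxE (f : cfield R) p : cdx f p = dx (Cre \o f) p +i* dx (Cim \o f) p by [].
have cdyE (f : cfield R) p : cdy f p = dy (Cre \o f) p +i* dy (Cim \o f) p by [].
have eqs p : D p -> 
   [/\ mu P * (dx (dx a1) p + dy (dy a1) p) + (lambda P + mu P) * (dx (dx a1) p + dx (dy a2) p)
      + omega P ^+ 2 * a1 p = 0,
    mu P * (dx (dx a2) p + dy (dy a2) p) + (lambda P + mu P) * (dy (dx a1) p + dy (dy a2) p)
      + omega P ^+ 2 * a2 p = 0,
    mu P * (dx (dx b1) p + dy (dy b1) p) + (lambda P + mu P) * (dx (dx b1) p + dx (dy b2) p)
      + omega P ^+ 2 * b1 p = 0 &
    mu P * (dx (dx b2) p + dy (dy b2) p) + (lambda P + mu P) * (dy (dx b1) p + dy (dy b2) p)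
      + omega P ^+ 2 * b2 p = 0].
  move=> Dp; have [n1 n2] := nav p Dp; have [xa ya] := da p Dp; have [xb yb] := db p Dp.
  rewrite !real_mulC lapE cdxE xa xb in n1; rewrite !real_mulC lapE cdyE ya yb in n2.
  by case: n1 => n1a n1b; case: n2 => n2a n2b; split.
by split; split => // p /eqs[].
Qed.

Let mO : measurable (Omega P S : set plane) := @cell_measurable _ D L top oD.

Lemma energy_h1_density (f g : cfield R) p :
  energy (vec4 (Cre \o f) (Cim \o f) (Cre \o g) (Cim \o g))
    (vec4 (dx (Cre \o f)) (dx (Cim \o f)) (dx (Cre \o g)) (dx (Cim \o g)))
    (vec4 (dy (Cre \o f)) (dy (Cim \o f)) (dy (Cre \o g)) (dy (Cim \o g))) p =
  h1_density f p + h1_density g p.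
Proof. by rewrite /energy sum_ord4 /vec4 /h1_density /normsq /=; ring. Qed.

(** The density of the squared H1 norm of the two components is the energy of their four
    real parts, so the approximations of the trace condition converge in energy. *)
Lemma scattering_flux_eq0 (Y : R) : top <= Y ->
  (\int[leb]_(x in `]0%R, L[)
    (flux2 (mu P) (lambda P + mu P) a1 a2 b1 b2 (x, Y))%:E = 0)%E.
Proof.
have [[[ca1 cb1] [ca2 cb2]] nav [h1 h2] [[w1 [hw1 lim1]] [w2 [hw2 lim2]]] [[qp1 qp2] _]] := hu.
have [sola solb] := lame_solution_parts.
have [lo lo_top Dlo] := region_collar L0 hS.
have [bot bot_top Dbot] := region_bounded_below L0 hS.
have D0 y : D (0, y) <-> D (L, y) by have := Dper 0 y; rewrite add0r.
have c1a : C1_on D a1 by case: ca1. have c1b : C1_on D b1 by case: cb1.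
have c2a : C1_on D a2 by case: ca2. have c2b : C1_on D b2 by case: cb2.
have C1wB (f g : R * R -> R) : C1_on D f -> C1_on D g ->
    C1w D (fun p => f p - g p) (fun p => dx f p - dx g p) (fun p => dy f p - dy g p).
  move=> /(C1_on_C1w oD) hf /(C1_on_C1w oD) hg.
  apply: (C1w_ext oD _ (C1wD hf (C1wN oD hg))) => p Dp; by split.
have [p1x p1y] := quasi_periodic_phase_shift_derive qp1 (conj c1a c1b).
have [p2x p2y] := quasi_periodic_phase_shift_derive qp2 (conj c2a c2b).
have cs1 : c ^+ 2 + s ^+ 2 = 1 by exact: cos2Dsin2.
have iv : leb2.-integrable (cell D L top : set plane) (EFin \o
    energy (vec4 a1 b1 a2 b2) (vec4 (dx a1) (dx b1) (dx a2) (dx b2))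
      (vec4 (dy a1) (dy b1) (dy a2) (dy b2))).
  apply/integrableP; split.
    apply/measurable_EFinP; apply: (energy_measurable oD) => i.
    by apply: C1w_vec4; exact: C1_on_C1w.
  have m1 := h1_density_measurable (C1_on_C1w oD c1a) (C1_on_C1w oD c1b).
  have m2 := h1_density_measurable (C1_on_C1w oD c2a) (C1_on_C1w oD c2b).
  rewrite (_ : (fun _ => _) = (fun p => (h1_density u.1 p)%:E + (h1_density u.2 p)%:E)%E).
    have H1 : (\int[leb2]_(p in (cell D L top : set plane)) (h1_density u.1 p)%:E < +oo)%E by exact: h1.
    have H2 : (\int[leb2]_(p in (cell D L top : set plane)) (h1_density u.2 p)%:E < +oo)%E by exact: h2.
    have M1 := (measurable_EFinP _ _).2 m1. have M2 := (measurable_EFinP _ _).2 m2.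
    have P1 (p : plane) : cell D L top p -> (0 <= (h1_density u.1 p)%:E)%E by rewrite lee_fin h1_density_ge0.
    have P2 (p : plane) : cell D L top p -> (0 <= (h1_density u.2 p)%:E)%E by rewrite lee_fin h1_density_ge0.
    rewrite (ge0_integralD _ mO P1 M1 P2 M2).
    exact: (lte_add_pinfty H1 H2).
  apply/funext => p /=; rewrite ger0_norm ?energy_ge0// -EFinD; congr (_%:E).
  exact: energy_h1_density.
have C1_w k : [/\ C1_on D (Cre \o w1 k), C1_on D (Cim \o w1 k), C1_on D (Cre \o w2 k) &
    C1_on D (Cim \o w2 k)].
  by have [[? ?] _ _ _ _] := hw1 k; have [[? ?] _ _ _ _] := hw2 k; split.
have cont_w k i : {within D `|` S, continuous
    (vec4 (Cre \o w1 k) (Cim \o w1 k) (Cre \o w2 k) (Cim \o w2 k) i)}.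
  have [_ _ k1 k2 _] := hw1 k; have [_ _ k3 k4 _] := hw2 k.
  by case: i => [[|[|[|[|//]]]] ?].
have zero_w k i p : S p -> vec4 (Cre \o w1 k) (Cim \o w1 k) (Cre \o w2 k) (Cim \o w2 k) i p = 0.
  move=> Sp; have [_ _ _ _ z1] := hw1 k; have [_ _ _ _ z2] := hw2 k.
  by case: i => [[|[|[|[|//]]]] ?]; rewrite /vec4/= ?z1// z2.
have psw1 k : phase_shift D L c s (Cre \o w1 k) (Cim \o w1 k).
  by have [_ qw _ _ _] := hw1 k; exact: quasi_periodic_phase_shift.
have psw2 k : phase_shift D L c s (Cre \o w2 k) (Cim \o w2 k).
  by have [_ qw _ _ _] := hw2 k; exact: quasi_periodic_phase_shift.
pose d1 k : cfield R := fun p => u.1 p - w1 k p.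
pose d2 k : cfield R := fun p => u.2 p - w2 k p.
have Ccomp (f g : cfield R) : Cre \o (fun p => f p - g p) = (fun p => (Cre \o f) p - (Cre \o g) p) /\
    Cim \o (fun p => f p - g p) = (fun p => (Cim \o f) p - (Cim \o g) p).
  by split; apply/funext => p /=; rewrite ?ReD ?ImD ?ReN ?ImN.
have cd1 k : C1w D (Cre \o d1 k) (fun p => dx a1 p - dx (Cre \o w1 k) p) (fun p => dy a1 p - dy (Cre \o w1 k) p) /\
   C1w D (Cim \o d1 k) (fun p => dx b1 p - dx (Cim \o w1 k) p) (fun p => dy b1 p - dy (Cim \o w1 k) p).
  have [[? ?] _ _ _ _] := hw1 k; rewrite /d1 (Ccomp _ _).1 (Ccomp _ _).2.
  by split; exact: C1wB.
have cd2 k : C1w D (Cre \o d2 k) (fun p => dx a2 p - dx (Cre \o w2 k) p) (fun p => dy a2 p - dy (Cre \o w2 k) p) /\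
   C1w D (Cim \o d2 k) (fun p => dx b2 p - dx (Cim \o w2 k) p) (fun p => dy b2 p - dy (Cim \o w2 k) p).
  have [[? ?] _ _ _ _] := hw2 k; rewrite /d2 (Ccomp _ _).1 (Ccomp _ _).2.
  by split; exact: C1wB.
move=> topY; apply: (flux_integral_eq0 oD (region_closedU hS) L0 bot_top lo_top
  Dbot D0 Dlo cs1 sola solb (quasi_periodic_phase_shift qp1)
  (quasi_periodic_phase_shift qp2) p1x p2x p2y iv C1_w cont_w zero_w psw1 psw2 _ topY).
have := cvgeD _ lim1 lim2; rewrite adde0 => /(_ _ isT) lim12; apply: cvg_trans lim12.
apply: near_eq_cvg; apply: nearW => k /=.
have [r1 i1] := cd1 k; have [r2 i2] := cd2 k.
rewrite /H1normsq -/(d1 k) -/(d2 k) -ge0_integralD//; first last.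
- by apply/measurable_EFinP; exact: (h1_density_measurable r2 i2).
- by move=> p _; rewrite lee_fin (h1_density_ge0 (d2 k) p).
- by apply/measurable_EFinP; exact: (h1_density_measurable r1 i1).
- by move=> p _; rewrite lee_fin (h1_density_ge0 (d1 k) p).
apply: eq_integral => p /set_mem[Dp _ _]; rewrite -EFinD; congr (_%:E).
transitivity (h1_density (d1 k) p + h1_density (d2 k) p) => //.
rewrite -energy_h1_density /energy !sum_ord4 /vec4 /=.
have [-> ->] := C1w_dx r1 Dp; have [-> ->] := C1w_dx i1 Dp.
have [-> ->] := C1w_dx r2 Dp; have [-> ->] := C1w_dx i2 Dp.
by rewrite /d1 /d2 !(ReD, ImD, ReN, ImN).
Qed.

End ScatteringFlux.

(** * Complex functions of a real variable *)

Section ComplexCurves.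
Context {R : realType}.
Implicit Types z w : R[i].

Lemma normc_ge0 z : 0 <= normc z.
Proof. by case: z => a b; exact: sqrtr_ge0. Qed.

Lemma sqr_normcE z : normc z ^+ 2 = normsq z.
Proof. by case: z => a b; rewrite /normc sqr_sqrtr// addr_ge0 ?sqr_ge0. Qed.

Lemma Re_le_normc z : `|Cre z| <= normc z.
Proof.
case: z => a b /=; rewrite -sqrtr_sqr ler_sqrt ?addr_ge0 ?sqr_ge0//.
by rewrite lerDl sqr_ge0.
Qed.

Lemma Im_le_normc z : `|Cim z| <= normc z.
Proof.
case: z => a b /=; rewrite -sqrtr_sqr ler_sqrt ?addr_ge0 ?sqr_ge0//.
by rewrite lerDr sqr_ge0.
Qed.

Lemma normc_le_parts z : normc z <= `|Cre z| + `|Cim z|.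
Proof.
rewrite -(@ler_pXn2r _ 2)// ?nnegrE ?normc_ge0 ?addr_ge0//.
rewrite sqr_normcE /normsq -[X in X + _ <= _]real_normK ?num_real// -[X in _ + X <= _]real_normK ?num_real//.
have := normr_ge0 (Cre z); have := normr_ge0 (Cim z); set a := `|Cre z|; set b := `|Cim z|; nra.
Qed.

Lemma normc_real (x : R) : normc x%:C = `|x|.
Proof. by rewrite /= expr0n addr0 sqrtr_sqr. Qed.

Lemma normc_ci : normc (ci : R[i]) = 1.
Proof. by rewrite /= expr0n expr1n add0r sqrtr1. Qed.

Lemma normcD z w : normc (z + w) <= normc z + normc w.
Proof. exact: (le_normcD z w). Qed.

Lemma Re_sum (I : Type) (r : seq I) (F : I -> R[i]) :
  Cre (\sum_(i <- r) F i) = \sum_(i <- r) Cre (F i).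
Proof. by elim: r => [|i r IH]; rewrite ?big_nil// !big_cons ReD IH. Qed.

Lemma Im_sum (I : Type) (r : seq I) (F : I -> R[i]) :
  Cim (\sum_(i <- r) F i) = \sum_(i <- r) Cim (F i).
Proof. by elim: r => [|i r IH]; rewrite ?big_nil// !big_cons ImD IH. Qed.

Lemma cexpD z w : cexp (z + w) = cexp z * cexp w.
Proof.
rewrite /cexp !ReD !ImD expRD cosD sinD; apply: complex_eq; rewrite !(ReM, ImM) /=; ring.
Qed.

Lemma normsqM z w : normsq (z * w) = normsq z * normsq w.
Proof. by rewrite /normsq ReM ImM; ring. Qed.

Lemma normsq_cexp z : normsq (cexp z) = expR (Cre z) ^+ 2.
Proof.
rewrite /cexp normsqM /normsq /= expr0n addr0 cos2Dsin2 mulr1 //.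
Qed.

Lemma normc_cexp z : normc (cexp z) = expR (Cre z).
Proof.
by apply/eqP; rewrite -(@eqrXn2 _ 2)// ?normc_ge0 ?expR_ge0// sqr_normcE normsq_cexp.
Qed.

Definition is_cderive (f : R -> R[i]) (t : R) (d : R[i]) :=
  is_derive t 1 (Cre \o f) (Cre d) /\ is_derive t 1 (Cim \o f) (Cim d).

Lemma is_cderiveD f g t a b : is_cderive f t a -> is_cderive g t b ->
  is_cderive (fun t => f t + g t) t (a + b).
Proof.
move=> [f1 f2] [g1 g2]; rewrite /is_cderive ReD ImD.
have -> : Cre \o (fun t => f t + g t) = (Cre \o f) + (Cre \o g) by apply/funext => x; exact: ReD.
have -> : Cim \o (fun t => f t + g t) = (Cim \o f) + (Cim \o g) by apply/funext => x; exact: ImD.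
by split; exact: is_deriveD.
Qed.

Lemma is_cderiveZ f t a k : is_cderive f t a -> is_cderive (fun t => k * f t) t (k * a).
Proof.
move=> [f1 f2]; rewrite /is_cderive ReM ImM.
have -> : Cre \o (fun t => k * f t) = Cre k \*: (Cre \o f) - Cim k \*: (Cim \o f).
  by apply/funext => x; exact: ReM.
have -> : Cim \o (fun t => k * f t) = Cre k \*: (Cim \o f) + Cim k \*: (Cre \o f).
  by apply/funext => x; exact: ImM.
split; last by exact: (is_deriveD (is_deriveZ (Cre k) f2) (is_deriveZ (Cim k) f1)).
exact: (is_deriveB (is_deriveZ (Cre k) f1) (is_deriveZ (Cim k) f2)).
Qed.

Lemma is_cderive_sum (I : Type) (r : seq I) (f : I -> R -> R[i]) t (d : I -> R[i]) :
  (forall i, is_cderive (f i) t (d i)) ->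
  is_cderive (fun t => \sum_(i <- r) f i t) t (\sum_(i <- r) d i).
Proof.
move=> h; elim: r => [|i r IH].
  have -> : (fun t => \sum_(i <- [::]) f i t) = cst 0 by apply/funext => x; rewrite big_nil.
  by rewrite big_nil; split; exact: is_derive_cst.
have -> : (fun t => \sum_(j <- i :: r) f j t) = (fun t => f i t + \sum_(j <- r) f j t).
  by apply/funext => x; rewrite big_cons.
by rewrite big_cons; exact: is_cderiveD.
Qed.

Lemma is_cderive_cexp (z w : R[i]) (t : R) :
  is_cderive (fun t => cexp (z + w * t%:C)) t (w * cexp (z + w * t%:C)).
Proof.
have lin (a b : R) : is_derive t 1 (fun t : R => a + b * t) b.
  have h := is_deriveD (is_derive_cst a t 1) (is_deriveZ b (is_derive_id t 1)).
  by apply: is_derive_eq h _; rewrite add0r /GRing.scale/= mulr1.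
have fE : (fun t => cexp (z + w * t%:C)) = (fun t : R =>
   (expR (Cre z + Cre w * t) * cos (Cim z + Cim w * t)) +i*
   (expR (Cre z + Cre w * t) * sin (Cim z + Cim w * t))).
  apply/funext => x; rewrite /cexp; apply: complex_eq;
  by rewrite !(ReM, ImM) /= !(ReD, ImD) !(ReM, ImM) /= !(mul0r, mulr0, subr0, add0r, addr0).
rewrite fE.
have e1 := @is_derive1_comp _ expR _ t _ _ (is_derive_expR _) (lin (Cre z) (Cre w)).
have e2 := @is_derive1_comp _ (@cos R) _ t _ _ (is_derive_cos _) (lin (Cim z) (Cim w)).
have e3 := @is_derive1_comp _ (@sin R) _ t _ _ (is_derive_sin _) (lin (Cim z) (Cim w)).
have -> : cexp (z + w * t%:C) =
   (expR (Cre z + Cre w * t) * cos (Cim z + Cim w * t)) +i*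
   (expR (Cre z + Cre w * t) * sin (Cim z + Cim w * t)) by rewrite -[RHS](congr1 (fun f => f t) fE).
split.
  apply: is_derive_eq (is_deriveM e1 e2) _.
  by rewrite ReM /= /GRing.scale/=; ring.
apply: is_derive_eq (is_deriveM e1 e3) _.
by rewrite ImM /= /GRing.scale/=; ring.
Qed.

(** Second derivatives bounded uniformly in [N] make the difference quotients
    converge uniformly, so differentiation passes to the pointwise limit. *)
Lemma is_derive_limit (F F1 F2 : nat -> R -> R) (G : R -> R) (g x r K : R) : 0 < r ->
  (forall N (z : R), ball x r z -> is_derive z 1 (F N) (F1 N z)) ->
  (forall N (z : R), ball x r z -> is_derive z 1 (F1 N) (F2 N z)) ->
  (forall N (z : R), ball x r z -> `|F2 N z| <= K) ->
  (forall (z : R), ball x r z -> F N z @[N --> \oo] --> G z) ->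
  F1 N x @[N --> \oo] --> g ->
  is_derive x 1 G g.
Proof.
move=> r0 d1 d2 bK lF lF1.
have K0 : 0 <= K by apply: le_trans (bK 0%N x (ballxx _ r0)).
have mvt (f df : R -> R) (z : R) : ball x r z -> (forall y, ball x r y -> is_derive y 1 f (df y)) ->
    exists2 y, `|y - x| <= `|z - x| & f z - f x = df y * (z - x).
  move=> xz hf.
  have inb y : y \in `[Num.min x z, Num.max x z] -> `|y - x| <= `|z - x| /\ ball x r y.
    move: xz; rewrite /ball/= in_itv/= => xz yin.
    suff h : `|y - x| <= `|z - x|.
      by split => //; rewrite distrC (le_lt_trans h)// distrC.
    move: yin; have [xz'|zx] := leP x z => /andP[y1 y2].
      by rewrite !ger0_norm ?subr_ge0// lerD2r.
    by rewrite distrC [leRHS]distrC !ger0_norm ?subr_ge0 ?(ltW zx)// lerD2l lerN2.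
  have lem : Num.min x z <= Num.max x z by rewrite ge_min !le_max !lexx.
  have dq y : y \in `]Num.min x z, Num.max x z[ -> is_derive y 1 f (df y).
    by move=> /subset_itv_oo_cc/inb[_]; exact: hf.
  have cw : {within `[Num.min x z, Num.max x z], continuous f}.
    by apply: derivable_within_continuous => y /inb[_ /hf[]].
  have [y /inb[yx _]] := MVT_segment lem dq cw.
  have [_|_] := leP x z => e; exists y => //.
  by rewrite -opprB e -mulrN opprB.
have quad N (z : R) : ball x r z -> `|F N z - F N x - F1 N x * (z - x)| <= K * `|z - x| ^+ 2.
  move=> xz; have [y yx ->] := mvt (F N) (F1 N) z xz (d1 N).
  rewrite -mulrBl normrM expr2 mulrA; apply: ler_wpM2r => //.
  have xy : ball x r y.
    by move: xz; rewrite /ball/= ![`|x - _|]distrC; exact: le_lt_trans.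
  have [v vx ->] := mvt (F1 N) (F2 N) y xy (d2 N).
  have xv : ball x r v.
    by move: xy; rewrite /ball/= ![`|x - _|]distrC; exact: le_lt_trans.
  by rewrite normrM; apply: ler_pM => //; exact: bK.
have limquad (z : R) : ball x r z -> `|G z - G x - g * (z - x)| <= K * `|z - x| ^+ 2.
  move=> xz.
  have l : `|F N z - F N x - F1 N x * (z - x)| @[N --> \oo] --> `|G z - G x - g * (z - x)|.
    apply: cvg_norm; apply: cvgB; last by apply: cvgM => //; exact: cvg_cst.
    by apply: cvgB; apply: lF => //; exact: ballxx.
  rewrite -(cvg_lim _ l)//; apply: limr_le; first by apply/cvg_ex; eexists; exact: l.
  by apply: nearW => N; exact: quad.
have lim : h^-1 *: (G (h *: 1 + x) - G x) @[h --> 0^'] --> g.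
  apply/cvgrPdist_lt => e e0; apply/nbhs_ballP.
  exists (Num.min r (e / (K + 1))); first by rewrite /= lt_min r0 divr_gt0// ltr_wpDl.
  move=> h; rewrite /ball/= sub0r normrN lt_min => /andP[hr he] h0.
  rewrite [h *: 1]mulr1 /GRing.scale/=.
  have := limquad (h + x); rewrite /ball/= addrK opprD addrA addrAC subrr sub0r normrN => /(_ hr) q.
  have hp : 0 < `|h| by rewrite normr_gt0.
  have -> : g - h^-1 * (G (h + x) - G x) = - (h^-1 * (G (h + x) - G x - g * h)).
    by field.
  rewrite normrN normrM normfV mulrC ltr_pdivrMr//.
  apply: (le_lt_trans q); rewrite expr2 mulrA ltr_pM2r//.
  have k1 : 0 < K + 1 by rewrite ltr_wpDl.
  move: he; rewrite ltr_pdivlMr// => he; apply: le_lt_trans he.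
  by rewrite mulrC ler_wpM2l// lerDl.
apply: DeriveDef; first by apply/cvg_ex; exists g.
exact: cvg_lim lim.
Qed.

End ComplexCurves.

(** * Symmetric series and sequences of subexponential growth *)

Section SymmetricSums.
Context {R : realType}.
Implicit Types F : int -> R[i].

Lemma psumZ0 F : psumZ F 0 = F 0.
Proof. by rewrite /psumZ big_nat1 subr0. Qed.

Lemma psumZS F N : psumZ F N.+1 = psumZ F N + (F N.+1%:Z + F (- N.+1%:Z)).
Proof.
rewrite /psumZ doubleS big_nat_recl// big_nat_recr//= addrCA; congr (_ + _).
  apply: eq_big_nat => k _; congr (F _).
  lia.
rewrite addrC; congr (F _ + F _); last by rewrite sub0r.
rewrite -addnn; lia.
Qed.

Lemma psumZ_bound F (K q : R) N : 0 <= q -> q < 1 ->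
  (forall n, normc (F n) <= K * q ^+ `|n|%N) -> normc (psumZ F N) <= 2 * K / (1 - q).
Proof.
move=> q0 q1 hF; have d0 : 0 < 1 - q by rewrite subr_gt0.
have K0 : 0 <= K by have := hF 0; rewrite expr0 mulr1; apply: le_trans; exact: normc_ge0.
suff h : normc (psumZ F N) <= 2 * K / (1 - q) * (1 - q ^+ N.+1).
  apply: (le_trans h); rewrite ler_piMr ?divr_ge0 ?mulr_ge0 ?(ltW d0)//.
  by rewrite gerBl exprn_ge0.
elim: N => [|N IH].
  rewrite psumZ0 expr1 divfK ?gt_eqF//; apply: (le_trans (hF 0)).
  by rewrite expr0 mulr1; lra.
rewrite psumZS; apply: (le_trans (normcD _ _)).
apply: (le_trans (lerD IH (normcD _ _))).
have h1 := hF N.+1%:Z; have h2 := hF (- N.+1%:Z); rewrite abszN !absz_nat in h1 h2.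
apply: (le_trans (lerD (lexx _) (lerD h1 h2))).
have -> : K * q ^+ N.+1 + K * q ^+ N.+1 = 2 * K / (1 - q) * (q ^+ N.+1 * (1 - q)).
  by field; rewrite gt_eqF.
by rewrite -mulrDr; apply: ler_wpM2l;
  rewrite ?divr_ge0 ?mulr_ge0 ?(ltW d0)// [q ^+ N.+2]exprS; lra.
Qed.

Lemma geometric_steps_cvg (v : nat -> R) (C q : R) : 0 <= q -> q < 1 ->
  (forall N, `|v N.+1 - v N| <= C * q ^+ N) -> cvgn v.
Proof.
move=> q0 q1 hv.
have c1 : cvgn (series (fun N => v N.+1 - v N)).
  apply: normed_cvg; apply: (@series_le_cvg _ _ (geometric C q)).
  - by move=> n; exact: normr_ge0.
  - by move=> n; rewrite /geometric/=; apply: le_trans (hv n).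
  - by move=> n; exact: hv.
  - by apply: is_cvg_geometric_series; rewrite ger0_norm.
have -> : v = (fun N => v 0%N + series (fun N => v N.+1 - v N) N).
  apply/funext => N; rewrite /series /= telescope_sumr//.
  by rewrite addrC subrK.
by apply: is_cvgD => //; exact: is_cvg_cst.
Qed.

Lemma seriesZ_cvg F (K q : R) : 0 <= q -> q < 1 ->
  (forall n, normc (F n) <= K * q ^+ `|n|%N) ->
  seriesZ_to F (limn (fun N => Cre (psumZ F N)) +i* limn (fun N => Cim (psumZ F N))).
Proof.
move=> q0 q1 hF.
have step N : normc (psumZ F N.+1 - psumZ F N) <= 2 * K * q * q ^+ N.
  rewrite psumZS addrC addKr; apply: (le_trans (normcD _ _)).
  have h1 := hF N.+1%:Z; have h2 := hF (- N.+1%:Z); rewrite abszN !absz_nat exprS in h1 h2.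
  lra.
split => /=; apply: (geometric_steps_cvg q0 q1 (C := 2 * K * q)) => N.
  by apply: le_trans (step N); rewrite -ReN -ReD; exact: Re_le_normc.
by apply: le_trans (step N); rewrite -ImN -ImD; exact: Im_le_normc.
Qed.

Lemma seriesZ_to_bound F l (B : R) : seriesZ_to F l -> (forall N, normc (psumZ F N) <= B) ->
  `|Cre l| <= B /\ `|Cim l| <= B.
Proof.
move=> [h1 h2] hB; split.
  have c1 : `|Cre (psumZ F N)| @[N --> \oo] --> `|Cre l| by exact: cvg_norm.
  rewrite -(cvg_lim _ c1)//; apply: limr_le.
    by apply/cvg_ex; eexists; exact: c1.
  by apply: nearW => N; apply: le_trans (hB N); exact: Re_le_normc.
have c2 : `|Cim (psumZ F N)| @[N --> \oo] --> `|Cim l| by exact: cvg_norm.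
 rewrite -(cvg_lim _ c2)//; apply: limr_le.
  by apply/cvg_ex; eexists; exact: c2.
by apply: nearW => N; apply: le_trans (hB N); exact: Im_le_normc.
Qed.

Lemma seriesZ_to_unique F l l' : seriesZ_to F l -> seriesZ_to F l' -> l = l'.
Proof.
by move=> [h1 h2] [h3 h4]; apply: complex_eq; [apply: cvg_unique h1 h3|apply: cvg_unique h2 h4].
Qed.

Lemma seriesZ_toD F G l l' : seriesZ_to F l -> seriesZ_to G l' ->
  seriesZ_to (fun n => F n + G n) (l + l').
Proof.
move=> [h1 h2] [h3 h4].
have e N : psumZ (fun n => F n + G n) N = psumZ F N + psumZ G N by rewrite /psumZ big_split.
split; rewrite ?ReD ?ImD.
  by under eq_fun do rewrite e ReD; exact: cvgD.
by under eq_fun do rewrite e ImD; exact: cvgD.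
Qed.

(** Sequences of subexponential growth: stable under products, and small against
    the exponential decay of the modes above the line. *)
Definition tame (c : int -> R[i]) := forall eta : R, 0 < eta ->
  exists C, forall n, normc (c n) <= C * expR (eta * `|n|%N%:R).

Lemma tameM c d : tame c -> tame d -> tame (fun n => c n * d n).
Proof.
move=> hc hd eta eta0; have e2 : 0 < eta / 2 by rewrite divr_gt0.
have [C hC] := hc _ e2; have [E hE] := hd _ e2.
exists (C * E) => n; rewrite normcM.
have -> : C * E * expR (eta * `|n|%N%:R) =
    C * expR (eta / 2 * `|n|%N%:R) * (E * expR (eta / 2 * `|n|%N%:R)).
  have -> : eta * `|n|%N%:R = eta / 2 * `|n|%N%:R + eta / 2 * `|n|%N%:R by field.
  by rewrite expRD; ring.
by apply: ler_pM => //; exact: normc_ge0.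
Qed.

Lemma tameD c d : tame c -> tame d -> tame (fun n => c n + d n).
Proof.
move=> hc hd eta eta0; have [C hC] := hc _ eta0; have [E hE] := hd _ eta0.
exists (C + E) => n; apply: (le_trans (normcD _ _)); rewrite mulrDl; exact: lerD.
Qed.

Lemma tame_linear c (A B : R) : 0 <= B -> (forall n, normc (c n) <= A + B * `|n|%N%:R) -> tame c.
Proof.
move=> B0 hc eta eta0; exists (`|A| + B / eta) => n; apply: (le_trans (hc n)).
rewrite mulrDl; apply: lerD.
  apply: (le_trans (ler_norm A)); rewrite ler_peMr// -expR0 ler_expR.
  by rewrite mulr_ge0// ltW.
have -> : B * `|n|%N%:R = B / eta * (eta * `|n|%N%:R) by field; rewrite gt_eqF.
apply: ler_wpM2l; first by rewrite divr_ge0// ltW.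
apply: le_trans (expR_ge1Dx _); lra.
Qed.

Lemma tame_bounded c (A : R) : (forall n, normc (c n) <= A) -> tame c.
Proof. by move=> h; apply: (@tame_linear _ A 0) => // n; rewrite mul0r addr0. Qed.

Lemma tame_le c d : (forall n, normc (c n) <= normc (d n)) -> tame d -> tame c.
Proof.
by move=> h hd eta eta0; have [C hC] := hd eta eta0; exists C => n; exact: le_trans (h n) (hC n).
Qed.

Lemma bounded_of_eventually (c : int -> R[i]) (N : nat) (A : R) :
  (forall n, (N <= `|n|)%N -> normc (c n) <= A) -> exists B, forall n, normc (c n) <= B.
Proof.
elim: N A => [|N IH] A h; first by exists A => n; exact: h.
apply: (IH (Num.max A (Num.max (normc (c N%:Z)) (normc (c (- N%:Z)))))) => n.
rewrite leq_eqVlt => /orP[/eqP e|/h]; last by rewrite le_max => ->.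
rewrite !le_max; case: n e => m e; first by rewrite absz_nat in e; rewrite e lexx !orbT.
have -> : Negz m = - N%:Z by rewrite NegzE; congr (- _%:Z).
by rewrite lexx !orbT.
Qed.

End SymmetricSums.

(** * Rayleigh modes *)

Section Modes.
Context {R : realType}.
Variables (P : params R).
Hypothesis L0 : 0 < Lam P.
Local Notation L := (Lam P).
Local Notation top := (hgt P).
Local Notation al := (alphan P).

(** The spacing of the frequencies [al n]. *)
Definition freq_step : R := 2 * pi / L.

Lemma freq_step_gt0 : 0 < freq_step.
Proof. by rewrite divr_gt0// mulr_gt0// pi_gt0. Qed.

Lemma alphanE n : al n = alpha P + freq_step * n%:~R.
Proof. by rewrite /alphan /freq_step; congr (_ + _); rewrite mulrAC. Qed.

Lemma norm_intr n : `|n%:~R : R| = `|n|%N%:R.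
Proof. by rewrite -intr_norm -abszE. Qed.

Let norm_freq n : `|freq_step * n%:~R| = freq_step * `|n|%N%:R.
Proof. by rewrite normrM norm_intr gtr0_norm// freq_step_gt0. Qed.

Lemma alphan_ge n : freq_step * `|n|%N%:R - `|alpha P| <= `|al n|.
Proof.
rewrite alphanE -norm_freq lerBlDr.
have := ler_normB (alpha P + freq_step * n%:~R) (alpha P).
by rewrite addrAC subrr add0r.
Qed.

Lemma alphan_le n : `|al n| <= `|alpha P| + freq_step * `|n|%N%:R.
Proof. by rewrite alphanE -norm_freq; exact: ler_normD. Qed.

Lemma tame_alphan : tame (fun n => (al n)%:C).
Proof.
apply: (@tame_linear _ _ `|alpha P| freq_step (ltW freq_step_gt0)) => n.
by rewrite normc_real alphan_le.
Qed.

Lemma tame_ci (c : int -> R[i]) : tame c -> tame (fun n => ci * c n).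
Proof. by apply: tame_le => n; rewrite normcM normc_ci mul1r. Qed.

Section OneWavenumber.
Variable kap : R.
Hypothesis kap0 : 0 < kap.
Hypothesis nonres : forall n, kap != `|al n|.
Local Notation be := (betan P kap).

Lemma betan_im n : Cre (be n) = (if `|al n| < kap then Num.sqrt (kap ^+ 2 - al n ^+ 2) else 0) /\
  Cim (be n) = (if `|al n| < kap then 0 else Num.sqrt (al n ^+ 2 - kap ^+ 2)).
Proof.
by rewrite /betan; case: ifP => _ //; rewrite ReM ImM /= !(mul0r, mul1r, mulr0, subr0, add0r, subrr).
Qed.

Let sq_lt n : (`|al n| < kap) -> 0 < kap ^+ 2 - al n ^+ 2.
Proof. by move=> h; rewrite subr_gt0 -[X in X < _]real_normK ?num_real// ltrXn2r. Qed.

Let sq_gt n : (`|al n| < kap) = false -> 0 < al n ^+ 2 - kap ^+ 2.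
Proof.
move=> /negbT; rewrite -leNgt le_eqVlt (negbTE (nonres n)) /= => h.
by rewrite subr_gt0 -[X in _ < X]real_normK ?num_real// ltrXn2r// ltW.
Qed.

Lemma betan_propagating n : `|al n| < kap ->
  [/\ Cim (be n) = 0, 0 < Cre (be n) & Cre (be n) ^+ 2 = kap ^+ 2 - al n ^+ 2].
Proof.
move=> h; have [-> ->] := betan_im n; rewrite h; split => //.
  by rewrite sqrtr_gt0 sq_lt.
by rewrite sqr_sqrtr// ltW// sq_lt.
Qed.

Lemma betan_evanescent n : ~~ (`|al n| < kap) -> 0 < Cim (be n).
Proof.
by move=> h; have [_ ->] := betan_im n; rewrite (negbTE h) sqrtr_gt0 sq_gt// (negbTE h).
Qed.

Lemma betan_im_ge0 n : 0 <= Cim (be n).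
Proof. by have [_ ->] := betan_im n; case: ifP => _ //; exact: sqrtr_ge0. Qed.

Lemma betan_im_ge n : `|al n| - kap <= Cim (be n).
Proof.
have [_ ->] := betan_im n; case: ifP => h; first by rewrite subr_le0 ltW.
have k : kap <= `|al n| by rewrite leNgt h.
rewrite -[X in X <= _]ger0_norm ?subr_ge0// -sqrtr_sqr ler_sqrt ?(ltW (sq_gt h))//.
rewrite sqrrB real_normK ?num_real//.
have : kap * kap <= `|al n| * kap by rewrite ler_wpM2r// ltW.
rewrite -[_ * kap *+ 2]mulr_natl -expr2; lra.
Qed.

Lemma tame_betan : tame be.
Proof.
apply: (@tame_linear _ _ (kap + `|alpha P|) freq_step (ltW freq_step_gt0)) => n.
rewrite -addrA; apply: (le_trans _ (lerD (lexx kap) (alphan_le n))).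
have [h1 h2] := betan_im n; apply: (le_trans (normc_le_parts _)); rewrite h1 h2.
case: ifP => h; rewrite normr0 ?addr0 ?add0r ger0_norm ?sqrtr_ge0//.
  apply: (@le_trans _ _ kap); last by rewrite lerDl.
  rewrite -[X in _ <= X]ger0_norm ?(ltW kap0)// -sqrtr_sqr ler_sqrt ?sqr_ge0//.
  by rewrite gerBl sqr_ge0.
apply: (@le_trans _ _ `|al n|); last by rewrite lerDr ltW.
by rewrite -sqrtr_sqr ler_sqrt ?sqr_ge0// gerBl sqr_ge0.
Qed.

Lemma tame_propagating (c : int -> R[i]) : tame c ->
  tame (fun n => if `|al n| < kap then c n else 0) /\
  tame (fun n => if `|al n| < kap then 0 else c n).
Proof.
by move=> hc; split; apply: tame_le hc => n; case: ifP => _; rewrite ?normc0 ?normc_ge0.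
Qed.

Definition mode (n : int) (p : R * R) : R[i] :=
  cexp (ci * ((al n * p.1)%:C + be n * (p.2 - top)%:C)).

Lemma normc_mode n p : normc (mode n p) = expR (- (Cim (be n) * (p.2 - top))).
Proof.
rewrite normc_cexp; congr expR.
by rewrite ReM ReD ImD ReM ImM /= !(mul0r, mul1r, mulr0, subr0, add0r, addr0).
Qed.

Lemma mode_dx n (x y : R) :
  is_cderive (fun t => mode n (t, y)) x ((ci * (al n)%:C) * mode n (x, y)).
Proof.
have e (t : R) : mode n (t, y) = cexp (ci * (be n * (y - top)%:C) + ci * (al n)%:C * t%:C).
  by rewrite /mode /= rmorphM/=; congr cexp; ring.
by rewrite e (funext e); exact: is_cderive_cexp.
Qed.

Lemma mode_dy n (x y : R) :
  is_cderive (fun t => mode n (x, t)) y ((ci * be n) * mode n (x, y)).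
Proof.
have e (t : R) : mode n (x, t) = cexp (ci * ((al n * x)%:C - be n * top%:C) + ci * be n * t%:C).
  by rewrite /mode /= rmorphB/=; congr cexp; ring.
by rewrite e (funext e); exact: is_cderive_cexp.
Qed.

(** The decay rate of a mode grows linearly with its order, which beats any
    subexponential coefficient. *)
Lemma mode_term_bound (c : int -> R[i]) (t0 : R) : 0 < t0 -> tame c ->
  exists K q, [/\ 0 <= q, q < 1 & forall n x y, top + t0 <= y ->
    normc (c n * mode n (x, y)) <= K * q ^+ `|n|%N].
Proof.
move=> t00 hc.
have eta0 : 0 < freq_step * t0 / 2 by rewrite divr_gt0// mulr_gt0// freq_step_gt0.
have [C hC] := hc _ eta0.
exists (C * expR ((`|alpha P| + kap) * t0)), (expR (- (freq_step * t0 / 2))).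
split; [exact: expR_ge0|by rewrite expR_lt1 oppr_lt0|move=> n x y hy].
rewrite normcM normc_mode /=.
have hb : expR (- (Cim (be n) * (y - top))) <=
   expR ((`|alpha P| + kap) * t0) * expR (- (freq_step * t0 * `|n|%N%:R)).
  rewrite -expRD ler_expR.
  have b1 := betan_im_ge n; have b2 := alphan_ge n; have b3 := betan_im_ge0 n.
  have h1 : Cim (be n) * t0 <= Cim (be n) * (y - top) by rewrite ler_wpM2l//; lra.
  have h2 : (freq_step * `|n|%N%:R - `|alpha P| - kap) * t0 <= Cim (be n) * t0.
    by rewrite ler_wpM2r ?(ltW t00)//; lra.
  lra.
apply: (le_trans (ler_pM (normc_ge0 _) (expR_ge0 _) (hC n) hb)).
have -> : expR (- (freq_step * t0 * `|n|%N%:R)) =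
    (expR (freq_step * t0 / 2 * `|n|%N%:R))^-1 * expR (- (freq_step * t0 / 2)) ^+ `|n|%N.
  by rewrite -expRN -expRM_natl -expRD; congr expR; rewrite -mulr_natl; field.
rewrite le_eqVlt; apply/orP; left; apply/eqP.
set a := expR (freq_step * t0 / 2 * _); set q := _ ^+ _; set E := expR (_ * t0).
by field; rewrite gt_eqF// expR_gt0.
Qed.

(** Defined as a limit of the symmetric partial sums even where they diverge; for a
    [tame] sequence they converge above the line. *)
Definition mode_sum (c : int -> R[i]) (p : R * R) : R[i] :=
  limn (fun N => Cre (psumZ (fun n => c n * mode n p) N)) +i*
  limn (fun N => Cim (psumZ (fun n => c n * mode n p) N)).

Lemma mode_sum_cvg c p : tame c -> top < p.2 -> seriesZ_to (fun n => c n * mode n p) (mode_sum c p).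
Proof.
move=> hc hp; have t0 : 0 < p.2 - top by rewrite subr_gt0.
have [K [q [q0 q1 hK]]] := mode_term_bound t0 hc.
apply: (seriesZ_cvg q0 q1) => n; case: p hp t0 hK => x y /= hp t0 hK.
by apply: hK; rewrite addrC subrK.
Qed.

Let mode_psum_bound c (t0 : R) : 0 < t0 -> tame c -> exists B, forall x y N, top + t0 <= y ->
  normc (psumZ (fun n => c n * mode n (x, y)) N) <= B.
Proof.
move=> t00 hc; have [K [q [q0 q1 hK]]] := mode_term_bound t00 hc.
by exists (2 * K / (1 - q)) => x y N hy; apply: (psumZ_bound N q0 q1) => n; exact: hK.
Qed.

Let psum_dx c N (x y : R) :
  is_cderive (fun t => psumZ (fun n => c n * mode n (t, y)) N) x
    (psumZ (fun n => (ci * (al n)%:C * c n) * mode n (x, y)) N).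
Proof.
have h := @is_cderive_sum _ nat (index_iota 0 N.*2.+1)
  (fun k t => c (k%:Z - N%:Z) * mode (k%:Z - N%:Z) (t, y)) x _
  (fun k => is_cderiveZ (c (k%:Z - N%:Z)) (mode_dx (k%:Z - N%:Z) x y)).
move: h; rewrite /psumZ; congr is_cderive.
by apply: eq_bigr => k _; ring.
Qed.

Let psum_dy c N (x y : R) :
  is_cderive (fun t => psumZ (fun n => c n * mode n (x, t)) N) y
    (psumZ (fun n => (ci * be n * c n) * mode n (x, y)) N).
Proof.
have h := @is_cderive_sum _ nat (index_iota 0 N.*2.+1)
  (fun k t => c (k%:Z - N%:Z) * mode (k%:Z - N%:Z) (x, t)) y _
  (fun k => is_cderiveZ (c (k%:Z - N%:Z)) (mode_dy (k%:Z - N%:Z) x y)).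
move: h; rewrite /psumZ; congr is_cderive.
by apply: eq_bigr => k _; ring.
Qed.

(** Two formal differentiations again give series with [tame] coefficients, so the
    second derivatives of the partial sums are uniformly bounded and
    [is_derive_limit] applies. *)
Lemma mode_sum_dx c (x y : R) : tame c -> top < y ->
  is_cderive (fun t => mode_sum c (t, y)) x (mode_sum (fun n => ci * (al n)%:C * c n) (x, y)).
Proof.
move=> hc hy; have t0 : 0 < y - top by rewrite subr_gt0.
have yE : top + (y - top) <= y by rewrite addrC subrK.
have h1 := tameM (tame_ci tame_alphan) hc; have h2 := tameM (tame_ci tame_alphan) h1.
have [B hB] := mode_psum_bound t0 h2.
have s1 := @mode_sum_cvg _ (x, y) h1 hy.
split.
  apply: (@is_derive_limit _ (fun N t => Cre (psumZ (fun n => c n * mode n (t, y)) N))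
   (fun N t => Cre (psumZ (fun n => (ci * (al n)%:C * c n) * mode n (t, y)) N))
   (fun N t => Cre (psumZ (fun n => (ci * (al n)%:C * (ci * (al n)%:C * c n)) * mode n (t, y)) N))
   _ _ x 1 B ltr01).
  - by move=> N z _; have [] := psum_dx c N z y.
  - by move=> N z _; have [] := psum_dx (fun n => ci * (al n)%:C * c n) N z y.
  - by move=> N z _; apply: le_trans (hB z y N yE); exact: Re_le_normc.
  - by move=> z _; have [] := @mode_sum_cvg c (z, y) hc hy.
  - by case: s1.
apply: (@is_derive_limit _ (fun N t => Cim (psumZ (fun n => c n * mode n (t, y)) N))
   (fun N t => Cim (psumZ (fun n => (ci * (al n)%:C * c n) * mode n (t, y)) N))
   (fun N t => Cim (psumZ (fun n => (ci * (al n)%:C * (ci * (al n)%:C * c n)) * mode n (t, y)) N))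
   _ _ x 1 B ltr01).
- by move=> N z _; have [] := psum_dx c N z y.
- by move=> N z _; have [] := psum_dx (fun n => ci * (al n)%:C * c n) N z y.
- by move=> N z _; apply: le_trans (hB z y N yE); exact: Im_le_normc.
- by move=> z _; have [] := @mode_sum_cvg c (z, y) hc hy.
- by case: s1.
Qed.

Lemma mode_sum_dy c (x y : R) : tame c -> top < y ->
  is_cderive (fun t => mode_sum c (x, t)) y (mode_sum (fun n => ci * be n * c n) (x, y)).
Proof.
move=> hc hy; pose t0 := (y - top) / 2.
have t00 : 0 < t0 by rewrite divr_gt0// subr_gt0.
have near_y (z : R) : ball y t0 z -> top + t0 <= z.
  by rewrite /ball/= ltr_distlC /t0 => /andP[h _]; lra.
have above (z : R) : ball y t0 z -> top < z.
  by move=> /near_y; apply: lt_le_trans; rewrite ltrDl.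
have h1 := tameM (tame_ci tame_betan) hc; have h2 := tameM (tame_ci tame_betan) h1.
have [B hB] := mode_psum_bound t00 h2.
have s1 := @mode_sum_cvg _ (x, y) h1 hy.
split.
  apply: (@is_derive_limit _ (fun N t => Cre (psumZ (fun n => c n * mode n (x, t)) N))
   (fun N t => Cre (psumZ (fun n => (ci * be n * c n) * mode n (x, t)) N))
   (fun N t => Cre (psumZ (fun n => (ci * be n * (ci * be n * c n)) * mode n (x, t)) N))
   _ _ y t0 B t00).
  - by move=> N z _; have [] := psum_dy c N x z.
  - by move=> N z _; have [] := psum_dy (fun n => ci * be n * c n) N x z.
  - by move=> N z /near_y hz; apply: le_trans (hB x z N hz); exact: Re_le_normc.
  - by move=> z /above hz; have [] := @mode_sum_cvg c (x, z) hc hz.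
  - by case: s1.
apply: (@is_derive_limit _ (fun N t => Cim (psumZ (fun n => c n * mode n (x, t)) N))
   (fun N t => Cim (psumZ (fun n => (ci * be n * c n) * mode n (x, t)) N))
   (fun N t => Cim (psumZ (fun n => (ci * be n * (ci * be n * c n)) * mode n (x, t)) N))
   _ _ y t0 B t00).
- by move=> N z _; have [] := psum_dy c N x z.
- by move=> N z _; have [] := psum_dy (fun n => ci * be n * c n) N x z.
- by move=> N z /near_y hz; apply: le_trans (hB x z N hz); exact: Im_le_normc.
- by move=> z /above hz; have [] := @mode_sum_cvg c (x, z) hc hz.
- by case: s1.
Qed.

Lemma propagating_order_bound : exists N, forall n, `|al n| < kap -> (`|n| < N)%N.
Proof.
have [N hN] : exists N : nat, (kap + `|alpha P|) / freq_step < N%:R.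
  by exists (Num.truncn ((kap + `|alpha P|) / freq_step)).+1; exact: truncnS_gt.
exists N => n h; rewrite -(ltr_nat R); apply: le_lt_trans hN.
rewrite ler_pdivlMr ?freq_step_gt0// mulrC; have := alphan_ge n; lra.
Qed.

(** The decay rates tend to infinity and none is zero, by the nonresonance
    condition. *)
Lemma evanescent_gap : exists2 g, 0 < g & forall n, ~~ (`|al n| < kap) -> g <= Cim (be n).
Proof.
have [N hN] : exists N : nat, (kap + `|alpha P| + 1) / freq_step < N%:R.
  by exists (Num.truncn ((kap + `|alpha P| + 1) / freq_step)).+1; exact: truncnS_gt.
have far n : (N <= `|n|)%N -> 1 <= Cim (be n).
  rewrite -(ler_nat R) => h; have := lt_le_trans hN h.
  rewrite ltr_pdivrMr ?freq_step_gt0// mulrC => h2.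
  have := alphan_ge n; have := betan_im_ge n; lra.
have near_ M : exists2 g, 0 < g & forall n, (`|n| < M)%N -> ~~ (`|al n| < kap) -> g <= Cim (be n).
  elim: M => [|M [g g0 IH]]; first by exists 1.
  pose v n := if `|al n| < kap then 1 else Cim (be n).
  have v0 n : 0 < v n by rewrite /v; case: ifPn => // /betan_evanescent.
  exists (Num.min g (Num.min (v M%:Z) (v (- M%:Z)))); first by rewrite !lt_min g0 !v0.
  move=> n; rewrite ltnS leq_eqVlt => /orP[/eqP e ev|h ev]; last by rewrite ge_min IH.
  have vn : v n = Cim (be n) by rewrite /v (negbTE ev).
  have [en|en] : n = M%:Z \/ n = - M%:Z by lia.
    by rewrite -vn en !ge_min lexx !orbT.
  by rewrite -vn en !ge_min lexx !orbT.
have [g g0 hg] := near_ N.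
exists (Num.min g 1); first by rewrite lt_min g0 ltr01.
move=> n ev; have [h|h] := ltnP `|n| N; first by rewrite ge_min hg.
by rewrite ge_min far ?orbT.
Qed.

(** Evanescent modes are compared with their values at height 1 above the line,
    where their series already converges; the rest of the way brings the decay
    common to all of them. *)
Lemma mode_sum_asymptotic c : tame c ->
  exists B g N0, [/\ 0 < g & forall N x y, (N0 <= N)%N -> top + 1 <= y ->
   let P := psumZ (fun n => (if `|al n| < kap then c n else 0) * mode n (x, y)) N in
   normc P <= B /\ normc (mode_sum c (x, y) - P) <= B * expR (- (g * (y - top)))].
Proof.
move=> hc; have [tp te] := tame_propagating hc.
set cp := (fun n => if `|al n| < kap then c n else 0) in tp.
set ce := (fun n => if `|al n| < kap then 0 else c n) in te.
have [g g0 hg] := evanescent_gap.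
have [N0 hN0] := propagating_order_bound.
have [K [q [q0 q1 hK]]] := mode_term_bound ltr01 te.
have [B1 hB1] := mode_psum_bound ltr01 tp.
pose B2 := 2 * K / (1 - q).
have K0 : 0 <= K.
  have := hK 0 0 (top + 1) (lexx _); rewrite expr0 mulr1; apply: le_trans; exact: normc_ge0.
have B20 : 0 <= B2 by rewrite divr_ge0 ?mulr_ge0// subr_ge0 ltW.
exists (`|B1| + 2 * B2 * expR g), g, N0; split => // N x y NN hy /=; split.
  apply: (le_trans (hB1 x y N hy)); apply: (le_trans (ler_norm _)).
  by rewrite lerDl; apply: mulr_ge0; [apply: mulr_ge0|exact: expR_ge0].
have ytop : top < y by apply: lt_le_trans hy; rewrite ltrDl.
have stable M : (N0 <= M)%N -> psumZ (fun n => cp n * mode n (x, y)) M =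
    psumZ (fun n => cp n * mode n (x, y)) N0.
  elim: M => [|M IH]; first by rewrite leqn0 => /eqP ->.
  rewrite leq_eqVlt => /orP[/eqP <-//|hM].
  rewrite psumZS IH//.
  have z n : (N0 <= `|n|)%N -> cp n = 0.
    by move=> h; rewrite /cp; case: ifP => // /hN0; rewrite ltnNge h.
  by rewrite !z ?mul0r ?addr0// ?abszN absz_nat ltnW.
have sp : seriesZ_to (fun n => cp n * mode n (x, y)) (psumZ (fun n => cp n * mode n (x, y)) N).
  rewrite (stable N NN).
  have st : \forall M \near \oo, psumZ (fun n => cp n * mode n (x, y)) N0 =
     psumZ (fun n => cp n * mode n (x, y)) M.
    by exists N0 => // M /= hM; rewrite (stable M hM).
  split; apply: cvg_near_cst; apply: filterS st => M <- //.
have se := @mode_sum_cvg ce (x, y) te ytop.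
have sc := @mode_sum_cvg c (x, y) hc ytop.
have e : mode_sum c (x, y) = psumZ (fun n => cp n * mode n (x, y)) N + mode_sum ce (x, y).
  apply: seriesZ_to_unique sc _.
  have := seriesZ_toD sp se; congr seriesZ_to; apply/funext => n.
  by rewrite /cp /ce; case: ifP => _; rewrite mul0r ?addr0 ?add0r.
rewrite e addrC addKr.
have bound M : normc (psumZ (fun n => ce n * mode n (x, y)) M) <= B2 * expR (- (g * (y - top - 1))).
  rewrite /B2 mulrAC -[2 * K * _]mulrA; apply: (psumZ_bound M q0 q1) => n.
  rewrite mulrAC; have [pr|ev] := boolP (`|al n| < kap).
    by rewrite /ce pr mul0r normc0 !mulr_ge0 ?expR_ge0 ?exprn_ge0.
  have -> : ce n * mode n (x, y) = (ce n * mode n (x, top + 1)) *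
     ((expR (- (Cim (be n) * (y - top - 1))))%:C * cexp (ci * (Cre (be n) * (y - top - 1))%:C)).
    rewrite -mulrA; congr (_ * _); rewrite /mode.
    have -> : (expR (- (Cim (be n) * (y - top - 1))))%:C * cexp (ci * (Cre (be n) * (y - top - 1))%:C)
       = cexp (ci * (be n * (y - top - 1)%:C)).
      rewrite cexp_ci /cexp; congr ((expR _)%:C * (cos _ +i* sin _));
      by rewrite ?ReM ?ImM /= ?ReM ?ImM /= !(mul0r, mul1r, mulr0, subr0, add0r, addr0, sub0r).
    rewrite -cexpD; congr cexp; rewrite /= [top + 1]addrC addrK.
    have -> : (y - top)%:C = (y - top - 1)%:C + 1%:C :> R[i] by rewrite -rmorphD subrK.
    ring.
  rewrite normcM; apply: ler_pM; try exact: normc_ge0; first by apply: hK.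
  rewrite normcM cexp_ci normc_real ger0_norm ?expR_ge0//.
  have -> : normc (cos (Cre (be n) * (y - top - 1)) +i* sin (Cre (be n) * (y - top - 1))) = 1.
    by rewrite /= cos2Dsin2 sqrtr1.
  rewrite mulr1 ler_expR lerN2; apply: ler_wpM2r; last exact: hg.
  by rewrite -addrA -opprD subr_ge0.
have [r1 r2] := seriesZ_to_bound se bound.
apply: (le_trans (normc_le_parts _)); apply: (le_trans (lerD r1 r2)).
rewrite mulrDl -[2 * B2 * _ * _]mulrA -expRD.
have -> : g - g * (y - top) = - (g * (y - top - 1)) by ring.
have := expR_ge0 (- (g * (y - top - 1))).
have := mulr_ge0 (normr_ge0 B1) (expR_ge0 (- (g * (y - top)))); lra.
Qed.

End OneWavenumber.
End Modes.

(** * Flux of trigonometric sums *)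

Section TrigonometricSums.
Context {R : realType}.
Local Notation leb := (@lebesgue_measure R).

(** The imaginary part of [conj z * w]: the energy flux density carried by a
    displacement [z] and a traction [w]. *)
Definition cross (z w : R[i]) : R := Cre z * Cim w - Cim z * Cre w.
Definition dot (z w : R[i]) : R := Cre z * Cre w + Cim z * Cim w.

Lemma norm_cross_le z w : `|cross z w| <= 2 * (normc z * normc w).
Proof.
apply: (le_trans (ler_normB _ _)); rewrite !normrM.
have h1 : `|Cre z| * `|Cim w| <= normc z * normc w.
  by apply: ler_pM => //; [exact: Re_le_normc|exact: Im_le_normc].
have h2 : `|Cim z| * `|Cre w| <= normc z * normc w.
  by apply: ler_pM => //; [exact: Im_le_normc|exact: Re_le_normc].
lra.
Qed.

Lemma crossD2 z z' w w' : cross z w - cross z' w' = cross (z - z') w + cross z' (w - w').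
Proof. by rewrite /cross !(ReD, ImD, ReN, ImN); ring. Qed.

Lemma cross_suml (I : Type) (r : seq I) (F : I -> R[i]) w :
  cross (\sum_(i <- r) F i) w = \sum_(i <- r) cross (F i) w.
Proof. by rewrite /cross Re_sum Im_sum !mulr_suml -sumrB. Qed.

Lemma cross_sumr (I : Type) (r : seq I) (F : I -> R[i]) z :
  cross z (\sum_(i <- r) F i) = \sum_(i <- r) cross z (F i).
Proof. by rewrite /cross Re_sum Im_sum !mulr_sumr -sumrB. Qed.

Lemma cross_cexp z w (s t : R) : cross (z * cexp (ci * s%:C)) (w * cexp (ci * t%:C)) =
  cross z w * cos (t - s) + dot z w * sin (t - s).
Proof. by rewrite !cexp_ci /cross /dot !(ReM, ImM) /= cosB sinB; ring. Qed.

Lemma trig_integer (m : int) : cos (2 * pi * m%:~R : R) = 1 /\ sin (2 * pi * m%:~R : R) = 0.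
Proof.
have nat_case (k : nat) : cos (2 * pi * k%:R : R) = 1 /\ sin (2 * pi * k%:R : R) = 0.
  elim: k => [|k [IH1 IH2]]; first by rewrite mulr0 cos0 sin0.
  have -> : 2 * pi * k.+1%:R = 2 * pi * k%:R + pi *+ 2 :> R.
    by rewrite -[k.+1%:R]natr1 mulrDr mulr1 [2 * pi]mulr_natl.
  by rewrite cosD2pi sinD2pi.
case: m => k; first exact: nat_case.
have -> : 2 * pi * (Negz k)%:~R = - (2 * pi * k.+1%:R) :> R by rewrite NegzE mulrNz mulrN.
by rewrite cosN sinN; have [-> ->] := nat_case k.+1; rewrite oppr0.
Qed.

Lemma is_derive_fsum (I : Type) (r : seq I) (f : I -> R -> R) (t : R) (d : I -> R) :
  (forall i, is_derive t 1 (f i) (d i)) ->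
  is_derive t 1 (fun t => \sum_(i <- r) f i t) (\sum_(i <- r) d i).
Proof.
move=> h; elim: r => [|i r IH].
  have -> : (fun t => \sum_(i <- [::]) f i t) = cst 0 by apply/funext => x; rewrite big_nil.
  by rewrite big_nil; exact: is_derive_cst.
have -> : (fun t => \sum_(j <- i :: r) f j t) = (fun t => f i t + \sum_(j <- r) f j t).
  by apply/funext => x; rewrite big_cons.
by rewrite big_cons; exact: is_deriveD.
Qed.

Variables (P : params R).
Hypothesis L0 : 0 < Lam P.
Local Notation L := (Lam P).
Local Notation al := (alphan P).

Definition trig_sum (c : int -> R[i]) (N : nat) (x : R) : R[i] :=
  psumZ (fun n => c n * cexp (ci * (al n * x)%:C)) N.

Let diff_al (n k : int) : (al k - al n) * L = 2 * pi * (k - n)%:~R.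
Proof.
by rewrite !alphanE /freq_step intrD mulrNz; field; rewrite gt_eqF.
Qed.

Let al_inj (n k : int) : n != k -> al k - al n != 0.
Proof.
move=> nk; apply: contra_neq nk => e; have := diff_al n k; rewrite e mul0r => /esym/eqP.
by rewrite !mulf_eq0 pnatr_eq0 /= gt_eqF ?pi_gt0//= intr_eq0 subr_eq0 => /eqP.
Qed.

(* An antiderivative of [cross z w * cos (d x) + dot z w * sin (d x)], with [d = al k - al n]. *)
Let primitive (z w : R[i]) (n k : int) (x : R) : R :=
  if n == k then cross z w * x
  else (cross z w * sin ((al k - al n) * x) - dot z w * cos ((al k - al n) * x)) / (al k - al n).

Let primitive_derive z w n k (x : R) : is_derive x 1 (primitive z w n k)
  (cross z w * cos ((al k - al n) * x) + dot z w * sin ((al k - al n) * x)).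
Proof.
have [nk|nk] := eqVneq n k.
  have e : primitive z w n k = cross z w \*: id.
    by apply/funext => t; rewrite /primitive nk eqxx.
  rewrite e nk subrr mul0r cos0 sin0 mulr1 mulr0 addr0.
  by apply: is_derive_eq (is_deriveZ _ (is_derive_id x 1)) _; rewrite /GRing.scale/= mulr1.
set d := al k - al n.
have d0 : d != 0 by exact: al_inj.
have lin : is_derive x 1 (fun t => d * t) d.
  by apply: is_derive_eq (is_deriveZ d (is_derive_id x 1)) _; rewrite /GRing.scale/= mulr1.
have e1 := @is_derive1_comp _ (@cos R) _ x _ _ (is_derive_cos _) lin.
have e2 := @is_derive1_comp _ (@sin R) _ x _ _ (is_derive_sin _) lin.
have e : primitive z w n k =
  d^-1 \*: (cross z w \*: (sin \o (fun t => d * t)) - dot z w \*: (cos \o (fun t => d * t))).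
  apply/funext => t; rewrite /primitive (negbTE nk) -/d mulrC.
  by [].
rewrite e; apply: is_derive_eq (is_deriveZ d^-1 (is_deriveB (is_deriveZ (cross z w) e2)
  (is_deriveZ (dot z w) e1))) _.
by rewrite /GRing.scale/=; field.
Qed.

Let primitive_period z w n k : primitive z w n k L - primitive z w n k 0 =
  if n == k then cross z w * L else 0.
Proof.
rewrite /primitive; case: ifPn => nk; first by rewrite mulr0 subr0.
have [c1 s1] := trig_integer (k - n).
by rewrite diff_al c1 s1 !mulr0 cos0 sin0 !mulr0 subrr.
Qed.

Lemma trig_cross_continuous (a b : int -> R[i]) (N : nat) :
  continuous (fun x => cross (trig_sum a N x) (trig_sum b N x)).
Proof.
move=> x.
have cont c : {for x, continuous (Cre \o trig_sum c N)} /\ {for x, continuous (Cim \o trig_sum c N)}.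
  suff [d [[d1 _] [d2 _]]] : exists d, is_cderive (trig_sum c N) x d.
    by split; apply/differentiable_continuous/derivable1_diffP.
  eexists; apply: is_cderive_sum => k; apply: is_cderiveZ.
  have e (t : R) : cexp (ci * (al (k%:Z - N%:Z) * t)%:C) = cexp (0 + ci * (al (k%:Z - N%:Z))%:C * t%:C).
    by rewrite rmorphM/= add0r mulrA.
  by rewrite (funext e); exact: is_cderive_cexp.
have [a1 a2] := cont a; have [b1 b2] := cont b.
exact: cvgB (cvgM a1 b2) (cvgM a2 b1).
Qed.

(** Parseval's identity: the products of different orders integrate to zero over a
    period because the frequencies differ by multiples of [2 * pi / L]. *)
Lemma trig_cross_integral (a b : int -> R[i]) (N : nat) :
  (\int[leb]_(x in `]0%R, L[) (cross (trig_sum a N x) (trig_sum b N x))%:E =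
   (L * \sum_(0 <= k < N.*2.+1) cross (a (k%:Z - N%:Z)) (b (k%:Z - N%:Z)))%:E)%E.
Proof.
pose r := index_iota 0 N.*2.+1.
pose o (k : nat) := k%:Z - N%:Z.
pose G x := \sum_(k <- r) \sum_(l <- r) primitive (a (o k)) (b (o l)) (o k) (o l) x.
have fE x : cross (trig_sum a N x) (trig_sum b N x) = \sum_(k <- r) \sum_(l <- r)
   (cross (a (o k)) (b (o l)) * cos ((al (o l) - al (o k)) * x) +
    dot (a (o k)) (b (o l)) * sin ((al (o l) - al (o k)) * x)).
  rewrite /trig_sum /psumZ cross_suml; apply: eq_bigr => k _.
  by rewrite cross_sumr; apply: eq_bigr => l _; rewrite cross_cexp -mulrBl.
have dG (x : R) : is_derive x 1 G (cross (trig_sum a N x) (trig_sum b N x)).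
  by rewrite fE; apply: is_derive_fsum => k; apply: is_derive_fsum => l; exact: primitive_derive.
have cf : {within `[0, L], continuous (fun x => cross (trig_sum a N x) (trig_sum b N x))}.
  by apply: continuous_subspaceT => x; exact: trig_cross_continuous.
rewrite (integral_derive_oo L0 (fun x _ => dG x) cf); congr (_%:E).
rewrite /G -sumrB mulr_sumr; apply: eq_big_seq => k kr.
rewrite -sumrB (bigD1_seq k) ?iota_uniq//= primitive_period eqxx big1 ?addr0 1?mulrC//.
move=> l lk; rewrite primitive_period; case: ifPn => // /eqP h.
by move/eqP: lk; case; move: h; rewrite /o; lia.
Qed.

(** [h] is asymptotic, exponentially in the height, to the trigonometric sum
    with coefficients [hh n y] at height [y]. *)
Definition trig_asymptotic (h : R * R -> R[i]) (hh : int -> R -> R[i]) :=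
  exists B g N0, 0 < g /\ forall N x y, (N0 <= N)%N -> hgt P + 1 <= y ->
    normc (trig_sum (hh^~ y) N x) <= B /\
    normc (h (x, y) - trig_sum (hh^~ y) N x) <= B * expR (- (g * (y - hgt P))).

Lemma trig_sumD a b N x : trig_sum (fun n => a n + b n) N x = trig_sum a N x + trig_sum b N x.
Proof. by rewrite /trig_sum /psumZ -big_split; apply: eq_bigr => k _; rewrite mulrDl. Qed.

Lemma trig_sumZ c a N x : trig_sum (fun n => c * a n) N x = c * trig_sum a N x.
Proof. by rewrite /trig_sum /psumZ mulr_sumr; apply: eq_bigr => k _; rewrite mulrA. Qed.

Lemma trig_asymptoticD h k hh kk : trig_asymptotic h hh -> trig_asymptotic k kk ->
  trig_asymptotic (fun p => h p + k p) (fun n y => hh n y + kk n y).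
Proof.
move=> [B1 [g1 [N1 [g10 h1]]]] [B2 [g2 [N2 [g20 h2]]]].
exists (B1 + B2), (Num.min g1 g2), (maxn N1 N2); split; first by rewrite lt_min g10.
move=> N x y; rewrite geq_max => /andP[n1 n2] hy.
have [p1 q1] := h1 N x y n1 hy; have [p2 q2] := h2 N x y n2 hy.
rewrite trig_sumD; split; first by apply: (le_trans (normcD _ _)); exact: lerD.
rewrite opprD addrACA; apply: (le_trans (normcD _ _)); rewrite mulrDl.
have y0 : 0 <= y - hgt P by rewrite subr_ge0; apply: le_trans hy; rewrite lerDl.
have B10 : 0 <= B1 by apply: le_trans p1; exact: normc_ge0.
have B20 : 0 <= B2 by apply: le_trans p2; exact: normc_ge0.
apply: lerD.
  apply: (le_trans q1); apply: ler_wpM2l => //; rewrite ler_expR lerN2.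
  by apply: ler_wpM2r => //; rewrite ge_min lexx.
apply: (le_trans q2); apply: ler_wpM2l => //; rewrite ler_expR lerN2.
by apply: ler_wpM2r => //; rewrite ge_min lexx orbT.
Qed.

Lemma trig_asymptoticZ c h hh : trig_asymptotic h hh ->
  trig_asymptotic (fun p => c * h p) (fun n y => c * hh n y).
Proof.
move=> [B [g [N0 [g0 hB]]]]; exists (normc c * B), g, N0; split => // N x y hN hy.
have [h1 h2] := hB N x y hN hy; rewrite trig_sumZ -mulrBr !normcM -mulrA.
by split; apply: ler_wpM2l => //; exact: normc_ge0.
Qed.

Lemma trig_asymptotic_mode_sum kap c : 0 < kap -> (forall n, kap != `|al n|) -> tame c ->
  trig_asymptotic (mode_sum P kap c)
   (fun n y => (if `|al n| < kap then c n else 0) * cexp (ci * (betan P kap n * (y - hgt P)%:C))).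
Proof.
move=> k0 nr hc; have [B [g [N0 [g0 hB]]]] := mode_sum_asymptotic L0 k0 nr hc.
exists B, g, N0; split => // N x y hN hy.
have -> : trig_sum (fun n => (if `|al n| < kap then c n else 0) *
      cexp (ci * (betan P kap n * (y - hgt P)%:C))) N x =
    psumZ (fun n => (if `|al n| < kap then c n else 0) * mode P kap n (x, y)) N.
  by apply: eq_bigr => k _; rewrite -mulrA -cexpD /mode /=; congr (_ * cexp _); ring.
exact: hB N x y hN hy.
Qed.

Lemma trig_asymptotic_single (k : R -> R[i]) (B : R) : (forall y, normc (k y) <= B) ->
  trig_asymptotic (fun p => k p.2 * cexp (ci * (al 0 * p.1)%:C)) (fun n y => if n == 0 then k y else 0).
Proof.
move=> hk; exists B, 1, 0%N; split => // N x y _ hy.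
have -> : trig_sum (fun n => if n == 0 then k y else 0) N x = k y * cexp (ci * (al 0 * x)%:C).
  elim: N => [|N IH]; first by rewrite /trig_sum psumZ0 eqxx.
  by rewrite /trig_sum psumZS -/(trig_sum _ N x) IH /= !mul0r !addr0.
have B0 : 0 <= B by apply: le_trans (hk 0); exact: normc_ge0.
rewrite subrr normc0; split; last by rewrite mulr_ge0 ?expR_ge0.
by rewrite normcM cexp_ci /= cos2Dsin2 sqrtr1 mulr1.
Qed.

End TrigonometricSums.

(** * Energy of one diffraction order and bounds on the coefficients *)

Section Coefficients.
Context {R : realType}.
Local Notation leb := (@lebesgue_measure R).

(** [A], [B] and [I] are the amplitudes of the reflected compressional, reflected
    shear and incident wave in an order with tangential frequency [a]. The mixed
    terms cancel thanks to the dispersion relations that express [om2]. *)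
Lemma flux_algebra (m l a b1 b2 om2 : R) (A B I : R[i]) :
  (A = 0 /\ I = 0) \/ (m + l) * (a ^+ 2 + b1 ^+ 2) = om2 ->
  B = 0 \/ m * (a ^+ 2 + b2 ^+ 2) = om2 ->
  cross (ci * a%:C * (A + I) + ci * b2%:C * B)
        (m%:C * (ci * b1%:C * (ci * a%:C) * (A - I) + ci * b2%:C * (ci * b2%:C) * B)) +
  cross (ci * b1%:C * (A - I) - ci * a%:C * B)
        (m%:C * (ci * b1%:C * (ci * b1%:C) * (A + I) - ci * b2%:C * (ci * a%:C) * B) +
         l%:C * ((ci * a%:C * (ci * a%:C) * (A + I) + ci * a%:C * (ci * b2%:C) * B) +
                 (ci * b1%:C * (ci * b1%:C) * (A + I) - ci * b2%:C * (ci * a%:C) * B))) =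
  om2 * (b1 * normsq A + b2 * normsq B - b1 * normsq I).
Proof.
move=> h1 h2.
have ciM (b : R) z : ci * b%:C * z = (- (b * Cim z)) +i* (b * Cre z).
  by apply: complex_eq; rewrite !(ReM, ImM) /=; ring.
have ciM2 (b d : R) z : ci * b%:C * (ci * d%:C) * z = (- (b * d * Cre z)) +i* (- (b * d * Cim z)).
  by apply: complex_eq; rewrite !(ReM, ImM) /=; ring.
have rM (b : R) z : b%:C * z = (b * Cre z) +i* (b * Cim z).
  by apply: complex_eq; rewrite !(ReM, ImM) /=; ring.
rewrite !ciM2 !ciM !rM /cross /normsq ?ReD ?ImD ?ReN ?ImN /= ?ReD ?ImD ?ReN ?ImN /= ?ReD ?ImD ?ReN ?ImN /= ?ReN ?ImN.
have [A1E A2E] : [/\ A = 0 -> Cre A = 0 & A = 0 -> Cim A = 0] by split=> ->.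
have [I1E I2E] : [/\ I = 0 -> Cre I = 0 & I = 0 -> Cim I = 0] by split=> ->.
have [B1E B2E] : [/\ B = 0 -> Cre B = 0 & B = 0 -> Cim B = 0] by split=> ->.
set A1 := Cre A in A1E *; set A2 := Cim A in A2E *.
set B1 := Cre B in B1E *; set B2 := Cim B in B2E *.
set I1 := Cre I in I1E *; set I2 := Cim I in I2E *.
have [[-> -> -> ->]|e1] : [/\ A1 = 0, A2 = 0, I1 = 0 & I2 = 0] \/ (m + l) * (a ^+ 2 + b1 ^+ 2) = om2.
  by case: h1 => [[a0 i0]|e]; [left; split; [exact: A1E|exact: A2E|exact: I1E|exact: I2E]|right].
  have [[-> ->]|<-] : (B1 = 0 /\ B2 = 0) \/ m * (a ^+ 2 + b2 ^+ 2) = om2.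
    by case: h2 => [b0|e]; [left; split; [exact: B1E|exact: B2E]|right].
  - by ring.
  - by ring.
have [[-> ->]|e2] : (B1 = 0 /\ B2 = 0) \/ m * (a ^+ 2 + b2 ^+ 2) = om2.
  by case: h2 => [b0|e]; [left; split; [exact: B1E|exact: B2E]|right].
- by rewrite -e1; ring.
rewrite -e2.
(* The difference of the two dispersion relations. *)
have e : l * (a ^+ 2 + b1 ^+ 2) - (m * b2 ^+ 2 - m * b1 ^+ 2) = 0.
  by apply/eqP; rewrite subr_eq0; apply/eqP; move: e1; rewrite -e2; lra.
(* All mixed terms are collected in a multiple of this difference. *)
transitivity (m * (a ^+ 2 + b2 ^+ 2) *
    (b1 * (A1 ^+ 2 + A2 ^+ 2) + b2 * (B1 ^+ 2 + B2 ^+ 2) - b1 * (I1 ^+ 2 + I2 ^+ 2)) -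
  (l * (a ^+ 2 + b1 ^+ 2) - (m * b2 ^+ 2 - m * b1 ^+ 2)) *
  ((a * B2 - b1 * (A2 - I2)) * (A2 + I2) - (b1 * (A1 - I1) - a * B1) * (A1 + I1))).
  by ring.
by rewrite e mul0r subr0.
Qed.

(** The finitely supported sums of the statement as symmetric partial sums. *)
Lemma fsum_psumZ (A : int -> bool) (F : int -> R[i]) (N : nat) :
  (forall n, A n -> (`|n| <= N)%N) ->
  \sum_(n \in [set n | A n]) F n = psumZ (fun n => if A n then F n else 0) N.
Proof.
move=> hA; pose r := [seq k%:Z - N%:Z | k <- index_iota 0 N.*2.+1].
have ur : uniq r by rewrite map_inj_uniq ?iota_uniq// => k l; lia.
have -> : psumZ (fun n => if A n then F n else 0) N = \sum_(n <- r) (if A n then F n else 0).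
  by rewrite big_map.
transitivity (\sum_(n \in [set n | A n]) (if A n then F n else 0)).
  by apply: eq_fsbigr => n /set_mem /= ->.
rewrite [RHS]fsbig_seq//; apply: fsbig_widen => [n /= An|n /= [_ /negP/negbTE ->//]].
apply/mapP; have {}hA := hA n An; exists `|(n + N%:Z)%R|%N; rewrite ?mem_index_iota; lia.
Qed.

Variables (P : params R) (S : set (R * R)).
Hypothesis hP : admissible P.
Local Notation L := (Lam P).
Local Notation top := (hgt P).
Local Notation al := (alphan P).
Local Notation k1 := (kappa1 P).
Local Notation k2 := (kappa2 P).

Let L0 : 0 < L. Proof. by have [[]] := hP. Qed.
Let om0 : 0 < omega P. Proof. by have [[]] := hP. Qed.
Let mu0 : 0 < mu P. Proof. by have [[]] := hP. Qed.
Let lm0 : 0 < lambda P + mu P. Proof. by have [[]] := hP. Qed.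
Let l2m0 : 0 < lambda P + 2 * mu P.
Proof. by have := addr_gt0 lm0 mu0; rewrite -addrA -mulr2n mulr_natl. Qed.

Lemma kappa1_gt0 : 0 < k1. Proof. by rewrite divr_gt0// sqrtr_gt0. Qed.
Lemma kappa2_gt0 : 0 < k2. Proof. by rewrite divr_gt0// sqrtr_gt0. Qed.
Lemma kappa1_sqr : (lambda P + 2 * mu P) * k1 ^+ 2 = omega P ^+ 2.
Proof.
rewrite /kappa1 expr_div_n sqr_sqrtr ?(ltW l2m0)//; field.
by rewrite gt_eqF.
Qed.
Lemma kappa2_sqr : mu P * k2 ^+ 2 = omega P ^+ 2.
Proof. by rewrite /kappa2 expr_div_n sqr_sqrtr ?(ltW mu0)//; field; rewrite gt_eqF. Qed.

Lemma kappa1_nonres n : k1 != `|al n|. Proof. by have [_ /(_ n)[]] := hP. Qed.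
Lemma kappa2_nonres n : k2 != `|al n|. Proof. by have [_ /(_ n)[]] := hP. Qed.

Lemma cos_theta_gt0 : 0 < cos (theta P).
Proof. by apply: cos_gt0_pihalf; rewrite -mulNr; have [[_ _ _ _ +] _] := hP; rewrite mulNr. Qed.

Lemma alphan0 : al 0 = alpha P.
Proof. by rewrite /alphan mulr0 mul0r addr0. Qed.

Lemma beta_gt0 : 0 < beta P.
Proof. by rewrite mulr_gt0 ?kappa1_gt0 ?cos_theta_gt0. Qed.

Lemma alpha_beta : k1 ^+ 2 - alpha P ^+ 2 = beta P ^+ 2.
Proof.
rewrite /alpha /beta !exprMn; have := cos2Dsin2 (theta P) => e.
by rewrite -[X in X - _]mulr1 -e; ring.
Qed.

Lemma order0_propagating : `|al 0| < k1 /\ Cre (beta1 P 0) = beta P.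
Proof.
have lt : `|al 0| < k1.
  rewrite -(@ltr_pXn2r _ 2)// ?nnegrE ?(ltW kappa1_gt0)//.
  by rewrite real_normK ?num_real// alphan0 -subr_gt0 alpha_beta exprn_gt0// beta_gt0.
split => //; rewrite /beta1; have [-> _] := betan_im P k1 0; rewrite lt alphan0 alpha_beta.
by rewrite sqrtr_sqr ger0_norm// ltW// beta_gt0.
Qed.

(** A bound on the coefficients is enough because the modes decay exponentially in
    their order above the line. *)
Lemma trace_coef_bounded (f : cfield R) :
  (forall x, x \in `[0, L] -> {for x, continuous (fun t => Cre (f (t, top)))} /\
      {for x, continuous (fun t => Cim (f (t, top)))}) ->
  exists B, forall n, normc (trace_coef P f n) <= B.
Proof.
move=> cf.
have ccos (d : R) (x : R) : {for x, continuous (fun t => cos (d * t))}.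
  apply: (@continuous_comp _ _ _ (fun t => d * t)); last exact: continuous_cos.
  by apply: cvgM; [exact: cvg_cst|exact: cvg_id].
have csin (d : R) (x : R) : {for x, continuous (fun t => sin (d * t))}.
  apply: (@continuous_comp _ _ _ (fun t => d * t)); last exact: continuous_sin.
  by apply: cvgM; [exact: cvg_cst|exact: cvg_id].
have bnd (g : R -> R) : (forall x, x \in `[0, L] -> {for x, continuous g}) ->
   exists M, forall x, x \in `[0, L] -> `|g x| <= M.
  move=> cg; have ck : compact (g @` `[0, L]).
    by apply: continuous_compact (@segment_compact _ _ _); apply: continuous_in_subspaceT => x /set_mem; exact: cg.
  have [M [_ hM]] := compact_bounded ck.
  exists (`|M| + 1) => x hx; apply: (hM (`|M| + 1)); last by exists x.
  by rewrite (le_lt_trans (ler_norm _))// ltrDl.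
have [M1 hM1] := bnd _ (fun x hx => (cf x hx).1).
have [M2 hM2] := bnd _ (fun x hx => (cf x hx).2).
have rint (g : R -> R) (M : R) : (forall x, x \in `[0, L] -> {for x, continuous g}) ->
    (forall x, x \in `[0, L] -> `|g x| <= M) -> `|Rintegral leb `[0, L] g| <= M * L.
  move=> cg hg.
  have ig : leb.-integrable `[0, L] (EFin \o g).
    apply: continuous_compact_integrable; first exact: segment_compact.
    by apply: continuous_in_subspaceT => x /set_mem; exact: cg.
  have icst : leb.-integrable `[0, L] (EFin \o (cst M)).
    apply: continuous_compact_integrable; first exact: segment_compact.
    by apply: continuous_subspaceT => x; exact: cvg_cst.
  apply: (le_trans (le_normr_Rintegral _ ig)) => //.
  apply: (@le_trans _ _ (Rintegral leb `[0, L] (cst M))).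
    by apply: le_Rintegral => //; exact: integrable_norm.
  rewrite Rintegral_cst//; rewrite [X in M * fine X <= _](_ : _ = L%:E)//=.
  by rewrite lebesgue_measure_itv /= lte_fin L0 -EFinB subr0.
exists (2 * ((M1 + M2) * L) / L) => n.
rewrite /trace_coef normcM normc_real normfV gtr0_norm// mulrC; apply: ler_wpM2r.
  by rewrite invr_ge0 ltW.
have e (t : R) : cexp (- (ci * (al n * t)%:C)) = cos (al n * t) +i* (- sin (al n * t)).
  by rewrite -mulrN -rmorphN cexp_ci cosN sinN.
have rE : Cre \o (fun x : R => f (x, top) * cexp (- (ci * (al n * x)%:C))) =
    (fun x => Cre (f (x, top)) * cos (al n * x) + Cim (f (x, top)) * sin (al n * x)).
  by apply/funext => x; rewrite /= e ReM /= mulrN opprK.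
have iE : Cim \o (fun x : R => f (x, top) * cexp (- (ci * (al n * x)%:C))) =
    (fun x => Cim (f (x, top)) * cos (al n * x) - Cre (f (x, top)) * sin (al n * x)).
  by apply/funext => x; rewrite /= e ImM /= mulrN addrC.
apply: (le_trans (normc_le_parts _)); rewrite /cint /= rE iE.
have cs1 (x : R) : `|cos x| <= 1 by rewrite ler_norml cos_geN1 cos_le1.
have sn1 (x : R) : `|sin x| <= 1 by rewrite ler_norml sin_geN1 sin_le1.
have p (g h u v : R) : `|g| <= M1 -> `|h| <= M2 -> `|u| <= 1 -> `|v| <= 1 -> `|g * u| + `|h * v| <= M1 + M2.
  by move=> h1 h2 h3 h4; rewrite !normrM; apply: lerD; rewrite -[leRHS]mulr1; apply: ler_pM.
rewrite mulr_natl mulr2n; apply: lerD; apply: rint => x hx; have [c1 c2] := cf x hx.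
- by apply: cvgD; apply: cvgM; [exact: c1|exact: ccos|exact: c2|exact: csin].
- by apply: (le_trans (ler_normD _ _)); apply: p; rewrite ?hM1 ?hM2.
- by apply: cvgB; apply: cvgM; [exact: c2|exact: ccos|exact: c1|exact: csin].
- by apply: (le_trans (ler_normB _ _)); rewrite addrC; apply: p; rewrite ?hM1 ?hM2.
Qed.

(** For high orders [beta1] and [beta2] are imaginary, of moduli [a] and [b] say, and
    [chi] is at least [al n ^ 2 - (a ^ 2 + b ^ 2) / 2], the mean of the squared
    wavenumbers. The remaining orders are finite in number; a vanishing [chi]
    would do no harm among them, the inverse of 0 being 0. *)
Lemma chi_inv_bounded : exists B, forall n, normc (chi P n)^-1 <= B.
Proof.
have [N1 hN1] := propagating_order_bound L0 k1.
have [N2 hN2] := propagating_order_bound L0 k2.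
apply: (@bounded_of_eventually _ _ (maxn N1 N2) (2 / k1 ^+ 2)) => n; rewrite geq_max => /andP[n1 n2].
have p1 : (`|al n| < k1) = false by apply/negP => /hN1; rewrite ltnNge n1.
have p2 : (`|al n| < k2) = false by apply/negP => /hN2; rewrite ltnNge n2.
have [r1 i1] := betan_im P k1 n; have [r2 i2] := betan_im P k2 n.
rewrite p1 in r1 i1; rewrite p2 in r2 i2.
set a := Num.sqrt _ in i1; set b := Num.sqrt _ in i2.
have chiE : chi P n = (al n ^+ 2 - a * b)%:C.
  by apply: complex_eq; rewrite /chi /beta1 /beta2 ?ReD ?ImD ?ReM ?ImM r1 i1 r2 i2 /=; ring.
have sq (k : R) : 0 < k -> (`|al n| < k) = false -> Num.sqrt (al n ^+ 2 - k ^+ 2) ^+ 2 = al n ^+ 2 - k ^+ 2.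
  move=> k0 /negbT; rewrite -leNgt => h; rewrite sqr_sqrtr// subr_ge0.
  by rewrite -[leRHS]real_normK ?num_real// lerXn2r// nnegrE ltW.
have a2 : a ^+ 2 = al n ^+ 2 - k1 ^+ 2 by exact: sq kappa1_gt0 p1.
have b2 : b ^+ 2 = al n ^+ 2 - k2 ^+ 2 by exact: sq kappa2_gt0 p2.
have low : k1 ^+ 2 / 2 <= al n ^+ 2 - a * b.
  have := sqr_ge0 (a - b); rewrite sqrrB a2 b2 -mulr_natl; have := sqr_ge0 k2; lra.
have k10 : 0 < k1 ^+ 2 / 2 by rewrite divr_gt0// exprn_gt0// kappa1_gt0.
rewrite chiE normcV normc_real gtr0_norm; last exact: lt_le_trans low.
rewrite -[2 / _]invf_div lef_pV2// posrE//.
exact: lt_le_trans low.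
Qed.

End Coefficients.

(** * Vanishing flux and its asymptotic value *)

Section AsymptoticFlux.
Context {R : realType}.
Local Notation leb := (@lebesgue_measure R).
Variable P : params R.
Hypothesis L0 : 0 < Lam P.
Local Notation L := (Lam P).
Local Notation top := (hgt P).

Lemma decay_weaken (C g g' s : R) : 0 <= C -> g' <= g -> 0 <= s ->
  C * expR (- (g * s)) <= C * expR (- (g' * s)).
Proof.
move=> C0 gg s0; apply: ler_wpM2l => //; rewrite ler_expR lerN2.
exact: ler_wpM2r.
Qed.

Lemma cross_asymptotic h t hh tt : trig_asymptotic P h hh -> trig_asymptotic P t tt ->
  exists C g N0, [/\ 0 <= C, 0 < g & forall N x y, (N0 <= N)%N -> top + 1 <= y ->
    `|cross (h (x, y)) (t (x, y)) -
      cross (trig_sum P (hh^~ y) N x) (trig_sum P (tt^~ y) N x)| <= C * expR (- (g * (y - top)))].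
Proof.
move=> [B1 [g1 [N1 [g10 h1]]]] [B2 [g2 [N2 [g20 h2]]]].
pose g := Num.min g1 g2.
have g0 : 0 < g by rewrite lt_min g10.
have B10 : 0 <= B1 by have [+ _] := h1 _ 0 _ (leqnn _) (lexx _); apply: le_trans; exact: normc_ge0.
have B20 : 0 <= B2 by have [+ _] := h2 _ 0 _ (leqnn _) (lexx _); apply: le_trans; exact: normc_ge0.
exists (6 * (B1 * B2)), g, (maxn N1 N2); split => //; first by rewrite !mulr_ge0.
move=> N x y; rewrite geq_max => /andP[n1 n2] hy.
have [p1 q1] := h1 N x y n1 hy; have [p2 q2] := h2 N x y n2 hy.
have s0 : 0 <= y - top by lra.
have {}q1 := le_trans q1 (decay_weaken B10 (_ : g <= g1) s0).
have {}q2 := le_trans q2 (decay_weaken B20 (_ : g <= g2) s0).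
set z := h _ in q1 *; set w := t _ in q2 *.
set z' := trig_sum P (hh^~ y) N x in p1 q1 *; set w' := trig_sum P (tt^~ y) N x in p2 q2 *.
have E0 := expR_ge0 (- (g * (y - top))).
have E1 : expR (- (g * (y - top))) <= 1 by rewrite -expR0 ler_expR oppr_le0 mulr_ge0// ltW.
set E := expR _ in q1 q2 E0 E1 *.
have {}q1 : normc (z - z') <= B1 * E by apply: q1; rewrite ge_min lexx.
have {}q2 : normc (w - w') <= B2 * E by apply: q2; rewrite ge_min lexx orbT.
have wB : normc w <= 2 * B2.
  rewrite -(subrK w' w); apply: (le_trans (normcD _ _)).
  have := ler_wpM2l B20 E1; lra.
rewrite crossD2; apply: (le_trans (ler_normD _ _)).
have c1 := norm_cross_le (z - z') w; have c2 := norm_cross_le z' (w - w').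
have m1 := ler_pM (normc_ge0 _) (normc_ge0 _) q1 wB.
have m2 := ler_pM (normc_ge0 _) (normc_ge0 _) p1 q2.
lra.
Qed.

(** The flux of the asymptotic sums does not depend on the height, and it differs
    from the vanishing flux of [F] by a quantity that decays with the height. *)
Lemma asymptotic_flux_balance h1 t1 h2 t2 hh1 tt1 hh2 tt2 (F : R * R -> R) (w : int -> R) :
  trig_asymptotic P h1 hh1 -> trig_asymptotic P t1 tt1 ->
  trig_asymptotic P h2 hh2 -> trig_asymptotic P t2 tt2 ->
  (forall x y, top + 1 <= y -> x \in `]0, L[ ->
     F (x, y) = cross (h1 (x, y)) (t1 (x, y)) + cross (h2 (x, y)) (t2 (x, y))) ->
  (forall y, top + 1 <= y -> leb.-integrable `]0, L[ (fun x => (F (x, y))%:E)) ->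
  (forall y, top + 1 <= y -> (\int[leb]_(x in `]0%R, L[) (F (x, y))%:E = 0)%E) ->
  (forall n y, cross (hh1 n y) (tt1 n y) + cross (hh2 n y) (tt2 n y) = w n) ->
  exists N0, forall N, (N0 <= N)%N -> \sum_(0 <= k < N.*2.+1) w (k%:Z - N%:Z) = 0.
Proof.
move=> ah1 at1 ah2 at2 FE Fint F0 wE.
have [C1 [g1 [N1 [C10 g10 H1]]]] := cross_asymptotic ah1 at1.
have [C2 [g2 [N2 [C20 g20 H2]]]] := cross_asymptotic ah2 at2.
exists (maxn N1 N2) => N; rewrite geq_max => /andP[n1 n2].
set W := \sum_(_ <= _ < _) _.
pose g := Num.min g1 g2.
have g0 : 0 < g by rewrite lt_min g10.
have bound y : top + 1 <= y -> `|L * W| <= (C1 + C2) * L * expR (- (g * (y - top))).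
  move=> hy.
  pose G1 x := cross (trig_sum P (hh1^~ y) N x) (trig_sum P (tt1^~ y) N x).
  pose G2 x := cross (trig_sum P (hh2^~ y) N x) (trig_sum P (tt2^~ y) N x).
  have mI : measurable (`]0%R, L[%classic : set (measurableTypeR R)) by exact: measurable_itv.
  have Gint (G : R -> R) : continuous G -> leb.-integrable `]0, L[ (EFin \o G).
    move=> cG; apply: (@integrableS _ _ _ leb `[0, L]) => //.
      exact: subset_itv_oo_cc.
    apply: continuous_compact_integrable; first exact: segment_compact.
    exact: continuous_subspaceT.
  have i1 : leb.-integrable `]0, L[ (EFin \o G1) by apply: Gint; exact: trig_cross_continuous.
  have i2 : leb.-integrable `]0, L[ (EFin \o G2) by apply: Gint; exact: trig_cross_continuous.
  have i12 : leb.-integrable `]0, L[ (EFin \o (G1 \+ G2)) by apply: (eq_integrable _ _ _ _ (integrableD mI i1 i2)).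
  have iF : leb.-integrable `]0, L[ (EFin \o (fun x => F (x, y))) by exact: Fint.
  have iD : leb.-integrable `]0, L[ (EFin \o ((G1 \+ G2) \- (fun x => F (x, y)))) by apply: (eq_integrable _ _ _ _ (integrableB mI i12 iF)).
  have -> : L * W = Rintegral leb `]0, L[ ((G1 \+ G2) \- (fun x => F (x, y))).
    rewrite RintegralB// RintegralD// /Rintegral (F0 y hy) subr0 !trig_cross_integral//= -mulrDr.
    by rewrite -big_split; congr (_ * _); apply: eq_bigr => k _; rewrite /= wE.
  have icst (M : R) : leb.-integrable `]0, L[ (EFin \o cst M) by apply: Gint => x; exact: cvg_cst.
  apply: (le_trans (le_normr_Rintegral _ iD)) => //.
  set E := expR _.
  apply: (@le_trans _ _ (Rintegral leb `]0, L[ (cst ((C1 + C2) * E)))).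
    apply: le_Rintegral; [by []|exact: integrable_norm|exact: icst|].
    move=> x hx; rewrite /= (FE x y hy hx).
    have s0 : 0 <= y - top by lra.
    have gg1 : g <= g1 by rewrite ge_min lexx.
    have gg2 : g <= g2 by rewrite ge_min lexx orbT.
    have e1 := le_trans (H1 N x y n1 hy) (decay_weaken C10 gg1 s0).
    have e2 := le_trans (H2 N x y n2 hy) (decay_weaken C20 gg2 s0).
    rewrite -/E -/(G1 x) in e1; rewrite -/E -/(G2 x) in e2.
    rewrite distrC opprD addrACA; apply: (le_trans (ler_normD _ _)); lra.
  rewrite Rintegral_cst//; rewrite [X in _ * fine X <= _](_ : _ = L%:E)//=.
    by rewrite mulrAC.
  by rewrite lebesgue_measure_itv /= lte_fin L0 -EFinB subr0.
have lim0 : L * W = 0.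
  apply/eqP; rewrite -normr_le0; apply/ler_addgt0Pr => e e0; rewrite add0r.
  set K := (C1 + C2) * L in bound.
  have K0 : 0 <= K by apply: mulr_ge0; [exact: addr_ge0|exact: ltW].
  (* The inequality exp s >= 1 + s makes the bound smaller than [e] at this height. *)
  pose y := top + 1 + K / (e * g).
  have hy : top + 1 <= y by rewrite lerDl divr_ge0// mulr_ge0// ltW.
  apply: (le_trans (bound y hy)).
  rewrite expRN ler_pdivrMr ?expR_gt0//.
  have := expR_ge1Dx (g * (y - top)); rewrite -(ler_pM2l e0).
  apply: le_trans.
  have -> : e * (1 + g * (y - top)) = e * (1 + g) + K by rewrite /y; field; rewrite !gt_eqF.
  by rewrite lerDr mulr_ge0 ?addr_ge0 ?(ltW e0) ?(ltW g0).
by move/eqP: lim0; rewrite mulf_eq0 gt_eqF//= => /eqP.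
Qed.

End AsymptoticFlux.

(** * The field above the line *)

Section FarField.
Context {R : realType}.
Local Notation leb := (@lebesgue_measure R).
Variables (P : params R) (S : set (R * R)) (u : vfield R).
Hypothesis hP : admissible P.
Hypothesis hS : periodic_surface P S.
Hypothesis hu : scattering_solution P S u.
Local Notation D := (region_above P S).
Local Notation L := (Lam P).
Local Notation top := (hgt P).
Local Notation al := (alphan P).
Local Notation k1 := (kappa1 P).
Local Notation k2 := (kappa2 P).
Local Notation b1 := (beta1 P).
Local Notation b2 := (beta2 P).
Local Notation f1 := (phi1n P u).
Local Notation f2 := (phi2n P u).

Let L0 : 0 < L. Proof. by have [[]] := hP. Qed.
Let oD : open D := region_open hS.

Lemma is_cderive_near (f g : R -> R[i]) (t : R) d : (\forall s \near t, f s = g s) ->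
  is_cderive f t d -> is_cderive g t d.
Proof.
by move=> fg [h1 h2]; split; [apply: near_eq_is_derive h1|apply: near_eq_is_derive h2];
  apply: filterS fg => s /= ->.
Qed.

Lemma cdx_val (f : cfield R) (x y : R) d : is_cderive (fun t => f (t, y)) x d -> cdx f (x, y) = d.
Proof. by move=> [h1 h2]; apply: complex_eq; rewrite /= /dx derive1E /=; exact: derive_val. Qed.

Lemma cdy_val (f : cfield R) (x y : R) d : is_cderive (fun t => f (x, t)) y d -> cdy f (x, y) = d.
Proof. by move=> [h1 h2]; apply: complex_eq; rewrite /= /dy derive1E /=; exact: derive_val. Qed.

Definition inc (p : R * R) : R[i] := cexp (ci * (alpha P * p.1 - beta P * p.2)%:C).

Lemma inc_dx (x y : R) : is_cderive (fun t => inc (t, y)) x (ci * (alpha P)%:C * inc (x, y)).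
Proof.
have e (t : R) : inc (t, y) = cexp (ci * (- (beta P * y))%:C + ci * (alpha P)%:C * t%:C).
  by rewrite /inc /= rmorphB rmorphN !rmorphM/=; congr cexp; ring.
by rewrite e (funext e); exact: is_cderive_cexp.
Qed.

Lemma inc_dy (x y : R) : is_cderive (fun t => inc (x, t)) y (- (ci * (beta P)%:C) * inc (x, y)).
Proof.
have e (t : R) : inc (x, t) = cexp (ci * (alpha P * x)%:C + - (ci * (beta P)%:C) * t%:C).
  by rewrite /inc /= rmorphB !rmorphM/=; congr cexp; ring.
by rewrite e (funext e); exact: is_cderive_cexp.
Qed.

Lemma cC1_cderive (f : cfield R) (p : R * R) : cC1_on D f -> D p ->
  is_cderive (fun t => f (t, p.2)) p.1 (cdx f p) /\ is_cderive (fun t => f (p.1, t)) p.2 (cdy f p).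
Proof.
move=> [/(C1_on_C1w oD) h /(C1_on_C1w oD) k] Dp.
by have [_ h1 h2 _ _] := h p Dp; have [_ h3 h4 _ _] := k p Dp.
Qed.

(** The traces are bounded and so is the inverse of [chi]; the other factors grow
    linearly with the order. *)
Lemma tame_phi : tame f1 /\ tame f2.
Proof.
have [[[[c11 _ _] [c12 _ _]] [[c21 _ _] [c22 _ _]]] _ _ _ _] := hu.
have trace (f : cfield R) (k : R[i]) : cC1_on D f ->
    tame (trace_coef P (fun p => f p - k * inc p)).
  move=> cf; suff [B hB] : exists B, forall n, normc (trace_coef P (fun p => f p - k * inc p) n) <= B.
    exact: tame_bounded hB.
  apply: (trace_coef_bounded hP) => x _.
  have Dx : D (x, top) by exact: region_upper.
  have [[d1 _] [d2 _]] := is_cderiveD (cC1_cderive cf Dx).1 (is_cderiveZ (- k) (inc_dx x top)).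
  have e : (fun t => f (t, top) - k * inc (t, top)) = (fun t => f (t, top) + - k * inc (t, top)).
    by apply/funext => t; rewrite mulNr.
  split.
    have -> : (fun t => Cre (f (t, top) - k * inc (t, top))) = Cre \o (fun t => f (t, top) - k * inc (t, top)) by [].
    by rewrite e; apply/differentiable_continuous/derivable1_diffP.
  have -> : (fun t => Cim (f (t, top) - k * inc (t, top))) = Cim \o (fun t => f (t, top) - k * inc (t, top)) by [].
  by rewrite e; apply/differentiable_continuous/derivable1_diffP.
have t1 : tame (v1n P u) by exact: (trace u.1 _ (conj c11 c12)).
have t2 : tame (v2n P u) by exact: (trace u.2 _ (conj c21 c22)).
have tchi : tame (fun n => - (ci / chi P n)).
  have [B hB] := chi_inv_bounded hP.
  by apply: (@tame_bounded _ _ B) => n; rewrite normcN normcM normc_ci mul1r.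
have tN (c : int -> R[i]) : tame c -> tame (fun n => - c n) by apply: tame_le => n; rewrite normcN.
have ta := tame_alphan L0.
have tb1 := tame_betan L0 (kappa1_gt0 hP); have tb2 := tame_betan L0 (kappa2_gt0 hP).
split; apply: tameM tchi _; apply: tameD; try apply: tN; exact: tameM.
Qed.

Local Notation MS1 := (mode_sum P k1).
Local Notation MS2 := (mode_sum P k2).

(** The common form of the displacement components and of their derivatives: a
    compressional, a shear and an incident part. The sign [s] is that of the
    second potential in [grad phi1 + curl phi2], 1 in the first component and
    -1 in the second. *)
Definition wave (s : R[i]) (c d : int -> R[i]) (k : R[i]) (p : R * R) : R[i] :=
  MS1 c p + s * MS2 d p + k * inc p.

Lemma wave_dx s c d k (x y : R) : tame c -> tame d -> top < y ->
  is_cderive (fun t => wave s c d k (t, y)) x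
   (wave s (fun n => ci * (al n)%:C * c n) (fun n => ci * (al n)%:C * d n) (ci * (alpha P)%:C * k) (x, y)).
Proof.
move=> tc td hy.
have m1 := mode_sum_dx L0 (kappa1_gt0 hP) (kappa1_nonres hP) x tc hy.
have m2 := mode_sum_dx L0 (kappa2_gt0 hP) (kappa2_nonres hP) x td hy.
have := is_cderiveD (is_cderiveD m1 (is_cderiveZ s m2)) (is_cderiveZ k (inc_dx x y)).
by congr is_cderive; rewrite /wave; congr (_ + _); ring.
Qed.

Lemma wave_dy s c d k (x y : R) : tame c -> tame d -> top < y ->
  is_cderive (fun t => wave s c d k (x, t)) y
   (wave s (fun n => ci * b1 n * c n) (fun n => ci * b2 n * d n) (- (ci * (beta P)%:C) * k) (x, y)).
Proof.
move=> tc td hy.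
have m1 := mode_sum_dy L0 (kappa1_gt0 hP) (kappa1_nonres hP) x tc hy.
have m2 := mode_sum_dy L0 (kappa2_gt0 hP) (kappa2_nonres hP) x td hy.
have := is_cderiveD (is_cderiveD m1 (is_cderiveZ s m2)) (is_cderiveZ k (inc_dy x y)).
by congr is_cderive; rewrite /wave; congr (_ + _); ring.
Qed.

Local Notation E1 n y := (cexp (ci * (b1 n * (y - top)%:C))).
Local Notation E2 n y := (cexp (ci * (b2 n * (y - top)%:C))).
Local Notation G y := (cexp (ci * (- (beta P * y))%:C)).

Definition wave_coef (s : R[i]) (c d : int -> R[i]) (k : R[i]) (n : int) (y : R) : R[i] :=
  (if `|al n| < k1 then c n else 0) * E1 n y + s * ((if `|al n| < k2 then d n else 0) * E2 n y) +
  (if n == 0 then k * G y else 0).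

Lemma wave_asymptotic s c d k : tame c -> tame d ->
  trig_asymptotic P (wave s c d k) (wave_coef s c d k).
Proof.
move=> tc td.
have a1 := trig_asymptotic_mode_sum L0 (kappa1_gt0 hP) (kappa1_nonres hP) tc.
have a2 := trig_asymptotic_mode_sum L0 (kappa2_gt0 hP) (kappa2_nonres hP) td.
have a3 := @trig_asymptotic_single _ P (fun y => k * G y) (normc k) _.
have {}a3 := trig_asymptoticD (trig_asymptoticD a1 (trig_asymptoticZ s a2)) (a3 _).
have hG (y : R) : normc (k * G y) <= normc k.
  by rewrite normcM normc_cexp ReM /= !(mul0r, mulr0, subr0) expR0 mulr1.
move: (a3 hG); congr trig_asymptotic.
apply/funext => p; rewrite /wave; congr (_ + _); rewrite -mulrA /inc -cexpD; congr (_ * cexp _).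
by rewrite alphan0 -mulrDr -rmorphD addrC.
Qed.

Let c11 n := ci * (al n)%:C * f1 n.
Let c12 n := ci * b2 n * f2 n.
Let c21 n := ci * b1 n * f1 n.
Let c22 n := ci * (al n)%:C * f2 n.

Let tcs : [/\ tame c11, tame c12, tame c21 & tame c22].
Proof.
have [t1 t2] := tame_phi.
have ta := tame_ci (tame_alphan L0).
have tb1 := tame_ci (tame_betan L0 (kappa1_gt0 hP)); have tb2 := tame_ci (tame_betan L0 (kappa2_gt0 hP)).
by split; exact: tameM.
Qed.

Local Notation W1 := (wave 1 c11 c12 (sin (theta P))%:C).
Local Notation W2 := (wave (-1) c21 c22 (- cos (theta P))%:C).

Lemma far_field_wave p : Omega_e P p -> u.1 p = W1 p /\ u.2 p = W2 p.
Proof.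
move=> Op; have [_ _ _ _ [_ [phi1 [phi2 [hphi rep]]]]] := hu.
have [t1 t2] := tame_phi.
have e1 q : top < q.2 -> MS1 f1 q = phi1 q.
  move=> hq; apply: seriesZ_to_unique (hphi q hq).1.
  exact (mode_sum_cvg L0 (kappa1_gt0 hP) (kappa1_nonres hP) t1 hq).
have e2 q : top < q.2 -> MS2 f2 q = phi2 q.
  move=> hq; apply: seriesZ_to_unique (hphi q hq).2.
  exact (mode_sum_cvg L0 (kappa2_gt0 hP) (kappa2_nonres hP) t2 hq).
have [r1 r2] := rep p Op; case: p Op r1 r2 => x y [_ /= hy].
have near_y : \forall t \near y, top < t.
  by apply: (open_nbhs_nbhs (A := [set t | top < t])); split; [exact: open_gt|].
have -> : cdx phi1 (x, y) = MS1 c11 (x, y).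
  apply: cdx_val; apply: is_cderive_near (mode_sum_dx L0 (kappa1_gt0 hP) (kappa1_nonres hP) x t1 hy).
  by near=> t; exact: e1.
have -> : cdy phi1 (x, y) = MS1 c21 (x, y).
  apply: cdy_val; apply: is_cderive_near (mode_sum_dy L0 (kappa1_gt0 hP) (kappa1_nonres hP) x t1 hy).
  by apply: filterS near_y => t ht; exact: e1.
have -> : cdx phi2 (x, y) = MS2 c22 (x, y).
  apply: cdx_val; apply: is_cderive_near (mode_sum_dx L0 (kappa2_gt0 hP) (kappa2_nonres hP) x t2 hy).
  by near=> t; exact: e2.
have -> : cdy phi2 (x, y) = MS2 c12 (x, y).
  apply: cdy_val; apply: is_cderive_near (mode_sum_dy L0 (kappa2_gt0 hP) (kappa2_nonres hP) x t2 hy).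
  by apply: filterS near_y => t ht; exact: e2.
rewrite /diffracted /vsub /wave /= => r1 r2; split.
  by rewrite mul1r -r1 subrK.
by rewrite mulN1r -r2 subrK.
Unshelve. all: by end_near.
Qed.

(** The flux of real against imaginary part is the imaginary part of the complex
    flux. *)
Lemma flux2_cross m l (v : vfield R) p :
  flux2 m l (Cre \o v.1) (Cre \o v.2) (Cim \o v.1) (Cim \o v.2) p =
  cross (v.1 p) (m%:C * cdy v.1 p) + cross (v.2 p) (m%:C * cdy v.2 p + l%:C * (cdx v.1 p + cdy v.2 p)).
Proof. by rewrite /flux2 /tensor12 /tensor22 /cross !ReD !ImD !ReM !ImM /=; ring. Qed.

Lemma r0E : r0 P = - (ci * (k1^-1)%:C).
Proof. by rewrite /r0 fmorphV mulNr. Qed.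

(** The incident field is the gradient of a plane wave of amplitude [r0]. *)
Lemma polarization_sin : (sin (theta P))%:C = ci * (al 0)%:C * r0 P.
Proof.
rewrite alphan0 /alpha r0E; apply: complex_eq; rewrite !(ReM, ImM, ReN, ImN) /=; field;
by rewrite gt_eqF// kappa1_gt0.
Qed.

Lemma polarization_cos : (- cos (theta P))%:C = - (ci * (beta P)%:C * r0 P).
Proof.
rewrite /beta r0E; apply: complex_eq; rewrite !(ReM, ImM, ReN, ImN) /=; field;
by rewrite gt_eqF// kappa1_gt0.
Qed.

(** The amplitudes [A], [B], [I] of [flux_algebra] in the order [n]; evanescent orders
    are left out, and the incident wave has order 0. *)
Definition amp1 (n : int) (y : R) : R[i] := (if `|al n| < k1 then f1 n else 0) * E1 n y.
Definition amp2 (n : int) (y : R) : R[i] := (if `|al n| < k2 then f2 n else 0) * E2 n y.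
Definition amp0 (n : int) (y : R) : R[i] := if n == 0 then r0 P * G y else 0.

Lemma wave_coefE s c d k cc dd kk n y : (`|al n| < k1 -> c n = cc * f1 n) ->
  (`|al n| < k2 -> d n = dd * f2 n) -> (n = 0 -> k = kk * r0 P) ->
  wave_coef s c d k n y = cc * amp1 n y + s * (dd * amp2 n y) + kk * amp0 n y.
Proof.
move=> hc hd hk; rewrite /wave_coef /amp1 /amp2 /amp0; congr (_ + s * _ + _).
- by case: ifP => [/hc ->|_]; [rewrite -mulrA|rewrite mul0r mulr0].
- by case: ifP => [/hd ->|_]; [rewrite -mulrA|rewrite mul0r mulr0].
- by case: eqP => [/hk ->|_]; [rewrite -mulrA|rewrite mulr0].
Qed.

(** The incident energy counts negatively, and [beta] is [beta1] of the order 0. *)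
Definition order_energy (n : int) : R :=
  (if `|al n| < k1 then Cre (b1 n) * normsq (f1 n) else 0) +
  (if `|al n| < k2 then Cre (b2 n) * normsq (f2 n) else 0) -
  (if n == 0 then beta P * normsq (r0 P) else 0).

Lemma energy_balance : exists N0, forall N, (N0 <= N)%N ->
  \sum_(0 <= k < N.*2.+1) order_energy (k%:Z - N%:Z) = 0.
Proof.
have [t11 t12 t21 t22] := tcs.
have [sola solb] := lame_solution_parts hS hu.
have om20 : omega P ^+ 2 != 0 by rewrite expf_neq0// gt_eqF//; have [[]] := hP.
have ta := tame_ci (tame_alphan L0).
have tb1 := tame_ci (tame_betan L0 (kappa1_gt0 hP)); have tb2 := tame_ci (tame_betan L0 (kappa2_gt0 hP)).
set DY1 := wave 1 (fun n => ci * b1 n * c11 n) (fun n => ci * b2 n * c12 n)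
   (- (ci * (beta P)%:C) * (sin (theta P))%:C).
set DX1 := wave 1 (fun n => ci * (al n)%:C * c11 n) (fun n => ci * (al n)%:C * c12 n)
   (ci * (alpha P)%:C * (sin (theta P))%:C).
set DY2 := wave (-1) (fun n => ci * b1 n * c21 n) (fun n => ci * b2 n * c22 n)
   (- (ci * (beta P)%:C) * (- cos (theta P))%:C).
have aW1 := wave_asymptotic 1 (sin (theta P))%:C t11 t12.
have aW2 := wave_asymptotic (-1) (- cos (theta P))%:C t21 t22.
have aY1 := wave_asymptotic 1 (- (ci * (beta P)%:C) * (sin (theta P))%:C) (tameM tb1 t11) (tameM tb2 t12).
have aX1 := wave_asymptotic 1 (ci * (alpha P)%:C * (sin (theta P))%:C) (tameM ta t11) (tameM ta t12).
have aY2 := wave_asymptotic (-1) (- (ci * (beta P)%:C) * (- cos (theta P))%:C) (tameM tb1 t21) (tameM tb2 t22).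
have aT1 := trig_asymptoticZ (mu P)%:C aY1.
have aT2 := trig_asymptoticD (trig_asymptoticZ (mu P)%:C aY2)
  (trig_asymptoticZ (lambda P + mu P)%:C (trig_asymptoticD aX1 aY2)).
pose F := flux2 (mu P) (lambda P + mu P) (Cre \o u.1) (Cre \o u.2) (Cim \o u.1) (Cim \o u.2).
have FE x y : top + 1 <= y -> x \in `]0, L[ -> F (x, y) =
    cross (W1 (x, y)) ((mu P)%:C * DY1 (x, y)) +
    cross (W2 (x, y)) ((mu P)%:C * DY2 (x, y) + (lambda P + mu P)%:C * (DX1 (x, y) + DY2 (x, y))).
  rewrite in_itv /= => hy hx; have ytop : top < y by lra.
  have [e1 e2] : u.1 (x, y) = W1 (x, y) /\ u.2 (x, y) = W2 (x, y) by exact: far_field_wave.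
  have near_y : \forall t \near y, top < t.
    by apply: (open_nbhs_nbhs (A := [set t | top < t])); split; [exact: open_gt|].
  have near_x : \forall t \near x, 0 < t < L.
    have := @near_in_itvoo R 0 L x; rewrite in_itv /= => /(_ hx).
    by apply: filterS => t; rewrite in_itv.
  have Ey t : top < t -> u.1 (x, t) = W1 (x, t) /\ u.2 (x, t) = W2 (x, t).
    by move=> ht; exact: far_field_wave.
  have Ex t : 0 < t < L -> u.1 (t, y) = W1 (t, y) /\ u.2 (t, y) = W2 (t, y).
    by move=> ht; exact: far_field_wave.
  rewrite /F flux2_cross e1 e2.
  have -> : cdy u.1 (x, y) = DY1 (x, y).
    apply: cdy_val; apply: is_cderive_near (wave_dy 1 (sin (theta P))%:C x t11 t12 ytop).
    by apply: filterS near_y => t /Ey[].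
  have -> : cdy u.2 (x, y) = DY2 (x, y).
    apply: cdy_val; apply: is_cderive_near (wave_dy (-1) (- cos (theta P))%:C x t21 t22 ytop).
    by apply: filterS near_y => t /Ey[].
  have -> // : cdx u.1 (x, y) = DX1 (x, y).
  apply: cdx_val; apply: is_cderive_near (wave_dx 1 (sin (theta P))%:C x t11 t12 ytop).
  by apply: filterS near_x => t /Ex[].
have Fint y : top + 1 <= y -> leb.-integrable `]0, L[ (fun x => (F (x, y))%:E).
  move=> hy; apply: (@integrableS _ _ _ leb `[0, L]) => //; first exact: subset_itv_oo_cc.
  apply: (@continuous_compact_integrable _ (fun x => F (x, y))); first exact: segment_compact.
  apply: continuous_subspaceT => x.
  have [F1x [F1y [F2x [F2y [_ hF _]]]]] := C1w_flux oD sola solb.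
  have Dp : D (x, y) by apply: region_upper => //=; lra.
  have [_ [h _] _ _ _] := hF _ Dp.
  exact/differentiable_continuous/derivable1_diffP.
have F0 y : top + 1 <= y -> (\int[leb]_(x in `]0%R, L[) (F (x, y))%:E = 0)%E.
  by move=> hy; apply: (scattering_flux_eq0 L0 hS hu); lra.
case: (asymptotic_flux_balance (w := fun n => omega P ^+ 2 * order_energy n)
  L0 aW1 aT1 aW2 aT2 FE Fint F0) => [n y|N0 hN0]; last first.
  by exists N0 => N /hN0; rewrite -mulr_sumr => /eqP; rewrite mulf_eq0 (negbTE om20) => /eqP.
have [p0 bE0] := order0_propagating hP.
have real1 : `|al n| < k1 -> b1 n = (Cre (b1 n))%:C.
  by move=> h; apply: complex_eq => //; have [] := betan_propagating h.
have real2 : `|al n| < k2 -> b2 n = (Cre (b2 n))%:C.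
  by move=> h; apply: complex_eq => //; have [] := betan_propagating h.
set a := al n; set x1 := Cre (b1 n) in real1 *; set x2 := Cre (b2 n) in real2 *.
have aE : n = 0 -> (alpha P)%:C = a%:C by move=> n0; rewrite /a n0 alphan0.
have bE : n = 0 -> (beta P)%:C = x1%:C by move=> n0; rewrite /x1 n0 bE0.
have sE : n = 0 -> (sin (theta P))%:C = ci * a%:C * r0 P by move=> n0; rewrite /a n0 polarization_sin.
have cE : n = 0 -> (- cos (theta P))%:C = - (ci * x1%:C) * r0 P.
  by move=> n0; rewrite polarization_cos (bE n0) mulNr.
set A := amp1 n y; set B := amp2 n y; set I := amp0 n y.
rewrite (@wave_coefE 1 _ _ _ (ci * a%:C) (ci * x2%:C) (ci * a%:C)); first last.
- exact: sE.
- by move=> /real2 e; rewrite /c12 e.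
- by [].
rewrite (@wave_coefE 1 _ _ _ (ci * x1%:C * (ci * a%:C)) (ci * x2%:C * (ci * x2%:C)) (- (ci * x1%:C * (ci * a%:C)))); first last.
- by move=> n0; rewrite (bE n0) (sE n0); ring.
- by move=> /real2 e; rewrite /c12 -/(b2 n) e; ring.
- by move=> /real1 e; rewrite /c11 -/(b1 n) e -/a; ring.
rewrite (@wave_coefE (-1) _ _ _ (ci * x1%:C) (ci * a%:C) (- (ci * x1%:C))); first last.
- exact: cE.
- by [].
- by move=> /real1 e; rewrite /c21 e.
rewrite (@wave_coefE (-1) _ _ _ (ci * x1%:C * (ci * x1%:C)) (ci * x2%:C * (ci * a%:C)) (ci * x1%:C * (ci * x1%:C))); first last.
- by move=> n0; rewrite (bE n0) (cE n0); ring.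
- by move=> /real2 e; rewrite /c22 -/(b2 n) e -/a; ring.
- by move=> /real1 e; rewrite /c21 -/(b1 n) e; ring.
rewrite (@wave_coefE 1 _ _ _ (ci * a%:C * (ci * a%:C)) (ci * a%:C * (ci * x2%:C)) (ci * a%:C * (ci * a%:C))); first last.
- by move=> n0; rewrite (aE n0) (sE n0); ring.
- by move=> /real2 e; rewrite /c12 e -/a; ring.
- by rewrite /c11 -/a => _; ring.
rewrite -/A -/B -/I.
have phase1 : `|al n| < k1 -> normsq (E1 n y) = 1.
  by move=> /real1 e; rewrite normsq_cexp /= -/x1 e -rmorphM ReM /= !(mul0r, mulr0, subr0) expR0 expr1n.
have phase2 : `|al n| < k2 -> normsq (E2 n y) = 1.
  by move=> /real2 e; rewrite normsq_cexp /= -/x2 e -rmorphM ReM /= !(mul0r, mulr0, subr0) expR0 expr1n.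
have normsq0 : normsq (0 : R[i]) = 0 by rewrite /normsq /= expr0n addr0.
have -> : order_energy n = x1 * normsq A + x2 * normsq B - x1 * normsq I.
  rewrite /order_energy /A /B /I /amp1 /amp2 /amp0 -/x1 -/x2; congr (_ + _ - _).
  - by case: ifP => [/phase1 e|_]; [rewrite normsqM e mulr1|rewrite mul0r normsq0 mulr0].
  - by case: ifP => [/phase2 e|_]; [rewrite normsqM e mulr1|rewrite mul0r normsq0 mulr0].
  - case: eqP => [n0|_]; last by rewrite normsq0 mulr0.
    rewrite /x1 n0 bE0 normsqM; congr (_ * _).
    by rewrite normsq_cexp ReM /= !(mul0r, mulr0, subr0) expR0 expr1n mulr1.
have rel1 : (A = 0 /\ I = 0) \/ (mu P + (lambda P + mu P)) * (a ^+ 2 + x1 ^+ 2) = omega P ^+ 2.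
  have [h|h] := boolP (`|al n| < k1); [right|left].
    have [_ _ ->] := betan_propagating h; rewrite -(kappa1_sqr hP) -/a; ring.
  rewrite /A /I /amp1 /amp0 (negbTE h) mul0r; split => //.
  by case: eqP => // n0; move: h; rewrite n0 p0.
have rel2 : B = 0 \/ mu P * (a ^+ 2 + x2 ^+ 2) = omega P ^+ 2.
  have [h|h] := boolP (`|al n| < k2); [right|left].
    have [_ _ ->] := betan_propagating h; rewrite -(kappa2_sqr hP) -/a; ring.
  by rewrite /B /amp2 (negbTE h) mul0r.
rewrite -(flux_algebra rel1 rel2); congr (cross _ _ + cross _ _); ring.
Qed.
End FarField.

(** * Grating efficiencies *)

Section Efficiencies.
Context {R : realType} (P : params R).

Lemma sqr_norm_normsq (z : R[i]) : `|z| ^+ 2 = (normsq z)%:C.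
Proof. by rewrite normc_def -rmorphXn/= sqr_sqrtr// addr_ge0 ?sqr_ge0. Qed.

Lemma normsq_gt0 (z : R[i]) : z != 0 -> 0 < normsq z.
Proof. by move=> z0; rewrite -sqr_normcE exprn_gt0// lt_def normc_ge0 andbT; apply: contra_neq z0 => /eq0_normc. Qed.

(** A propagating wave has the same modulus at every height, so an efficiency
    is a ratio of energies. *)
Lemma efficiency_propagating (kap : R) (f : R[i]) (n : int) : `|alphan P n| < kap ->
  betan P kap n * `|f * cexp (- (ci * betan P kap n * (hgt P)%:C))| ^+ 2 /
    ((beta P)%:C * `|r0 P| ^+ 2) =
  (Cre (betan P kap n) * normsq f / (beta P * normsq (r0 P)))%:C.
Proof.
move=> h; have [im0 _ _] := betan_propagating h.
rewrite !sqr_norm_normsq normsqM normsq_cexp !(ReN, ReM, ImM) /= im0.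
rewrite !(mul0r, mulr0, subr0, addr0, subrr, oppr0, sub0r) expR0 expr1n mulr1.
rewrite [in LHS](_ : betan P kap n = (Cre (betan P kap n))%:C); last exact: complex_eq.
by rewrite -!rmorphM -fmorphV -rmorphM.
Qed.

Lemma psumZ_delta (N : nat) : psumZ (fun n => if n == 0 then 1 else 0 : R[i]) N = 1.
Proof.
elim: N => [|N IH]; first by rewrite psumZ0 eqxx.
by rewrite psumZS IH /= !addr0.
Qed.

End Efficiencies.

Theorem theorem2p2 (R : realType) (P : params R) (S : set (R * R)) (u : vfield R)
    (hP : admissible P) (hS : periodic_surface P S)
    (hu : scattering_solution P S u) :
  \sum_(n \in U1 P) e1 P u n + \sum_(n \in U2 P) e2 P u n = 1.
Proof.
have L0 : 0 < Lam P by have [[]] := hP.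
have [N0 bal] := energy_balance hP hS hu.
have [N1 hN1] := propagating_order_bound L0 (kappa1 P).
have [N2 hN2] := propagating_order_bound L0 (kappa2 P).
(* Beyond [N] no order propagates, so the partial sums up to [N] are the whole sums. *)
pose N := maxn N0 (maxn N1 N2).
have le1 n : `|alphan P n| < kappa1 P -> (`|n| <= N)%N.
  by move=> /hN1/ltnW h; rewrite /N !leq_max h orbT.
have le2 n : `|alphan P n| < kappa2 P -> (`|n| <= N)%N.
  by move=> /hN2/ltnW h; rewrite /N !leq_max h !orbT.
rewrite [X in X + _](fsum_psumZ _ le1) [X in _ + X](fsum_psumZ _ le2).
pose q := beta P * normsq (r0 P).
have q0 : q != 0.
  rewrite mulf_neq0 ?gt_eqF ?beta_gt0// normsq_gt0//.
  have k0 := kappa1_gt0 hP; rewrite r0E; apply/eqP => /(congr1 (@complex.Im R)).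
  by rewrite ImN ImM /= mul0r add0r mul1r => /eqP; rewrite oppr_eq0 invr_eq0 gt_eqF.
(* The incident energy sits in order 0 only, where it accounts for the 1. *)
rewrite -[RHS](psumZ_delta N).
have : \sum_(0 <= k < N.*2.+1) (order_energy P u (k%:Z - N%:Z) / q)%:C = 0 :> R[i].
  by rewrite -rmorph_sum -mulr_suml bal ?leq_maxl// mul0r.
move=> /(congr1 (fun z => z + psumZ (fun n => if n == 0 then 1 else 0) N)).
rewrite add0r => <-; rewrite /psumZ -!big_split; apply: eq_bigr => k _.
move: (_ - _) => n /=.
have -> : (if `|alphan P n| < kappa1 P then e1 P u n else 0) =
   ((if `|alphan P n| < kappa1 P then Cre (beta1 P n) * normsq (phi1n P u n) else 0) / q)%:C.
  by case: ifP => [h|_]; [exact: efficiency_propagating|rewrite mul0r].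
have -> : (if `|alphan P n| < kappa2 P then e2 P u n else 0) =
   ((if `|alphan P n| < kappa2 P then Cre (beta2 P n) * normsq (phi2n P u n) else 0) / q)%:C.
  by case: ifP => [h|_]; [exact: efficiency_propagating|rewrite mul0r].
have -> : (if n == 0 then 1 else 0) = ((if n == 0 then q else 0) / q)%:C :> R[i].
  by case: ifP; rewrite ?mul0r// divff.
rewrite -!rmorphD; congr (_%:C); rewrite /order_energy -/q -!mulrDl; congr (_ / _).
by rewrite subrK.
Qed.
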